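(* Let $0<b_-<b_+<3b_-$ and put $r_0:=\dfrac{(3b_--b_+)^{1/2}}{2b_+}$. Let $b,\tilde b\in\mathbb{B}$, let $a(x):=\int_0^x b(s)\,\mathrm{d}s$ and $\tilde a(x):=\int_0^x\tilde b(s)\,\mathrm{d}s$ for $x\in\mathbb{R}$, and assume that there exists $r\in(0,r_0)$ such that $$\mathrm{supp}(\tilde a-a)\subset[-r,r].$$ If $0$ is an accumulation point of the set $\{\varepsilon\in(0,1] : \vartheta_\varepsilon=\vartheta\}$ (equality of maps on $C_0^\infty(\mathbb{R},\mathbb{R})$), then $\tilde b=b$ (as elements of $L^\infty(\mathbb{R})$).
   Context: Fix real numbers $b_\pm$ with $0<b_-<b_+<3b_-$. $\mathbb{B}$ denotes the (convex) set of non-decreasing real-valued functions $b\in L^\infty(\mathbb{R})$ with $\lim_{x\to\pm\infty}b(x)=b_\pm$. For $b\in\mathbb{B}$, let $a(x):=\int_0^x b(s)\,\mathrm{d}s$ and $v(x,\xi):=2(\xi-a(x))$. For $\xi\in\mathbb{R}$ let $h(\xi)$ be the self-adjoint operator in $L^2(\mathbb{R})$ which acts as $-\frac{\mathrm{d}^2}{\mathrm{d}x^2}+(\xi-a(x))^2$ on $C_0^\infty(\mathbb{R})$, with domain (independent of $\xi$) $\{u\in H^1(\mathbb{R}) : -u''+a^2u\in L^2(\mathbb{R})\}$. It has compact resolvent and simple eigenvalues $\lambda_1(\xi)<\lambda_2(\xi)<\cdots$. Let $\varphi_1(\cdot,\xi)$ be the eigenfunction of $h(\xi)$ associated with $\lambda_1(\xi)$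 that is normalized in $L^2(\mathbb{R})$, real-valued and positive on $\mathbb{R}$. The current operator of $b$ is the map $$\vartheta(\chi):=\int_{\mathbb{R}}\chi(\xi)^2\,\langle v(\cdot,\xi)\varphi_1(\cdot,\xi),\varphi_1(\cdot,\xi)\rangle_{L^2(\mathbb{R})}\,\mathrm{d}\xi,\qquad \chi\in C_0^\infty(\mathbb{R},\mathbb{R}).$$ Given $b,\tilde b\in\mathbb{B}$ and $\varepsilon\in(0,1]$, put $b_\varepsilon:=(1-\varepsilon)b+\varepsilon\tilde b\in\mathbb{B}$; $\vartheta_\varepsilon$ denotes the current operator of $b_\varepsilon$, i.e. the map defined as $\vartheta$ with $b$ replaced by $b_\varepsilon$ throughout. *)

(* Defs.v *)
From HB Require Import structures.
From mathcomp Require Import all_boot all_order all_algebra.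
From mathcomp Require Import all_classical all_reals all_analysis.

Set Implicit Arguments.
Unset Strict Implicit.
Unset Printing Implicit Defensive.

Import Order.TTheory GRing.Theory Num.Theory.
Import numFieldNormedType.Exports.

Local Open Scope classical_set_scope.
Local Open Scope ring_scope.

(* Elements of Lebesgue spaces are represented by functions R -> R; the
   Hilbert space is the real L^2(R), which loses nothing here because the
   operators below have real coefficients. *)

Section MagneticSteps.
Variable R : realType.
Implicit Types (b V u w g p phi chi : R -> R) (xi l : R).

Notation mu := (@lebesgue_measure R).

Definition supp (f : R -> R) : set R := closure [set x | f x != 0].

(* C_0^oo(R, R): smooth functions with compact support *)
Definition test_fun : set (R -> R) :=
  [set p | (forall n x, derivable (derive1n n p) x 1) /\ compact (supp p)].

Definition profiles (bm bp : R) : set (R -> R) :=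
  [set b | [/\ b \in Lfun mu +oo%E, {homo b : x y / x <= y},
               b x @[x --> -oo] --> bm & b x @[x --> +oo] --> bp]].

(* \int_0^x b for either sign of x: one of the two intervals is always
   empty or reduced to a point *)
Definition potential b (x : R) : R :=
  \int[mu]_(t in `[0, x]) b t - \int[mu]_(t in `[x, 0]) b t.

Definition velocity b xi (x : R) : R := 2 * (xi - potential b x).

Definition inner u w : R := \int[mu]_x (u x * w x).

Definition L2 : set (R -> R) := [set u | u \in Lfun mu 2%:E].

Definition weak_derivative u w : Prop :=
  forall p, test_fun p -> inner u (derive1 p) = - inner w p.

Definition H1 : set (R -> R) :=
  [set u | L2 u /\ exists2 w, L2 w & weak_derivative u w].

(* - u'' + V u = g in the sense of distributions *)
Definition schrodinger V u g : Prop :=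
  forall p, test_fun p -> inner u (fun x => - derive1n 2 p x + V x * p x) = inner g p.

Definition h_domain b : set (R -> R) :=
  [set u | H1 u /\
    exists2 g, L2 g & schrodinger (fun x => potential b x ^+ 2) u g].

(* The graph of h(xi): g = h(xi) u.  A self-adjoint operator extending the
   differential expression on test functions is a restriction of its
   distributional realization, so on the domain it acts in this way. *)
Definition h_graph b xi u g : Prop :=
  [/\ h_domain b u, L2 g & schrodinger (fun x => (xi - potential b x) ^+ 2) u g].

Definition eigenfunction b xi l u : Prop :=
  ~ {ae mu, forall x, u x = 0} /\ h_graph b xi u (fun x => l * u x).

Definition eigenvalue b xi : set R :=
  [set l | exists u, eigenfunction b xi l u].

Definition lambda1 b xi : R := inf (eigenvalue b xi).

(* Continuity selects the representative of the class for which pointwise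
   positivity is meaningful; it makes phi unique. *)
Definition ground_state b xi phi : Prop :=
  [/\ eigenfunction b xi (lambda1 b xi) phi, inner phi phi = 1,
      continuous phi & forall x, 0 < phi x].

Definition phi1 b xi : R -> R := xget (fun=> 0) [set phi | ground_state b xi phi].

Definition current b chi : R :=
  \int[mu]_xi (chi xi ^+ 2 *
    inner (fun x => velocity b xi x * phi1 b xi x) (phi1 b xi)).

Definition same_current b b' : Prop :=
  forall chi, test_fun chi -> current b chi = current b' chi.

Definition mix (b b' : R -> R) (e : R) : R -> R :=
  fun x => (1 - e) * b x + e * b' x.

End MagneticSteps.

(* Main.v *)
Require Import Defs.
From HB Require Import structures.
From mathcomp Require Import all_boot all_order all_algebra.
From mathcomp Require Import all_classical all_reals all_analysis.
From mathcomp Require Import measurable_realfun ring lra.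
Import Order.TTheory GRing.Theory Num.Theory.
Import numFieldNormedType.Exports.
Local Open Scope classical_set_scope.
Local Open Scope ring_scope.

(** Let a be the vector potential of b, let d be the difference of the two
    vector potentials, supported in [-r, r], and let lambda(xi) and phi be the
    lowest eigenvalue and the ground state of u |-> - u'' + (xi - a)^2 u.

    The current determines lambda.  By Hellmann-Feynman the mean velocity is the
    derivative of lambda, so equal currents force the two lowest eigenvalues to
    differ by a constant; for large xi the well sits far away from [-r, r] and
    the constant is 0 ([same_current_energy]).  In place of derivatives the
    proof compares supergradients: lambda - xi^2 is an infimum of affine functions
    of xi, hence concave, and the mean of the potential in the state phi provides
    its slopes ([energy_supergradient], [supergradient_increment]).

    At xi = 0 one is left with the potentials a^2 and (a + e d)^2 having the same
    lowest eigenvalue for arbitrarily small e > 0.  Put X = int 2 a d phi^2 and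
    Y = int d^2 phi^2.  An identity for the Wronskian of the two ground states,
    followed by a Poincare inequality on [-r, r], yields
      0 <= e X + e^2 Y <= th e^2 Y   with th = 4 bp^2 r^4
    ([second_order_balance]).  The condition on r makes [-r, r] classically
    allowed, which the Poincare inequality uses, and makes th < 1.  Dividing by e
    and letting e tend to 0 gives X >= 0 from the left inequality, and then
    (1 - th) Y <= 0 from the right one.  Hence Y = 0, and d = 0 because phi has no
    zero ([perturbation_vanishes]).

    The spectral input is that the lowest eigenvalue lies in [bm, bp] and that
    phi is a positive classical square integrable solution ([phi1_spec]).
    Existence comes from shooting: the potential lies between two parabolas, and
    bp < 3 bm says that every energy up to bp is below the first Dirichlet
    eigenvalue 3 bm of the lower oscillator on a half line, so on each half line
    there is a unique decaying solution, and the two are matched by varying the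
    energy ([positive_bound_state]).  Minimality follows from Jacobi's
    factorisation by the positive solution ([variational_inequality]), and
    distributional eigenfunctions are classical by a one-dimensional Weyl lemma
    ([weak_solution_classical]). *)

Set Implicit Arguments.
Unset Strict Implicit.
Unset Printing Implicit Defensive.

(** * Pointwise derivatives on the line *)

(** Differentiation rules are applied by unification with the shape of the
    function; a name of its own keeps [is_derive] out of type class resolution. *)
Definition der_at {R : realType} (x : R) (f : R -> R) (l : R) : Prop :=
  is_derive x (1 : R) f l.

Definition has_der {R : realType} (f g : R -> R) : Prop :=
  forall x : R, der_at x f (g x).

Section Calculus.
Context {R : realType}.
Implicit Types (f g F G u v K : R -> R) (a b c x y l : R).

Lemma der_eq {x f l} l' : der_at x f l -> l = l' -> der_at x f l'.
Proof. by move=> h <-. Qed.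

Lemma der_cst x c : der_at x (fun _ => c) 0.
Proof. exact: is_derive_cst. Qed.

Lemma der_id x : der_at x (fun y => y) 1.
Proof. exact: is_derive_id. Qed.

Lemma derD {x f g a b} : der_at x f a -> der_at x g b ->
  der_at x (fun y => f y + g y) (a + b).
Proof. by move=> hf hg; exact: (is_deriveD hf hg). Qed.

Lemma derN {x f a} : der_at x f a ->
  der_at x (fun y => - f y) (- a).
Proof. by move=> hf; exact: (is_deriveN hf). Qed.

Lemma derM {x f g a b} : der_at x f a -> der_at x g b ->
  der_at x (fun y => f y * g y) (a * g x + f x * b).
Proof.
move=> hf hg; apply: (der_eq (is_deriveM hf hg)).
by rewrite addrC /GRing.scale /= [g x * a]mulrC.
Qed.

Lemma derX {x f a} n : der_at x f a ->
  der_at x (fun y => f y ^+ n)%R (n%:R * f x ^+ n.-1 * a).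
Proof.
move=> hf; elim: n => [|n IH]; first by rewrite !mul0r; exact: der_cst.
have -> : (fun y => f y ^+ n.+1) = (fun y => f y ^+ n * f y).
  by apply/funext => y; rewrite exprSr.
apply: (der_eq (derM IH hf)); case: n {IH} => [|n] /=.
  by rewrite !expr0; ring.
rewrite -[in RHS]natr1 exprSr; ring.
Qed.

Lemma derV {x f a} : f x != 0 -> der_at x f a ->
  der_at x (fun y => (f y)^-1) (- (f x) ^- 2 * a).
Proof. by move=> f0 hf; exact: (is_deriveV f0 hf). Qed.

Lemma der_comp {x f g a b} : der_at (g x) f a ->
  der_at x g b -> der_at x (fun y => f (g y)) (a * b).
Proof. by move=> hf hg; exact: (is_derive1_comp hf hg). Qed.

Lemma der_exp {x g b} : der_at x g b ->
  der_at x (fun y => expR (g y)) (expR (g x) * b).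
Proof. by move=> h; exact: (der_comp (is_derive_expR (g x)) h). Qed.

Lemma der_continuous {f x l} : der_at x f l -> {for x, continuous f}.
Proof. by move=> h; apply: differentiable_continuous; apply/derivable1_diffP; case: h. Qed.

Lemma has_der_continuous f g : has_der f g -> continuous f.
Proof. by move=> h x; exact: der_continuous (h x). Qed.

Lemma continuous_in (D : set R) f : continuous f -> {within D, continuous f}.
Proof. by move=> cf; exact: continuous_subspaceT. Qed.

Lemma der_MVT f g a b : a < b -> (forall x, a <= x <= b -> der_at x f (g x)) ->
  exists2 c, a < c < b & f b - f a = g c * (b - a).
Proof.
move=> ab h.
have h1 x : x \in `]a, b[%R -> der_at x f (g x).
  by rewrite in_itv /= => /andP[ax xb]; apply: h; rewrite !ltW.
have h2 : {within `[a, b], continuous f}.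
  apply: continuous_in_subspaceT => x; rewrite inE /= in_itv /= => xab.
  exact: der_continuous (h x xab).
by have [c] := MVT ab h1 h2; rewrite in_itv /= => cab E; exists c.
Qed.

Lemma der_ge0_le f g a b : a <= b ->
  (forall x, a <= x <= b -> der_at x f (g x)) ->
  (forall x, a < x < b -> 0 <= g x) -> f a <= f b.
Proof.
rewrite le_eqVlt => /orP[/eqP-> //|ab] h g0.
have [c cab E] := der_MVT ab h.
by rewrite -subr_ge0 E mulr_ge0 ?g0 // subr_ge0 ltW.
Qed.

Lemma der_gt0_lt f g a b : a < b ->
  (forall x, a <= x <= b -> der_at x f (g x)) ->
  (forall x, a < x < b -> 0 < g x) -> f a < f b.
Proof.
move=> ab h g0; have [c cab E] := der_MVT ab h.
by rewrite -subr_gt0 E mulr_gt0 ?g0 // subr_gt0.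
Qed.

Lemma der_le0_ge f g a b : a <= b ->
  (forall x, a <= x <= b -> der_at x f (g x)) ->
  (forall x, a < x < b -> g x <= 0) -> f b <= f a.
Proof.
move=> ab h g0; rewrite -lerN2.
apply: (@der_ge0_le (fun x => - f x) (fun x => - g x)) => // x xab.
  exact/derN/h.
by rewrite oppr_ge0 g0.
Qed.

Lemma der_eq0_eq f g a b : a <= b ->
  (forall x, a <= x <= b -> der_at x f (g x)) ->
  (forall x, a < x < b -> g x = 0) -> f a = f b.
Proof.
move=> ab h g0; apply/le_anti/andP; split.
- by apply: (der_ge0_le ab h) => x /g0 ->.
- by apply: (der_le0_ge ab h) => x /g0 ->.
Qed.

End Calculus.

Ltac der_step := first
  [ apply: der_cst | apply: der_id
  | match goal with H : has_der _ _ |- _ => apply: H end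
  | eassumption
  | apply: derD | apply: derN | apply: derX | apply: derM
  | apply: der_exp ].
Ltac der := eapply der_eq; [ repeat der_step | cbv beta ].

(** * Primitives of locally integrable functions *)

Section Primitives.
Context {R : realType}.
Notation mu := (@lebesgue_measure R).
Implicit Types (f g F G u v K : R -> R) (a b c x y l : R).

Definition locint f := forall a b, mu.-integrable `[a, b] (EFin \o f).

Lemma continuous_locint f : continuous f -> locint f.
Proof.
move=> cf a b; apply: continuous_compact_integrable.
  exact: segment_compact.
exact: continuous_in.
Qed.

Lemma potentialB f x y : locint f -> x <= y ->
  potential f y - potential f x = \int[mu]_(t in `[x, y]) f t.
Proof.
move=> lf xy.
have split (a c d : R) : a <= c -> c <= d ->
    \int[mu]_(t in `[a, d]) f t = \int[mu]_(t in `[a, c]) f t + \int[mu]_(t in `[c, d]) f t.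
  move=> ac cd; apply/eqP; rewrite addrC -subr_eq; apply/eqP.
  rewrite Rintegral_itvB ?bnd_simp //.
  by rewrite Rintegral_itv_obnd_cbnd //; apply: integrableS (lf c d) => //; exact: subset_itv_oc_cc.
have I0 (c d : R) : d <= c -> \int[mu]_(t in `[c, d]) f t = 0.
  rewrite le_eqVlt => /orP[/eqP->|dc]; first by rewrite set_itv1 Rintegral_set1.
  by rewrite set_itv_ge ?Rintegral_set0 // bnd_simp -ltNge.
rewrite /potential.
have [x0|x0] := leP 0 x.
  rewrite (I0 y 0) ?(le_trans x0) // (I0 x 0) // (split 0 x y) //; ring.
have [y0|y0] := leP 0 y.
  by rewrite (I0 y 0) // (I0 0 x (ltW x0)) (split x 0 y (ltW x0) y0); ring.
by rewrite (I0 0 x (ltW x0)) (I0 0 y (ltW y0)) (split x y 0 xy (ltW y0)); ring.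
Qed.

Lemma potential0 f : potential f 0 = 0.
Proof. by rewrite /potential subrr. Qed.

(** The fundamental theorem of calculus for a fixed lower end point a only
    concerns x > a; taking a to the left of both 0 and x and using
    [potentialB] gives the primitive normalised at 0 on the whole line. *)
Lemma has_der_potential f : continuous f -> has_der (potential f) f.
Proof.
move=> cf x; have lf := continuous_locint cf.
pose F y := \int[mu]_(t in `[x - 1, y]) f t.
have [d1 d2] : derivable F x 1 /\ derive1 F x = f x.
  apply: (@continuous_FTC1_closed _ f (x - 1) x (x + 1)) => //; first [exact: cf | lra].
have dF : der_at x F (f x).
  by have := derivableP d1; rewrite -derive1E d2.
have dG := derD dF (der_cst x (potential f (x - 1))).
rewrite addr0 in dG.
apply: near_eq_is_derive dG.
near=> y; rewrite /F -potentialB //; first ring.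
near: y; exists 1 => //= y /=; rewrite ltr_norml => /andP[_]; rewrite ltrBlDr => h; rewrite lerBlDr addrC ltW.
Unshelve. all: by end_near. Qed.

Lemma has_der_unique f g h : has_der f h -> has_der g h -> f 0 = g 0 -> f =1 g.
Proof.
move=> hf hg fg x; apply/eqP; rewrite -subr_eq0; apply/eqP.
have d y : der_at y (fun z => f z - g z) 0.
  by der; ring.
have -> : f x - g x = f 0 - g 0 by exact: (is_derive_0_is_cst _ _ d).
by rewrite fg subrr.
Qed.

End Primitives.

(** * The Cauchy problem for a linear second order equation *)

Section LinearODE.
Context {R : realType}.
Implicit Types (f g F G u v K : R -> R) (a b c x y l : R).

(** The derivative is monotone and vanishes at 0, so that 0 is a minimum. *)
Lemma convex_crit0_ge0 H H1 H2 (N : R) : has_der H H1 -> has_der H1 H2 ->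
  (forall x, `|x| <= N -> 0 <= H2 x) -> H1 0 = 0 -> 0 <= H 0 ->
  forall x, `|x| <= N -> 0 <= H x.
Proof.
move=> d1 d2 h2 h10 h0 x; rewrite ler_norml => /andP[xl xr].
have [x0|x0] := leP 0 x.
  apply: (le_trans h0); apply: (@der_ge0_le _ H H1) => // y /andP[y0 yx].
  rewrite -h10; apply: (@der_ge0_le _ H1 H2) => [|//|z /andP[z0 zy]]; first lra.
  by apply: h2; rewrite ler_norml; apply/andP; split; lra.
apply: (le_trans h0); apply: (@der_le0_ge _ H H1) => [|//|y /andP[y0 yx]]; first lra.
rewrite -h10; apply: (@der_ge0_le _ H1 H2) => [|//|z /andP[z0 zy]]; first lra.
by apply: h2; rewrite ler_norml; apply/andP; split; lra.
Qed.

(** Pointwise majorants pass to double primitives; this replaces estimates of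
    iterated integrals in Picard's scheme. *)
Lemma double_primitive_le f F F1 G G1 G2 (N : R) :
  has_der F F1 -> has_der F1 f -> F 0 = 0 -> F1 0 = 0 ->
  has_der G G1 -> has_der G1 G2 -> 0 <= G 0 -> G1 0 = 0 ->
  (forall x, `|x| <= N -> `|f x| <= G2 x) ->
  forall x, `|x| <= N -> `|F x| <= G x.
Proof.
move=> dF dF1 F0 F10 dG dG1 G0 G10 fG x xN; rewrite ler_norml; apply/andP; split.
  rewrite -subr_ge0 opprK.
  apply: (@convex_crit0_ge0 (fun x => F x + G x) (fun x => F1 x + G1 x)
    (fun x => f x + G2 x) N) => //.
  - by move=> y; der.
  - by move=> y; der.
  - by move=> y /fG; rewrite ler_norml => /andP[h _]; lra.
  - by rewrite F10 G10 addr0.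
  - by rewrite F0 add0r.
rewrite -subr_ge0.
apply: (@convex_crit0_ge0 (fun x => G x - F x) (fun x => G1 x - F1 x)
    (fun x => G2 x - f x) N) => //.
- by move=> y; der.
- by move=> y; der.
- by move=> y /fG; rewrite ler_norml => /andP[_ h]; lra.
- by rewrite F10 G10 subr0.
- by rewrite F0 subr0.
Qed.

Lemma small_geometric (D e : R) : 0 < e -> exists n, D / 2 ^+ n < e.
Proof.
move=> e0; pose n := Num.truncn (D / e); exists n.
have D1 : D / e < n.+1%:R.
  have [De|De] := leP 0 (D / e); first by case/andP: (truncn_itv De).
  by apply: lt_le_trans De _; rewrite ler0n.
have n2 : n.+1%:R <= 2 ^+ n :> R by rewrite -natrX ler_nat ltn_expl.
rewrite ltr_pdivrMr ?exprn_gt0 // mulrC -ltr_pdivrMr //; exact: lt_le_trans D1 n2.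
Qed.

Lemma geometric_half (B : R) n : B / 2 ^+ n = 2 * (B / 2 ^+ n.+1).
Proof. by rewrite exprS; field; rewrite expf_neq0. Qed.

(** A sequence with geometrically small increments is squeezed by the nested
    intervals [s n - 2B/2^n, s n + 2B/2^n]. *)
Lemma geometric_limit (s : nat -> R) (B : R) :
  (forall n, `|s n.+1 - s n| <= B / 2 ^+ n) ->
  exists l, forall n, `|l - s n| <= 2 * B / 2 ^+ n.
Proof.
move=> h; pose d n := B / 2 ^+ n.
have dS n : d n = 2 * d n.+1.
  exact: geometric_half.
have lo n : s n - 2 * d n <= s n.+1 - 2 * d n.+1.
  by move: (h n); rewrite -/(d n) ler_norml dS => /andP[h1 h2]; lra.
have up n : s n.+1 + 2 * d n.+1 <= s n + 2 * d n.
  by move: (h n); rewrite -/(d n) ler_norml dS => /andP[h1 h2]; lra.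
have d0 n : 0 <= d n by apply: le_trans (h n); exact: normr_ge0.
have lom n k : s n - 2 * d n <= s (n + k)%N - 2 * d (n + k)%N.
  elim: k => [|k IH]; rewrite ?addn0 // addnS; exact: le_trans IH (lo _).
have upm n k : s (n + k)%N + 2 * d (n + k)%N <= s n + 2 * d n.
  elim: k => [|k IH]; rewrite ?addn0 // addnS; exact: le_trans (up _) IH.
have lu n m : s n - 2 * d n <= s m + 2 * d m.
  have := lom n m; have := upm m n; rewrite addnC; have := d0 (n + m)%N; lra.
pose A := [set s n - 2 * d n | n in [set: nat]].
have uA m : ubound A (s m + 2 * d m) by move=> _ [n _ <-].
exists (sup A) => n; rewrite -mulrA -/(d n) ler_distl; apply/andP; split.
- by apply: ub_le_sup; [exists (s 0%N + 2 * d 0%N)|exists n].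
- by apply: ge_sup => //; exists (s 0%N - 2 * d 0%N), 0%N.
Qed.

Lemma continuous_bounded f (N : R) : continuous f ->
  exists2 M, 0 <= M & forall x, `|x| <= N -> `|f x| <= M.
Proof.
move=> cf; have [N0|N0] := leP 0 N; last first.
  by exists 0 => // x xN; have := le_lt_trans xN N0; rewrite normr_lt0.
have cg : continuous (fun x => `|f x|).
  by move=> x; apply: (continuous_comp (cf x)); exact: norm_continuous.
have NN : - N <= N by lra.
have [c _ cmax] := EVT_max NN (continuous_in (D := `[- N, N]%classic) cg).
exists `|f c| => // x; rewrite ler_norml => xN.
by apply: cmax; rewrite in_itv.
Qed.

Definition solves K u u1 := has_der u u1 /\ has_der u1 (fun x => K x * u x).

(** Picard iteration.  On [-N, N] the increments are measured against
    e^{kx} + e^{-kx}: integrating twice divides this weight by k^2, so for k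
    large the increments decay geometrically and no restriction on the length
    of the interval is needed. *)
Theorem linear_ode K (al be : R) : continuous K ->
  exists u u1, [/\ solves K u u1, u 0 = al & u1 0 = be].
Proof.
move=> cK.
pose lin x := al + be * x.
pose P f := potential (potential f).
have [v [v0 vS]] : exists v : nat -> R -> R,
    v 0%N = lin /\ forall n x, v n.+1 x = lin x + P (fun y => K y * v n y) x.
  by exists (fix v n := if n is n'.+1 then
    fun x => lin x + P (fun y => K y * v n' y) x else lin).
have clin : continuous lin.
  by apply: (@has_der_continuous _ _ (fun=> be)) => x; der; ring.
have dlin x : der_at x lin be by der; ring.
have cM f : continuous f -> continuous (fun y => K y * f y).
  by move=> cf x; exact: continuousM (cK x) (cf x).
have P1 f : continuous f -> has_der (P f) (potential f).
  by move=> cf; apply/has_der_potential/has_der_continuous/has_der_potential.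
have cP f : continuous f -> continuous (P f).
  by move=> cf; exact: has_der_continuous (P1 _ cf).
have P0 f : P f 0 = 0 by exact: potential0.
clearbody P.
have vS' n : v n.+1 = (fun x => lin x + P (fun y => K y * v n y) x).
  by apply/funext => x; exact: vS.
have cv n : continuous (v n).
  elim: n => [|n IH]; rewrite ?v0 // vS' => x; apply: continuousD; first exact: clin.
  exact/cP/cM.
have bound (N : R) : exists2 D, 0 <= D &
    forall x, `|x| <= N -> forall n, `|v n.+1 x - v n x| <= D / 2 ^+ n.
  have [M M0 hM] := continuous_bounded N cK.
  (* any k with 2 M <= k^2 makes each iteration halve the increment *)
  pose k := 2 * (1 + M).
  have k2 : 2 * M <= k ^+ 2 by rewrite /k expr2; nra.
  pose g x := expR (k * x) + expR (- (k * x)).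
  pose g1 x := k * (expR (k * x) - expR (- (k * x))).
  have dg : has_der g g1 by move=> x; der; rewrite /g1; ring.
  have dg1 : has_der g1 (fun x => k ^+ 2 * g x) by move=> x; der; rewrite /g; ring.
  have g0 x : 1 <= g x.
    rewrite /g; have [x0|x0] := leP 0 (k * x).
      have := expR_ge1Dx (k * x); have := expR_gt0 (- (k * x)); lra.
    have := expR_ge1Dx (- (k * x)); have := expR_gt0 (k * x); lra.
  have [C0 C00 hC0] : exists2 M, 0 <= M & forall x, `|x| <= N -> `|v 1%N x - v 0%N x| <= M.
    by apply: continuous_bounded => x; exact: continuousB (cv _ _) (cv _ _).
  have [G G0 hG] := continuous_bounded N (has_der_continuous dg).
  have step n x : `|x| <= N -> `|v n.+1 x - v n x| <= C0 / 2 ^+ n * g x.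
    elim: n x => [x xN|n IH].
      by rewrite expr0 divr1; apply: le_trans (hC0 x xN) _; have := g0 x; nra.
    pose B := C0 / 2 ^+ n.+1.
    have BE : C0 / 2 ^+ n = 2 * B.
      exact: geometric_half.
    have B0 : 0 <= B by rewrite /B divr_ge0 // exprn_ge0.
    rewrite -/B; clearbody B.
    apply: (@double_primitive_le (fun x => K x * v n.+1 x - K x * v n x)
      _ (fun x => potential (fun y => K y * v n.+1 y) x - potential (fun y => K y * v n y) x)
      _ (fun x => B * g1 x) (fun x => B * (k ^+ 2 * g x))).
    - move=> x; have h1 := P1 _ (cM _ (cv n.+1)); have h2 := P1 _ (cM _ (cv n)).
      have h3 := dlin x; have h4 : der_at x (v n.+2) (be + potential (fun y => K y * v n.+1 y) x).
        by rewrite (vS' n.+1); der.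
      have h5 : der_at x (v n.+1) (be + potential (fun y => K y * v n y) x).
        by rewrite (vS' n); der.
      by der; ring.
    - have h1 := has_der_potential (cM _ (cv n.+1)).
      by have h2 := has_der_potential (cM _ (cv n)) => x; der.
    - by rewrite !vS !P0; ring.
    - by rewrite !potential0 subrr.
    - by move=> x; der; ring.
    - by move=> x; der; ring.
    - by rewrite mulr_ge0 // (le_trans _ (g0 0)).
    - by rewrite /g1 mulr0 oppr0 subrr !mulr0.
    move=> x xN; rewrite -mulrBr normrM.
    have := IH x xN; rewrite BE => h.
    apply: le_trans (ler_pM (normr_ge0 _) (normr_ge0 _) (hM x xN) h) _.
    have gx := g0 x.
    have : 0 <= (k ^+ 2 - 2 * M) * (B * g x) by rewrite mulr_ge0 ?mulr_ge0 //; lra.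
    lra.
  exists (C0 * G); first exact: mulr_ge0.
  move=> x xN n; apply: le_trans (step n x xN) _.
  rewrite mulrAC ler_wpM2r ?invr_ge0 ?exprn_ge0 // ler_wpM2l //.
  by apply: le_trans (hG x xN); exact: ler_norm.
have /choice[w wP] x : exists l, forall n, forall D,
    (forall n, `|v n.+1 x - v n x| <= D / 2 ^+ n) -> `|l - v n x| <= 2 * D / 2 ^+ n.
  have [D D0 hD] := bound `|x|.
  have [l hl] := geometric_limit (hD x (lexx _)).
  exists l => n D' hD'; have [l' hl'] := geometric_limit hD'.
  suff -> : l = l' by exact: hl'.
  apply/eqP; rewrite -subr_eq0 -normr_le0 leNgt; apply/negP => ll.
  (* both limits are within a geometric error of the same v m x *)
  have [m hm] := small_geometric (2 * D + 2 * D') ll.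
  have := ler_distD (v m x) l l'; rewrite [`|v m x - l'|]distrC.
  move: (hl m) (hl' m) hm; rewrite mulrDl; lra.
have wB (N : R) : exists2 D, 0 <= D &
    forall n x, `|x| <= N -> `|w x - v n x| <= D / 2 ^+ n.
  have [D D0 hD] := bound N; exists (2 * D); first by lra.
  by move=> n x xN; apply: wP => m; exact: hD.
have cw : continuous w.
  move=> x; apply/cvgrPdist_lt => e e0.
  have [D D0 hD] := wB (`|x| + 1).
  have e3 : 0 < e / 3 by lra.
  have [n hn] := small_geometric D e3.
  have /cvgrPdist_lt /(_ _ e3) := cv n x.
  move=> hc; near=> y.
  have xy : `|x - y| < 1 by near: y; exists 1 => //=.
  have yN : `|y| <= `|x| + 1.
    have := ler_distD x y 0; rewrite !subr0 distrC; lra.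
  have h1 := hD n x ltac:(lra); have h2 := hD n y yN.
  have h3 : `|v n x - v n y| < e / 3 by near: y.
  have := ler_distD (v n x) (w x) (w y).
  have := ler_distD (v n y) (v n x) (w y).
  rewrite [`|v n y - w y|]distrC; lra.
have wE x : w x = lin x + P (fun y => K y * w y) x.
  apply/eqP; rewrite -subr_eq0 -normr_le0 leNgt; apply/negP => ll.
  have [D D0 hD] := wB `|x|.
  have [M M0 hM] := continuous_bounded `|x| cK.
  have [n hn] := small_geometric (D + M * D * x ^+ 2) ll.
  have h1 := hD n.+1 x (lexx _).
  have h1' : `|w x - v n.+1 x| <= D / 2 ^+ n.
    apply: le_trans h1 _; rewrite ler_wpM2l // lef_pV2 ?posrE ?exprn_gt0 //.
    by rewrite ler_weXn2l // ler1n.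
  pose B := M * D / 2 ^+ n.
  have B0 : 0 <= B by rewrite /B divr_ge0 ?mulr_ge0 // exprn_ge0.
  have BE : B = M * (D / 2 ^+ n) by rewrite mulrA.
  rewrite mulrDl mulrAC -/B in hn; clearbody B.
  have h2 : `|v n.+1 x - (lin x + P (fun y => K y * w y) x)| <= B * x ^+ 2.
    apply: (@double_primitive_le (fun x => K x * v n x - K x * w x)
      (fun x => v n.+1 x - (lin x + P (fun y => K y * w y) x))
      (fun x => potential (fun y => K y * v n y) x - potential (fun y => K y * w y) x)
      (fun x => B * x ^+ 2) (fun x => 2 * B * x) (fun x => 2 * B) `|x|) => //.
    - move=> y; have a1 := P1 _ (cM _ (cv n)); have a2 := P1 _ (cM _ cw).
      by have a3 := dlin y; rewrite (vS' n); der; ring.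
    - have a1 := has_der_potential (cM _ (cv n)).
      by have a2 := has_der_potential (cM _ cw) => y; der.
    - by rewrite vS !P0; ring.
    - by rewrite !potential0 subrr.
    - by move=> y; der; rewrite /=; ring.
    - by move=> y; der; ring.
    - by rewrite expr0n mulr0.
    - by rewrite mulr0.
    move=> y yx; rewrite -mulrBr normrM distrC.
    apply: le_trans (ler_pM (normr_ge0 _) (normr_ge0 _) (hM y yx) (hD n y yx)) _.
    by rewrite -BE; lra.
  have := ler_distD (v n.+1 x) (w x) (lin x + P (fun y => K y * w y) x).
  move: hn h1' h2; lra.
exists w, (fun x => be + potential (fun y => K y * w y) x); split.
- split => x.
    have h := P1 _ (cM _ cw); have h3 := dlin x.
    have E : (fun x => lin x + P (fun y => K y * w y) x) = w.
      by apply/funext => y; rewrite -wE.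
    by rewrite -[X in der_at _ X _]E; der.
  by have h := has_der_potential (cM _ cw); der; ring.
- by rewrite wE P0 /lin mulr0 !addr0.
- by rewrite potential0 addr0.
Unshelve. all: by end_near. Qed.

End LinearODE.

(** * Decaying solutions on a half line *)

Section HalfLine.
Context {R : realType}.
Implicit Types (f g F G u v K : R -> R) (a b x y t T : R).

(** Intermediate value theorem: no sign change without a zero. *)
Lemma sign_const f a b : a <= b -> continuous f -> 0 < f a ->
  (forall x, a <= x <= b -> f x != 0) -> 0 < f b.
Proof.
move=> ab cf fa f0; rewrite ltNge; apply/negP => fb.
have [|c] := @IVT R f a b 0 ab (continuous_in (D := `[a, b]%classic) cf).
  by rewrite ge_min le_max fb (ltW fa) orbT.
by rewrite in_itv /= => cab /eqP; apply/negP/f0.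
Qed.

Lemma solves_continuous K u u1 : solves K u u1 -> continuous u.
Proof. by case=> d _; exact: has_der_continuous d. Qed.

Lemma solves_continuous1 K u u1 : solves K u u1 -> continuous u1.
Proof. by case=> _ d; exact: has_der_continuous d. Qed.

Lemma solves_lin K c c1 s s1 (m : R) : solves K c c1 -> solves K s s1 ->
  solves K (fun t => c t + m * s t) (fun t => c1 t + m * s1 t).
Proof.
by move=> [dc dc1] [ds ds1]; split => t; der; ring.
Qed.

Lemma der_wronskian K1 K2 u u1 v v1 : solves K1 u u1 -> solves K2 v v1 ->
  has_der (fun t => u t * v1 t - u1 t * v t) (fun t => (K2 t - K1 t) * (u t * v t)).
Proof. by move=> [du du1] [dv dv1] t; der; ring. Qed.

(** Where the potential is nonnegative, a solution that starts positive and
    nondecreasing remains so, because (v v')' = v'^2 + K v^2 >= 0. *)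
Lemma increasing_solution K v v1 T : solves K v v1 ->
  (forall t, T <= t -> 0 <= K t) -> 0 < v T -> 0 <= v1 T ->
  forall t, T <= t -> [/\ v T <= v t, 0 <= v1 t & v1 T <= v1 t].
Proof.
move=> sv K0 vT v1T t Tt; have [dv dv1] := sv.
have vv1 s : T <= s -> 0 <= v s * v1 s.
  move=> Ts; apply: (le_trans (mulr_ge0 (ltW vT) v1T)).
  apply: (@der_ge0_le _ (fun s => v s * v1 s)
    (fun s => v1 s ^+ 2 + K s * v s ^+ 2)) => [//|x _|x /andP[Tx _]].
    by der; ring.
  by rewrite addr_ge0 ?sqr_ge0 // mulr_ge0 ?sqr_ge0 // K0 // ltW.
have vpos s : T <= s -> 0 < v s.
  move=> Ts; apply: (@sign_const v T s Ts (solves_continuous sv) vT) => x /andP[Tx _].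
  have : 0 < v x ^+ 2.
    apply: (@lt_le_trans _ _ (v T ^+ 2)); first by rewrite exprn_gt0.
    apply: (@der_ge0_le _ (fun s => v s ^+ 2) (fun s => 2 * (v s * v1 s))) => [//|z _|z /andP[Tz _]].
      by der; rewrite /=; ring.
    by rewrite mulr_ge0 // vv1 ?ltW.
  by rewrite exprn_even_gt0.
have v1pos s : T <= s -> 0 <= v1 s.
  by move=> Ts; have := vv1 s Ts; rewrite pmulr_rge0 // vpos.
split; last 2 first; first exact: v1pos.
- apply: (@der_ge0_le _ v1 (fun s => K s * v s)) => [//|z _|z /andP[Tz _]]; first exact: dv1.
  by rewrite mulr_ge0 ?K0 ?ltW ?vpos ?ltW.
- apply: (@der_ge0_le _ v v1) => [//|z _|z /andP[Tz _]]; first exact: dv.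
  by rewrite v1pos ?ltW.
Qed.

(** For a positive solution this follows from square integrability where the
    potential is nonnegative, and implies it where the potential is at least 1;
    being a condition on signs, it is directly amenable to comparison. *)
Definition decays u u1 := exists T, forall t, T <= t -> 0 < u t /\ u1 t <= 0.

Definition eventually_ge (k : R) K := exists T, forall t, T <= t -> k <= K t.

(** A convex nonincreasing positive function has slope O(1/t), so the
    Wronskian of two of them vanishes at infinity. *)
Lemma wronskian_vanishes K1 K2 u u1 v v1 : solves K1 u u1 -> solves K2 v v1 ->
  eventually_ge 0 K1 -> eventually_ge 0 K2 -> decays u u1 -> decays v v1 ->
  forall e, 0 < e -> exists T, forall t, T <= t -> `|u t * v1 t - u1 t * v t| <= e.
Proof.
move=> su sv [Ta Ka] [Tb Kb] [Tc uc] [Td vd] e e0.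
pose T := Num.max (Num.max Ta Tb) (Num.max Tc Td).
have TT t : T <= t -> [/\ Ta <= t, Tb <= t, Tc <= t & Td <= t].
  by rewrite !ge_max => /andP[/andP[-> ->] /andP[-> ->]].
have slope K w w1 : solves K w w1 -> (forall t, T <= t -> 0 <= K t) ->
    (forall t, T <= t -> 0 < w t /\ w1 t <= 0) ->
    forall t, T < t -> w t <= w T /\ - w1 t * (t - T) <= w T.
  move=> [dw dw1] K0 w0 t Tt; split.
    apply: (@der_le0_ge _ w w1) => [|z _|z /andP[Tz _]]; [exact: ltW|exact: dw|].
    by case: (w0 z (ltW Tz)).
  have [c /andP[Tc' ct] E] := @der_MVT _ w w1 T t Tt (fun z _ => dw z).
  have : w1 c <= w1 t.
    apply: (@der_ge0_le _ w1 (fun s => K s * w s)) => [|z _|z /andP[cz _]]; [exact: ltW|exact: dw1|].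
    have Tz : T <= z by lra.
    by rewrite mulr_ge0 ?K0 // ltW //; case: (w0 z Tz).
  have [wt _] := w0 t (ltW Tt); have : 0 < t - T by lra.
  nra.
have su' := slope _ _ _ su (fun t h => let: And4 h1 _ _ _ := TT t h in Ka t h1)
  (fun t h => let: And4 _ _ h1 _ := TT t h in uc t h1).
have sv' := slope _ _ _ sv (fun t h => let: And4 _ h1 _ _ := TT t h in Kb t h1)
  (fun t h => let: And4 _ _ _ h1 := TT t h in vd t h1).
have [uT _] : 0 < u T /\ u1 T <= 0 by case: (TT T (lexx _)) => _ _ h _; exact: uc.
have [vT _] : 0 < v T /\ v1 T <= 0 by case: (TT T (lexx _)) => _ _ _ h; exact: vd.
pose C := u T * v T / e.
have C0 : 0 < C by rewrite divr_gt0 ?mulr_gt0.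
exists (T + C) => t tC; have Tt : T < t by lra.
have [u_le u1_le] := su' t Tt; have [v_le v1_le] := sv' t Tt.
have [ut ut1] : 0 < u t /\ u1 t <= 0 by case: (TT t (ltW Tt)) => _ _ h _; exact: uc.
have [vt vt1] : 0 < v t /\ v1 t <= 0 by case: (TT t (ltW Tt)) => _ _ _ h; exact: vd.
have CE : C * e = u T * v T by rewrite /C mulfVK // gt_eqF.
have tT0 : 0 < t - T by lra.
have h3 : C * e <= (t - T) * e by apply: ler_wpM2r; [exact: ltW|lra].
have h1 : u t * - v1 t <= e.
  rewrite -(ler_pM2r tT0) -mulrA.
  apply: (@le_trans _ _ (u T * v T)); last by rewrite -CE [e * _]mulrC.
  by apply: ler_pM => //; [exact: ltW|rewrite mulr_ge0 ?oppr_ge0 // ltW].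
have h2 : - u1 t * v t <= e.
  rewrite -(ler_pM2r tT0) mulrAC.
  apply: (@le_trans _ _ (u T * v T)); last by rewrite -CE [e * _]mulrC.
  by apply: ler_pM => //; [rewrite mulr_ge0 ?oppr_ge0 // ltW|exact: ltW].
have h4 : 0 <= u t * - v1 t by rewrite mulr_ge0 ?oppr_ge0 // ltW.
have h5 : 0 <= - u1 t * v t by rewrite mulr_ge0 ?oppr_ge0 // ltW.
rewrite ler_norml; apply/andP; split; lra.
Qed.

(** Sturm comparison: the Wronskian is nonincreasing by the order of the
    potentials, and it vanishes at infinity. *)
Lemma decaying_comparison K1 K2 u u1 v v1 : solves K1 u u1 -> solves K2 v v1 ->
  eventually_ge 0 K1 -> eventually_ge 0 K2 -> decays u u1 -> decays v v1 ->
  (forall t, 0 <= t -> 0 < u t) -> (forall t, 0 <= t -> 0 < v t) ->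
  (forall t, 0 <= t -> K2 t <= K1 t) ->
  forall t, 0 <= t -> 0 <= u t * v1 t - u1 t * v t.
Proof.
move=> su sv eK1 eK2 du dv u0 v0 K21 t t0.
rewrite leNgt; apply/negP => J0.
pose J t := u t * v1 t - u1 t * v t; rewrite -/(J t) in J0.
have J0' : 0 < - J t / 2 by lra.
have [T hT] := wronskian_vanishes su sv eK1 eK2 du dv J0'.
pose s := Num.max T t.
have Ts : T <= s by rewrite le_max lexx.
have ts : t <= s by rewrite le_max lexx orbT.
have : J s <= J t.
  apply: (der_le0_ge ts (fun z _ => der_wronskian su sv z)) => z /andP[tz _].
  have z0 : 0 <= z by lra.
  have := K21 z z0; have := mulr_gt0 (u0 z z0) (v0 z z0); nra.
have := hT s Ts; rewrite -/(J s) ler_norml => /andP[h1 h2]; lra.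
Qed.

(** A decaying solution is square integrable at infinity, since
    u^2 <= K u^2 <= (u u')' and u u' <= 0. *)
Lemma decaying_square_bound K u u1 P : solves K u u1 -> eventually_ge 1 K ->
  decays u u1 -> has_der P (fun t => u t ^+ 2) -> exists M, forall t, P t <= M.
Proof.
move=> [du du1] [Ta Ka] [Tb ub] dP.
pose T := Num.max Ta Tb.
have Tab t : T <= t -> Ta <= t /\ Tb <= t by rewrite ge_max => /andP[].
have Pmono s t : s <= t -> P s <= P t.
  move=> st; apply: (@der_ge0_le _ P (fun t => u t ^+ 2)) => // z _.
  exact: sqr_ge0.
exists (P T - u T * u1 T) => t.
have [tT|Tt] := leP t T.
  have [u0 u10] := ub T (Tab T (lexx _)).2.
  have := Pmono _ _ tT; nra.
have : u T * u1 T - P T <= u t * u1 t - P t.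
  apply: (@der_ge0_le _ (fun t => u t * u1 t - P t)
    (fun t => u1 t ^+ 2 + (K t - 1) * u t ^+ 2)) => [|z _|z /andP[Tz _]]; first exact: ltW.
    by der; ring.
  rewrite addr_ge0 ?sqr_ge0 // mulr_ge0 ?sqr_ge0 // subr_ge0; apply: Ka.
  exact: (Tab z (ltW Tz)).1.
have [u0 u10] := ub t (Tab t (ltW Tt)).2; nra.
Qed.

End HalfLine.

(** * Existence of a decaying solution below the Dirichlet threshold *)

Section Principal.
Context {R : realType}.
Implicit Types (f g F G u v K : R -> R) (a b x y t T : R).

Lemma expR_ge_sqr x : 0 <= x -> x ^+ 2 / 4 <= expR x.
Proof.
move=> x0; have -> : expR x = expR (x / 2) ^+ 2.
  by rewrite expr2 -expRD; congr expR; lra.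
have h := expR_ge1Dx (x / 2).
have : 0 <= (expR (x / 2) - x / 2) * (expR (x / 2) + x / 2).
  by rewrite mulr_ge0 //; lra.
nra.
Qed.

Lemma der_pos_right s s1 : has_der s s1 -> continuous s1 -> s 0 = 0 -> s1 0 = 1 ->
  exists2 e, 0 < e & forall t, 0 < t <= e -> 0 < s t.
Proof.
move=> ds cs1 s0 s10.
have h1 : (0 : R) < 1 by [].
have /cvgrPdist_lt /(_ _ h1) := cs1 0; rewrite s10 => -[e /= e0 he].
exists (e / 2) => [|t /andP[t0 te]]; first by rewrite divr_gt0.
rewrite -s0; apply: (@der_gt0_lt _ s s1) => // z /andP[z0 zt].
have : `|0 - z| < e by rewrite sub0r normrN gtr0_norm //; lra.
by move/he; rewrite ltr_norml => /andP[_]; lra.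
Qed.

(** Comparison with the odd harmonic oscillator eigenfunction
    y = t e^{-be t^2/2}, y'' = (be^2 t^2 - 3 be) y: a potential above
    be^2 t^2 - 3 be lies below the threshold of the Dirichlet problem on the
    half line, so the Dirichlet solution has no further zero and does not stay
    bounded. *)
Section Dirichlet.
Variables (K s s1 : R -> R) (be : R).
Hypotheses (be0 : 0 < be) (ss : solves K s s1) (s0 : s 0 = 0) (s10 : s1 0 = 1).
Hypothesis K_gt : forall t, 0 <= t -> be ^+ 2 * t ^+ 2 - 3 * be < K t.

Let e t := expR (- (be / 2 * t ^+ 2)).
Let y t := t * e t.
Let y1 t := (1 - be * t ^+ 2) * e t.
Let N t := s1 t * y t - s t * y1 t.

Let e_gt0 t : 0 < e t. Proof. exact: expR_gt0. Qed.
Let de : has_der e (fun t => - (be * t) * e t).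
Proof. by move=> t; der; rewrite /e /=; field. Qed.
Let dy : has_der y y1.
Proof. by move=> t; rewrite /y /y1; have h := de; der; ring. Qed.
Let dy1 : has_der y1 (fun t => (be ^+ 2 * t ^+ 2 - 3 * be) * y t).
Proof. by move=> t; rewrite /y /y1; have h := de; der; rewrite /=; ring. Qed.
Let dN : has_der N (fun t => (K t - (be ^+ 2 * t ^+ 2 - 3 * be)) * (s t * y t)).
Proof.
move=> t; rewrite /N; have [h1 h2] := ss; have h3 := dy; have h4 := dy1.
by der; ring.
Qed.
Let y_gt0 t : 0 < t -> 0 < y t. Proof. by move=> t0; rewrite mulr_gt0. Qed.

(** The quotient s N / y of the two Dirichlet solutions, N their Wronskian, has
    derivative (N/y)^2 + (K - be^2 t^2 + 3 be) s^2 >= 0 and is positive near 0,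
    which keeps s away from 0.  Then N is nondecreasing too. *)
Lemma dirichlet_gt0_wronskian : (forall t, 0 < t -> 0 < s t) /\
  exists2 c, 0 < c & exists t0, forall t, t0 <= t -> c <= N t.
Proof.
have [ds ds1] := ss.
have [a a0 ha] := der_pos_right ds (solves_continuous1 ss) s0 s10.
have N0 : N 0 = 0 by rewrite /N /y s0; ring.
have Ka t : 0 <= t -> 0 < K t - (be ^+ 2 * t ^+ 2 - 3 * be) by rewrite subr_gt0; exact: K_gt.
have Na : 0 < N a.
  rewrite -N0; apply: (der_gt0_lt a0 (fun z _ => dN z)) => z /andP[z0 za].
  by rewrite mulr_gt0 ?Ka ?mulr_gt0 ?y_gt0 ?ha ?z0 // ltW.
have Q0 t : a <= t -> 0 < s t * N t / y t.
  move=> at'; have : s a * N a / y a <= s t * N t / y t.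
    apply: (@der_ge0_le _ (fun t => s t * N t / y t)
      (fun t => N t ^+ 2 / y t ^+ 2 + (K t - (be ^+ 2 * t ^+ 2 - 3 * be)) * s t ^+ 2)) => //.
      move=> z /andP[az _]; have yz : y z != 0 by rewrite gt_eqF // y_gt0 //; lra.
      have h1 := dN; have h2 := derV yz (dy z); der; rewrite /N /=.
      by field.
    move=> z /andP[az _]; rewrite addr_ge0 //.
      by rewrite divr_ge0 ?sqr_ge0.
    by rewrite mulr_ge0 ?sqr_ge0 // ltW // Ka //; lra.
  by apply: lt_le_trans; rewrite divr_gt0 ?y_gt0 // mulr_gt0 // ha // a0 lexx.
have spos t : 0 < t -> 0 < s t.
  move=> t0; have [ta|ta] := leP t a; first by rewrite ha // t0.
  apply: (@sign_const _ s a t (ltW ta) (solves_continuous ss)).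
    by rewrite ha // a0 lexx.
  by move=> z /andP[az _]; apply/eqP => sz; have := Q0 z az; rewrite sz !mul0r ltxx.
split=> //; exists (N a) => //; exists a => t at'.
apply: (der_ge0_le at' (fun z _ => dN z)) => z /andP[az _].
have z0 : 0 < z by lra.
by rewrite mulr_ge0 // ltW ?Ka ?ltW // mulr_gt0 ?spos ?y_gt0.
Qed.

Lemma dirichlet_gt0 t : 0 < t -> 0 < s t.
Proof. by case: dirichlet_gt0_wronskian => h _; exact: h. Qed.

(** If s decreased from some point on, it would be bounded, and the Wronskian
    with the Gaussian y would tend to 0. *)
Lemma dirichlet_increases T : exists2 t, T <= t & 0 < s1 t.
Proof.
have [spos [c c0 [t0 hc]]] := dirichlet_gt0_wronskian.
apply: contrapT => no.
have s1le t : T <= t -> s1 t <= 0.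
  by move=> Tt; rewrite leNgt; apply/negP => h; apply: no; exists t.
pose T1 := Num.max (Num.max T t0) 1.
have [TT1 [t0T1 T11]] : T <= T1 /\ t0 <= T1 /\ 1 <= T1.
  by rewrite /T1 !le_max !lexx !orbT.
pose S := s T1; have S0 : 0 < S by rewrite spos //; lra.
(* beyond this point the Gaussian bound S 2x e^{-x}, x = be t^2/2, for the
   Wronskian is smaller than c, by e^x >= x^2/4 *)
pose t := T1 + 16 * S / (c * be).
have q0 : 0 < 16 * S / (c * be) by rewrite divr_gt0 ?mulr_gt0.
have tq : t * (c * be) = T1 * (c * be) + 16 * S.
  by rewrite /t mulrDl mulfVK // gt_eqF ?mulr_gt0.
have T1t : T1 <= t by rewrite /t; lra.
have t1 : 1 <= t by lra.
have st : s t <= S.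
  have [ds _] := ss; apply: (der_le0_ge T1t (fun z _ => ds z)) => z /andP[az _].
  by apply: s1le; lra.
have Nc : c <= N t by apply: hc; lra.
pose x := be / 2 * t ^+ 2.
have x0 : 0 < x by rewrite /x mulr_gt0 ?divr_gt0 // exprn_gt0 //; lra.
have NE : N t <= S * (2 * x) * e t.
  have h1 : s1 t * y t <= 0 by rewrite mulr_le0_ge0 ?s1le //; [lra|rewrite ltW // y_gt0; lra].
  have h2 : 0 <= s t by rewrite ltW // spos; lra.
  have -> : N t = s1 t * y t - s t * e t + s t * (2 * x) * e t.
    by rewrite /N /y1 /x; field.
  have h3 : 0 <= s t * e t by rewrite mulr_ge0 // ltW.
  have h4 : s t * (2 * x) * e t <= S * (2 * x) * e t.
    by rewrite ler_wpM2r ?(ltW (e_gt0 t)) // ler_wpM2r //; lra.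
  lra.
have ex := expR_ge_sqr (ltW x0).
have eE : e t * expR x = 1 by rewrite /e -/x -expRD addNr expR0.
have h1 : c * expR x <= S * (2 * x).
  have -> : S * (2 * x) = S * (2 * x) * e t * expR x by rewrite -mulrA eE mulr1.
  apply: ler_wpM2r; first exact/ltW/expR_gt0.
  exact: le_trans Nc NE.
have h2 : c * (x ^+ 2 / 4) <= S * (2 * x).
  by apply: le_trans h1; rewrite ler_wpM2l // ltW.
have h3 : c * x <= 8 * S.
  rewrite -(ler_pM2r x0); move: h2; rewrite expr2; lra.
have h4 : c * be * t <= c * be * t ^+ 2.
  apply: ler_wpM2l; first by rewrite mulr_ge0 // ltW.
  by rewrite expr2 ler_peMl //; lra.
have : 0 < c * be by rewrite mulr_gt0.
move: h3; rewrite /x; nra.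
Qed.

End Dirichlet.

Definition fundamental K c c1 s s1 :=
  [/\ solves K c c1, solves K s s1, c 0 = 1 /\ c1 0 = 0 & s 0 = 0 /\ s1 0 = 1].

Lemma fundamental_exists K : continuous K ->
  exists c c1 s s1, fundamental K c c1 s s1.
Proof.
move=> cK; have [c [c1 [h1 h2 h3]]] := linear_ode 1 0 cK.
have [s [s1 [h4 h5 h6]]] := linear_ode 0 1 cK.
by exists c, c1, s, s1.
Qed.

(** m is the Weyl-Titchmarsh coefficient of the half line.  It is a relation
    because uniqueness of m is a consequence of the comparison of slopes. *)
Definition decaying_slope K (m : R) := exists u u1,
  [/\ solves K u u1, u 0 = 1 /\ u1 0 = m, forall t, 0 <= t -> 0 < u t & decays u u1].

(** The decaying solution is c + m s with m the supremum of -c/s, which is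
    increasing because the Wronskian of c and s is 1.  If c + m s increased
    anywhere in the region K > 0, so would c + (m - d) s for small d > 0, and it
    would stay positive; this keeps -c/s below m - d. *)
Theorem decaying_solution K c c1 s s1 (be : R) : 0 < be ->
  fundamental K c c1 s s1 ->
  (forall t, 0 <= t -> be ^+ 2 * t ^+ 2 - 3 * be < K t) ->
  exists m, (forall t, 0 <= t -> 0 < c t + m * s t) /\
    decays (fun t => c t + m * s t) (fun t => c1 t + m * s1 t).
Proof.
move=> be0 [sc ss [c0 c10] [s0 s10]] K_gt.
have spos := dirichlet_gt0 ss s0 s10 K_gt.
have sinc := dirichlet_increases be0 ss s0 s10 K_gt.
(* beyond T0 the hypothesis gives K > 0 *)
pose T0 := 1 + 4 / be.
have T00 : 0 < T0 by rewrite /T0 addr_gt0 ?divr_gt0.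
have K1 t : T0 <= t -> 0 < K t.
  move=> Tt; have t0 : 0 <= t by lra.
  have : 4 + be <= be * t.
    have -> : 4 + be = be * T0 by rewrite /T0 mulrDr mulrCA divff ?gt_eqF //; ring.
    by rewrite ler_wpM2l // ltW.
  have := K_gt t t0; nra.
have W t : c t * s1 t - c1 t * s t = 1.
  have -> : 1 = c 0 * s1 0 - c1 0 * s 0 by rewrite c0 s10 c10 s0; ring.
  apply: (@is_derive_0_is_cst R (fun t => c t * s1 t - c1 t * s t)) => z.
  by apply: (der_eq (der_wronskian sc ss z)); rewrite subrr mul0r.
pose q t := - c t / s t.
have qlt a b : 0 < a -> a < b -> q a < q b.
  move=> a0 ab; apply: (@der_gt0_lt _ q (fun t => (s t ^+ 2)^-1)) => // z /andP[az zb].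
    have sz : s z != 0 by rewrite gt_eqF // spos //; lra.
    have [dc _] := sc; have [ds _] := ss; have h := derV sz (ds z); der.
    by rewrite -[RHS]mul1r -(W z); field.
  by rewrite invr_gt0 exprn_gt0 // spos; lra.
have qP t d : 0 < t -> (q t < d) = (0 < c t + d * s t).
  by move=> t0; rewrite /q ltr_pdivrMr ?spos // -subr_gt0 opprK addrC.
have [T T0T s1T] := sinc T0.
have T0' : 0 < T by lra.
(* c + d s is positive and nondecreasing at T, hence positive afterwards, so
   that d bounds -c/s *)
pose d := Num.max (q T + 1) (Num.max 0 (- c1 T / s1 T)).
have [d1 [d0 d2]] : q T < d /\ 0 <= d /\ 0 <= c1 T + d * s1 T.
  rewrite /d !lt_max !le_max lexx orbT ltrDl ltr01; split=> //; split=> //.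
  have h : - c1 T / s1 T <= d by rewrite !le_max lexx !orbT.
  by move: h; rewrite ler_pdivrMr // /d; lra.
have ub t : 0 < t -> q t < d.
  move=> t0; have [tT|Tt] := ltP t T; first exact: lt_trans (qlt _ _ t0 tT) d1.
  rewrite qP //.
  have h : 0 < c T + d * s T by rewrite -qP.
  have [h' _ _] := @increasing_solution _ K _ _ T (solves_lin d sc ss)
    (fun z hz => ltW (K1 z (le_trans T0T hz))) h d2 t Tt.
  exact: lt_le_trans h h'.
pose A := [set q t | t in [set t | 0 < t]].
have A0 : A !=set0 by exists (q T), T.
have uA : has_ubound A by exists d => _ [t t0 <-]; exact/ltW/ub.
pose m := sup A; exists m.
have qm t : 0 < t -> q t < m.
  move=> t0; apply: (lt_le_trans (qlt t (t + 1) t0 _)); first by rewrite ltrDl.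
  by apply: ub_le_sup => //; exists (t + 1) => //=; lra.
have upos t : 0 <= t -> 0 < c t + m * s t.
  rewrite le_eqVlt => /orP[/eqP<-|t0]; first by rewrite c0 s0 mulr0 addr0.
  by rewrite -qP // qm.
split=> //; exists T0 => t Tt; split; first by apply: upos; lra.
rewrite leNgt; apply/negP => u1t.
have t0 : 0 < t by lra.
have ut := upos t (ltW t0).
have st := spos t t0.
pose dd := Num.min ((c t + m * s t) / (2 * s t)) ((c1 t + m * s1 t) / (1 + `|s1 t|)).
have n0 : 0 < 1 + `|s1 t| by rewrite ltr_pwDl.
have dd0 : 0 < dd.
  by rewrite lt_min; apply/andP; split; rewrite divr_gt0 // mulr_gt0.
have h1 : 0 < c t + (m - dd) * s t.
  have : dd <= (c t + m * s t) / (2 * s t) by rewrite ge_min lexx.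
  rewrite ler_pdivlMr ?mulr_gt0 //; lra.
have h2 : 0 <= c1 t + (m - dd) * s1 t.
  have : dd <= (c1 t + m * s1 t) / (1 + `|s1 t|) by rewrite ge_min lexx orbT.
  rewrite ler_pdivlMr //; have := ler_norm (s1 t); nra.
have qle z : 0 < z -> q z <= m - dd.
  move=> z0.
  suff h z' : t <= z' -> q z' < m - dd.
    have [tz|zt] := leP t z; first exact/ltW/h.
    by apply/ltW/(lt_trans (qlt _ _ z0 zt))/h.
  move=> tz; rewrite qP; last by lra.
  have [h' _ _] := @increasing_solution _ K _ _ t (solves_lin (m - dd) sc ss)
    (fun z hz => ltW (K1 z (le_trans Tt hz))) h1 h2 z' tz.
  exact: lt_le_trans h1 h'.
have : m <= m - dd by apply: ge_sup => // _ [z z0 <-]; exact: qle.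
lra.
Qed.

End Principal.

(** * Shooting in the energy: positive bound states *)

Section Matching.
Context {R : realType}.
Implicit Types (f g F G u v K V : R -> R) (a b x y t T E m : R).

Lemma eventually_quadratic V (be E k : R) : 0 < be ->
  (forall t, 0 <= t -> be ^+ 2 * t ^+ 2 <= V t) -> eventually_ge k (fun t => V t - E).
Proof.
move=> be0 hV; pose c := Num.max (E + k) 0.
have [c0 cE] : 0 <= c /\ E + k <= c by rewrite /c !le_max !lexx orbT.
exists (1 + c / be ^+ 2) => t Tt.
have be2 : 0 < be ^+ 2 by rewrite exprn_gt0.
have h0 : 0 <= c / be ^+ 2 by rewrite divr_ge0 // ltW.
have h1 : be ^+ 2 + c <= be ^+ 2 * t.
  have -> : be ^+ 2 + c = be ^+ 2 * (1 + c / be ^+ 2).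
    by rewrite mulrDr mulr1 mulrCA divff ?mulr1 // gt_eqF.
  by rewrite ler_wpM2l // ltW.
have h2 : be ^+ 2 * t <= be ^+ 2 * t ^+ 2.
  by apply: ler_wpM2l; [exact: ltW|rewrite expr2 ler_peMl //; lra].
have := hV t ltac:(lra); lra.
Qed.

(** The value at 0 of the Wronskian in [decaying_comparison] is m2 - m1. *)
Lemma compare_slopes K1 K2 m1 m2 : decaying_slope K1 m1 -> decaying_slope K2 m2 ->
  eventually_ge 0 K1 -> eventually_ge 0 K2 -> (forall t, 0 <= t -> K2 t <= K1 t) ->
  m1 <= m2.
Proof.
move=> [u [u1 [su [u0 u10] upos du]]] [v [v1 [sv [v0 v10] vpos dv]]] e1 e2 K21.
have := decaying_comparison su sv e1 e2 du dv upos vpos K21 (lexx 0).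
by rewrite u0 u10 v0 v10; lra.
Qed.

(** The slope depends on the energy in a Lipschitz way: its increment is
    (E' - E) times the integral of the product of the two solutions, and these
    increase with the energy. *)
Lemma slope_lipschitz V bp mb : eventually_ge 1 (fun t => V t - bp) ->
  decaying_slope (fun t => V t - bp) mb ->
  exists2 M, 0 <= M & forall E E' m m', E <= E' -> E' <= bp ->
    decaying_slope (fun t => V t - E) m -> decaying_slope (fun t => V t - E') m' ->
    0 <= m' - m <= M * (E' - E).
Proof.
move=> eb [w [w1 [sw [w0 w10] wpos dw]]].
have e0 E : E <= bp -> eventually_ge 0 (fun t => V t - E).
  by move=> Eb; case: eb => T hT; exists T => t Tt; have := hT t Tt; lra.
pose P := potential (fun t => w t ^+ 2).
have dP : has_der P (fun t => w t ^+ 2).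
  apply: has_der_potential => x.
  have := solves_continuous sw => cw; apply: (@continuous_comp _ _ _ w (fun z => z ^+ 2)).
    exact: cw.
  exact: exprn_continuous.
have [M hM] := decaying_square_bound sw eb dw dP.
have P0 : P 0 = 0 by exact: potential0.
have M0 : 0 <= M by rewrite -P0; exact: hM.
(* v/u is nondecreasing, its derivative being the Wronskian over u^2 *)
have ratio E E' u u1 v v1 : E <= E' -> E' <= bp ->
    solves (fun t => V t - E) u u1 -> solves (fun t => V t - E') v v1 ->
    decays u u1 -> decays v v1 -> u 0 = 1 -> v 0 = 1 ->
    (forall t, 0 <= t -> 0 < u t) -> (forall t, 0 <= t -> 0 < v t) ->
    forall t, 0 <= t -> u t <= v t.
  move=> EE Eb su sv du dv u0 v0 upos vpos t t0.
  have J0 := decaying_comparison su sv (e0 _ (le_trans EE Eb)) (e0 _ Eb) du dv upos vpos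
    (fun t _ => lerB (lexx (V t)) EE).
  have : v 0 / u 0 <= v t / u t.
    apply: (@der_ge0_le _ (fun t => v t / u t)
      (fun t => (u t * v1 t - u1 t * v t) / u t ^+ 2)) => //.
      move=> z /andP[z0 _]; have uz : u z != 0 by rewrite gt_eqF // upos.
      have [d1 _] := su; have [d2 _] := sv; have h := derV uz (d1 z); der.
      by field.
    by move=> z /andP[z0 _]; rewrite divr_ge0 ?sqr_ge0 // J0 // ltW.
  by rewrite u0 v0 divr1 ler_pdivlMr ?upos // mul1r.
exists M => // E E' m m' EE Eb su' sv'.
have [u [u1 [su [u0 u10] upos du]]] := su'; have [v [v1 [sv [v0 v10] vpos dv]]] := sv'.
have Eb' := le_trans EE Eb.
apply/andP; split.
  rewrite subr_ge0; apply: (compare_slopes su' sv'); [exact: e0|exact: e0|].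
  by move=> t _; lra.
have uw := ratio _ _ _ _ _ _ Eb' (lexx bp) su sw du dw u0 w0 upos wpos.
have vw := ratio _ _ _ _ _ _ Eb (lexx bp) sv sw dv dw v0 w0 vpos wpos.
pose J t := u t * v1 t - u1 t * v t.
have -> : m' - m = J 0 by rewrite /J u0 u10 v0 v10; ring.
rewrite leNgt; apply/negP => JM.
pose e := (J 0 - M * (E' - E)) / 2.
have ee : 0 < e by rewrite /e; lra.
have [T hT] := wronskian_vanishes su sv (e0 _ Eb') (e0 _ Eb) du dv ee.
pose t := Num.max T 0.
have [Tt t0] : T <= t /\ 0 <= t by rewrite /t !le_max !lexx orbT.
have : J 0 + (E' - E) * P 0 <= J t + (E' - E) * P t.
  apply: (@der_ge0_le _ (fun t => J t + (E' - E) * P t)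
    (fun t => (V t - E' - (V t - E)) * (u t * v t) + (E' - E) * w t ^+ 2)) => //.
    by move=> z _; have h := der_wronskian su sv; der; ring.
  move=> z /andP[z0 _]; have z0' := ltW z0.
  have : u z * v z <= w z * w z by apply: ler_pM; rewrite ?uw ?vw ?ltW ?upos ?vpos.
  nra.
have := hT t Tt; rewrite -/(J t) ler_norml => /andP[h1 h2].
have := ler_wpM2l (ltac:(lra) : 0 <= E' - E) (hM t).
rewrite P0 /e in h2 *; lra.
Qed.

Definition gaussian (be : R) t := expR (- (be / 2 * t ^+ 2)).

(** The ground state of the harmonic oscillator is even. *)
Lemma gaussian_slope (be : R) : 0 < be ->
  decaying_slope (fun t => be ^+ 2 * t ^+ 2 - be) 0.
Proof.
move=> be0; exists (gaussian be), (fun t => - (be * t) * gaussian be t); split.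
- by split => t; rewrite /gaussian; der; rewrite /=; field.
- by rewrite /gaussian expr0n mulr0 oppr0 expR0 mulr0 oppr0 mul0r.
- by move=> t _; exact: expR_gt0.
- exists 0 => t t0; split; first exact: expR_gt0.
  by rewrite mulNr oppr_le0 !mulr_ge0 ?expR_ge0 // ltW.
Qed.

Lemma solves_reflect K u u1 : solves K u u1 ->
  solves (fun t => K (- t)) (fun t => u (- t)) (fun t => - u1 (- t)).
Proof.
by move=> [du du1]; split => t;
  have h1 := der_comp (du (- t)) (derN (der_id t));
  have h2 := der_comp (du1 (- t)) (derN (der_id t)); der; ring.
Qed.

Lemma fundamental_reflect K c c1 s s1 : fundamental K c c1 s s1 ->
  fundamental (fun t => K (- t)) (fun t => c (- t)) (fun t => - c1 (- t))
    (fun t => - s (- t)) (fun t => s1 (- t)).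
Proof.
move=> [sc ss [c0 c10] [s0 s10]]; split.
- exact: solves_reflect.
- have [d1 d2] := solves_reflect ss; split => t; first by der; ring.
  have h := derN (d2 t); apply: der_eq.
    have -> : (fun t => s1 (- t)) = (fun t => - - s1 (- t)) by apply/funext => z; rewrite opprK.
    exact: h.
  ring.
- by rewrite oppr0 c0 c10 oppr0.
- by rewrite oppr0 s0 s10 oppr0.
Qed.

Section Existence.
Variables (bm bp : R) (V : R -> R).
Hypotheses (bm0 : 0 < bm) (bmp : bm <= bp) (bp3 : bp < 3 * bm) (cV : continuous V).
Hypothesis V_between : forall t, bm ^+ 2 * t ^+ 2 <= V t <= bp ^+ 2 * t ^+ 2.

Let slope_of E : E <= bp -> forall c c1 s s1, fundamental (fun t => V t - E) c c1 s s1 ->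
  exists m, (forall t, 0 <= t -> 0 < c t + m * s t) /\
    decays (fun t => c t + m * s t) (fun t => c1 t + m * s1 t).
Proof.
move=> Eb c c1 s s1 F; apply: (decaying_solution bm0 F) => t _ /=.
have /andP[h _] := V_between t; have := le_lt_trans Eb bp3; lra.
Qed.

Let slope_exists E : E <= bp -> exists m, decaying_slope (fun t => V t - E) m.
Proof.
move=> Eb; have cK : continuous (fun t => V t - E).
  by move=> x; apply: continuousB; [exact: cV|exact: cst_continuous].
have [c [c1 [s [s1 F]]]] := fundamental_exists cK.
have [m [h1 h2]] := slope_of Eb F; have [sc ss [c0 c10] [s0 s10]] := F.
exists m, (fun t => c t + m * s t), (fun t => c1 t + m * s1 t); split=> //.
  exact: solves_lin.
by rewrite c0 c10 s0 s10; split; ring.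
Qed.

Let eventually_V k E : eventually_ge k (fun t => V t - E).
Proof. by apply: (eventually_quadratic _ _ bm0) => t _; have /andP[] := V_between t. Qed.

Let slope_low m : decaying_slope (fun t => V t - bm) m -> m <= 0.
Proof.
move=> h; apply: (compare_slopes h (gaussian_slope bm0)); first exact: eventually_V.
  by apply: (eventually_quadratic _ _ bm0) => t _.
by move=> t _ /=; have /andP[] := V_between t; lra.
Qed.

Let slope_high m : decaying_slope (fun t => V t - bp) m -> 0 <= m.
Proof.
have bp0 : 0 < bp by exact: lt_le_trans bm0 bmp.
move=> h; apply: (compare_slopes (gaussian_slope bp0) h); last 2 first.
- exact: eventually_V.
- by move=> t _ /=; have /andP[] := V_between t; lra.
by apply: (eventually_quadratic _ _ bp0) => t _.
Qed.

(** At the energies bm and bp the potential is compared with the oscillators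
    whose ground state energies these are and whose slope is 0; this fixes the
    signs of the slope at the two ends of [bm, bp]. *)
Lemma slope_function : exists f : R -> R, exists2 M, 0 <= M &
  [/\ forall E, E <= bp -> decaying_slope (fun t => V t - E) (f E),
    f bm <= 0, 0 <= f bp,
    forall E E', E <= E' -> E' <= bp -> `|f E' - f E| <= M * (E' - E) &
    forall E m, E <= bp -> decaying_slope (fun t => V t - E) m -> m = f E].
Proof.
have /choice[f hf] E : exists m, E <= bp -> decaying_slope (fun t => V t - E) m.
  by have [/slope_exists[m hm]|] := leP E bp; [exists m|exists 0].
have [M M0 hM] := slope_lipschitz (eventually_V 1 bp) (hf _ (lexx bp)).
exists f, M => //; split=> //.
- exact/slope_low/hf.
- exact/slope_high/hf.
- move=> E E' EE Eb; have /andP[h1 h2] := hM _ _ _ _ EE Eb (hf _ (le_trans EE Eb)) (hf _ Eb).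
  by rewrite ger0_norm.
- move=> E m Eb hm.
  have /andP[h1 h2] := hM _ _ _ _ (lexx E) Eb hm (hf _ Eb).
  by rewrite subrr mulr0 in h2; lra.
Qed.

End Existence.

(** Ground state of -d^2 + V for a potential V between two harmonic
    oscillators: the decaying solutions of the two half lines are matched at
    the bottom of the well by the intermediate value theorem in the energy. *)
Theorem positive_bound_state (bm bp : R) V : 0 < bm -> bm <= bp -> bp < 3 * bm ->
  continuous V -> (forall t, bm ^+ 2 * t ^+ 2 <= V t <= bp ^+ 2 * t ^+ 2) ->
  exists E u u1, [/\ bm <= E <= bp, solves (fun t => V t - E) u u1,
    forall t, 0 < u t & exists P M, has_der P (fun t => u t ^+ 2) /\ forall t, `|P t| <= M].
Proof.
move=> bm0 bmp bp3 cV hV.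
pose V' t := V (- t).
have cV' : continuous V'.
  move=> x; apply: (@continuous_comp _ _ _ (fun y : R => - y) V x); last exact: cV.
  exact: opp_continuous.
have hV' t : bm ^+ 2 * t ^+ 2 <= V' t <= bp ^+ 2 * t ^+ 2.
  by have := hV (- t); rewrite sqrrN.
have [f [M M0 [f1 f2 f3 f4 f5]]] := slope_function bm0 bmp bp3 cV hV.
have [g [N N0 [g1 g2 g3 g4 g5]]] := slope_function bm0 bmp bp3 cV' hV'.
(* the slopes are controlled on [bm, bp] only; composing with the retraction
   onto it gives a function that is continuous on the line *)
pose cl x := Num.max bm (Num.min bp x).
have cl_le x : cl x <= bp by rewrite ge_max bmp ge_min lexx.
have cl_ge x : bm <= cl x by rewrite le_max lexx.
have cl_lip x y : x <= y -> 0 <= cl y - cl x <= y - x.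
  by move=> xy; rewrite /cl; case: (leP bp x) => h1; case: (leP bp y) => h2;
    case: (leP bm x) => h3; case: (leP bm y) => h4; rewrite ?(max_idPl _ _) //;
    rewrite /Num.max; repeat case: ifP => ?; lra.
pose D x := f (cl x) + g (cl x).
have D_lip x y : x <= y -> `|D y - D x| <= (M + N) * (y - x).
  move=> xy; have /andP[h0 h1] := cl_lip x y xy.
  have cc : cl x <= cl y by rewrite -subr_ge0.
  have := f4 _ _ cc (cl_le y); have := g4 _ _ cc (cl_le y).
  have : M * (cl y - cl x) <= M * (y - x) by rewrite ler_wpM2l.
  have : N * (cl y - cl x) <= N * (y - x) by rewrite ler_wpM2l.
  rewrite /D !ler_norml => a1 a2 /andP[a3 a4] /andP[a5 a6]; lra.
have cD : continuous D.
  move=> x; apply/cvgrPdist_lt => e e0.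
  have L : 0 < M + N + 1 by lra.
  have d0 : 0 < e / (M + N + 1) by rewrite divr_gt0.
  near=> y.
  have xy : `|x - y| < e / (M + N + 1).
    by near: y; exists (e / (M + N + 1)) => //=.
  have : `|D x - D y| <= (M + N) * `|x - y|.
    have [h|h] := leP x y.
      by rewrite distrC (distrC x) (ger0_norm (x := y - x)) ?subr_ge0 // D_lip.
    by rewrite (ger0_norm (x := x - y)); [exact/D_lip/ltW|rewrite subr_ge0; exact: ltW].
  rewrite ltr_pdivlMr // in xy.
  have := normr_ge0 (x - y); nra.
have clm : cl bm = bm by rewrite /cl (min_idPr bmp) maxxx.
have clp : cl bp = bp by rewrite /cl minxx (max_idPr bmp).
have [|x] := @IVT R D bm bp 0 bmp (continuous_in (D := `[bm, bp]%classic) cD).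
  rewrite ge_min le_max /D clm clp.
  apply/andP; split; apply/orP; [left|right]; lra.
rewrite in_itv /= => /andP[xm xp]; have -> : D x = f x + g x.
  by rewrite /D /cl (min_idPr xp) (max_idPr xm).
move=> fg0; exists x.
have cK : continuous (fun t => V t - x).
  by move=> z; apply: continuousB; [exact: cV|exact: cst_continuous].
have [c [c1 [s [s1 F]]]] := fundamental_exists cK.
have F' := fundamental_reflect F.
have x3 : x < 3 * bm by lra.
have [m [mp md]] : exists m, (forall t, 0 <= t -> 0 < c t + m * s t) /\
    decays (fun t => c t + m * s t) (fun t => c1 t + m * s1 t).
  by apply: (decaying_solution bm0 F) => t _ /=; have /andP[h _] := hV t; lra.
have [n [np nd]] : exists n, (forall t, 0 <= t -> 0 < c (- t) + n * - s (- t)) /\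
    decays (fun t => c (- t) + n * - s (- t)) (fun t => - c1 (- t) + n * s1 (- t)).
  by apply: (decaying_solution bm0 F') => t _ /=; have /andP[h _] := hV' t; rewrite /V' in h *; lra.
have [sc ss [c0 c10] [s0 s10]] := F; have [sc' ss' [c0' c10'] [s0' s10']] := F'.
have mE : m = f x.
  apply: f5 => //; exists (fun t => c t + m * s t), (fun t => c1 t + m * s1 t); split=> //.
    exact: solves_lin.
  by rewrite c0 c10 s0 s10; split; ring.
have nE : n = g x.
  apply: g5 => //; exists (fun t => c (- t) + n * - s (- t)), (fun t => - c1 (- t) + n * s1 (- t)); split=> //.
    exact: solves_lin.
  by rewrite c0' c10' s0' s10'; split; ring.
(* opposite slopes at 0: the two half line solutions fit together *)
have nm : n = - m by lra.
pose u t := c t + m * s t; pose u1 t := c1 t + m * s1 t.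
have su : solves (fun t => V t - x) u u1 by exact: solves_lin.
have su' := solves_reflect su.
have E1 : (fun t => c (- t) + n * - s (- t)) = (fun t => u (- t)).
  by apply/funext => t; rewrite nm mulrNN.
have E2 : (fun t => - c1 (- t) + n * s1 (- t)) = (fun t => - u1 (- t)).
  by apply/funext => t; rewrite nm /u1; ring.
rewrite E1 E2 in nd.
exists u, u1; split=> //; first by rewrite xm.
  move=> t; have [t0|t0] := leP 0 t; first exact: mp.
  have := np (- t); rewrite opprK nm mulrNN; apply; lra.
pose P := potential (fun t => u t ^+ 2).
have dP : has_der P (fun t => u t ^+ 2).
  apply: has_der_potential => z.
  have cu := solves_continuous su; apply: (@continuous_comp _ _ _ u (fun z => z ^+ 2)).
    exact: cu.
  exact: exprn_continuous.
have dP' : has_der (fun t => - P (- t)) (fun t => u (- t) ^+ 2).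
  by move=> t; have h := der_comp (dP (- t)) (derN (der_id t)); der; ring.
have e1 : eventually_ge 1 (fun t => V t - x).
  by apply: (eventually_quadratic _ _ bm0) => t _; have /andP[] := hV t.
have e1' : eventually_ge 1 (fun t => V (- t) - x).
  by apply: (eventually_quadratic _ _ bm0) => t _; have /andP[] := hV' t.
have [A hA] := decaying_square_bound su e1 md dP.
have [B hB] := decaying_square_bound su' e1' nd dP'.
exists P, (A + B); split=> // t.
have P0 : P 0 = 0 by exact: potential0.
have := hA 0; have := hB 0; rewrite oppr0 P0 => b0 a0.
have := hA t; have := hB (- t); rewrite opprK => b1 a1.
rewrite ler_norml; apply/andP; split; lra.
Unshelve. all: by end_near. Qed.

End Matching.

(** * Integrals over the line and polynomial cutoffs *)

Section IntegralsOnTheLine.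
Context {R : realType}.
Notation mu := (@lebesgue_measure R).
Implicit Types (f g h k w F G B : R -> R) (a b c x y t : R).

Definition integrableT f := mu.-integrable [set: R] (EFin \o f).

Lemma integrableT_measurable f : integrableT f -> measurable_fun [set: R] f.
Proof. by move=> /integrableP[/measurable_EFinP]. Qed.

Lemma integrableT_le f g : measurable_fun [set: R] f -> integrableT g ->
  (forall x, `|f x| <= g x) -> integrableT f.
Proof.
move=> mf ig fg; apply: (le_integrable _ _ _ ig) => //; first exact/measurable_EFinP.
by move=> x _ /=; rewrite lee_fin (le_trans (fg x)) // ler_norm.
Qed.

Lemma integrableTD f g : integrableT f -> integrableT g -> integrableT (fun x => f x + g x).
Proof.
move=> hf hg; have := integrableD measurableT hf hg.
by apply: eq_integrable.
Qed.

Lemma integrableTZ (c : R) f : integrableT f -> integrableT (fun x => c * f x).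
Proof.
move=> hf; have := integrableZl measurableT c hf.
by apply: eq_integrable.
Qed.

Lemma integrableT_locint f : integrableT f -> locint f.
Proof. by move=> hf a b; apply: integrableS hf. Qed.

Lemma locintD f g : locint f -> locint g -> locint (fun x => f x + g x).
Proof.
move=> hf hg a b.
have h : mu.-integrable `[a, b] ((EFin \o f) \+ (EFin \o g))%E.
  exact: integrableD.
by apply: eq_integrable h.
Qed.

Lemma locintZ (c : R) f : locint f -> locint (fun x => c * f x).
Proof.
move=> hf a b.
have h : mu.-integrable `[a, b] (fun x => c%:E * (EFin \o f) x)%E.
  exact: integrableZl.
by apply: eq_integrable h.
Qed.

Lemma continuous_measurable f : continuous f -> measurable_fun [set: R] f.
Proof. exact: continuous_measurable_fun. Qed.

Lemma continuousD' f g : continuous f -> continuous g -> continuous (fun x => f x + g x).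
Proof. by move=> cf cg x; exact: continuousD (cf x) (cg x). Qed.

Lemma continuousN' f : continuous f -> continuous (fun x => - f x).
Proof. by move=> cf x; exact: continuousN (cf x). Qed.

Lemma continuousM' f g : continuous f -> continuous g -> continuous (fun x => f x * g x).
Proof. by move=> cf cg x; exact: continuousM (cf x) (cg x). Qed.

Lemma continuousX' f n : continuous f -> continuous (fun x => f x ^+ n).
Proof.
move=> cf x; apply: (@continuous_comp _ _ _ f (fun z => z ^+ n)); first exact: cf.
exact: exprn_continuous.
Qed.

Lemma continuous_cst' c : continuous (fun _ : R => c).
Proof. by move=> x; exact: cst_continuous. Qed.

Lemma continuous_id' : continuous (fun x : R => x).
Proof. by move=> x; exact: cvg_id. Qed.

Lemma Rintegral_itv_le f g a b : locint f -> locint g ->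
  (forall x, a <= x <= b -> f x <= g x) ->
  \int[mu]_(x in `[a, b]) f x <= \int[mu]_(x in `[a, b]) g x.
Proof.
by move=> hf hg fg; apply: le_Rintegral => //.
Qed.

Lemma Rintegral_itv_leT f a b : integrableT f -> (forall x, 0 <= f x) ->
  \int[mu]_(x in `[a, b]) f x <= \int[mu]_x f x.
Proof.
move=> hf f0; rewrite /Rintegral fine_le //.
- by apply: integrable_fin_num => //; exact: integrableT_locint.
- exact: integrable_fin_num.
- apply: ge0_subset_integral => //; first by case/integrableP: hf.
  by move=> x _; rewrite lee_fin.
Qed.

Lemma symitv_bigcup : \bigcup_n `[- n%:R, n%:R]%classic = [set: R].
Proof.
apply/seteqP; split=> // x _.
exists (Num.truncn `|x|).+1 => //=; rewrite in_itv /= -ler_norml ltW //.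
by have /andP[] := truncn_itv (normr_ge0 x).
Qed.

(** Monotone convergence along the intervals [-n, n]. *)
Lemma integrableT_itv_bounded f c : (forall x, 0 <= f x) -> locint f ->
  measurable_fun [set: R] f ->
  (forall n : nat, \int[mu]_(x in `[- n%:R, n%:R]) f x <= c) ->
  integrableT f /\ \int[mu]_x f x <= c.
Proof.
move=> f0 lf mf hc.
have E n : (\int[mu]_(x in `[(- n%:R)%R, n%:R%R]) (f x)%:E <= c%:E)%E.
  have := hc n; rewrite -lee_fin /Rintegral fineK //.
  by apply: integrable_fin_num => //; exact: lf.
have L : (\int[mu]_x (f x)%:E <= c%:E)%E.
  pose F (n : nat) : set (measurableTypeR R) := `[- n%:R, n%:R]%classic.
  have ndF : nondecreasing_seq F.
    apply/nondecreasing_seqP => n; rewrite subsetEset; apply: subset_itv; rewrite bnd_simp.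
      by rewrite lerN2 ler_nat.
    by rewrite ler_nat.
  have mF n : measurable (F n) by exact: measurable_itv.
  have mfF n : measurable_fun (F n) (fun x => (f x)%:E).
    by apply/measurable_EFinP; exact: measurable_funTS.
  have f0F n x : F n x -> (0 <= (f x)%:E)%E by rewrite lee_fin.
  have := @ge0_nondecreasing_set_cvg_integral _ _ R F (fun x => (f x)%:E) mu ndF mF mfF f0F.
  rewrite symitv_bigcup => cvgF; rewrite -(cvg_lim _ cvgF) //.
  apply: lime_le; last by apply: nearW => n; exact: E.
  by apply/cvg_ex; eexists; exact: cvgF.
have I : integrableT f.
  apply/integrableP; split; first exact/measurable_EFinP.
  apply: le_lt_trans (ltry c); apply: le_trans L.
  by under eq_integral => x _ do rewrite /= ger0_norm //.
split=> //; rewrite -lee_fin /Rintegral fineK //; exact: integrable_fin_num.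
Qed.

Lemma integrableT_bounded_primitive f P M : (forall x, 0 <= f x) -> continuous f ->
  has_der P f -> (forall x, `|P x| <= M) -> integrableT f.
Proof.
move=> f0 cf dP PM.
apply: (proj1 (@integrableT_itv_bounded f (M + M) f0 (continuous_locint cf) (continuous_measurable cf) _)) => n.
have nn : - n%:R <= n%:R :> R by rewrite (@le_trans _ _ 0) // oppr_le0.
rewrite -(potentialB (continuous_locint cf) nn).
have d := has_der_potential cf.
have E x : potential f x = P x - P 0.
  apply: (@has_der_unique _ _ (fun x => P x - P 0) f d); last by rewrite potential0 subrr.
  by move=> z; der; ring.
rewrite !E; have := PM n%:R; have := PM (- n%:R); rewrite !ler_norml => /andP[? ?] /andP[? ?]; lra.
Qed.

(** Only values on [-(n+1), n+1] matter: there it lies between 0 and 1 and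
    vanishes at the end points, and its derivative is O(1/n).  Truncation
    arguments need one derivative, which makes a polynomial sufficient. *)
Definition cutoff (n : nat) x : R := 1 - (x / n.+1%:R) ^+ 2.

Definition cutoff1 (n : nat) x : R := - (2 * x) / n.+1%:R ^+ 2.

Lemma der_cutoff n : has_der (cutoff n) (cutoff1 n).
Proof.
move=> x; have : n.+1%:R != 0 :> R by rewrite pnatr_eq0.
by rewrite /cutoff /cutoff1; move: n.+1%:R => m m0; der; rewrite /=; field.
Qed.

Lemma continuous_cutoff n : continuous (cutoff n).
Proof. exact: has_der_continuous (@der_cutoff n). Qed.

Lemma cutoff_end n : cutoff n n.+1%:R = 0 /\ cutoff n (- n.+1%:R) = 0.
Proof. by rewrite /cutoff mulNr divff ?pnatr_eq0 // sqrrN expr1n subrr. Qed.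

Lemma cutoff_itv n x : - n.+1%:R <= x <= n.+1%:R -> 0 <= cutoff n x <= 1.
Proof.
move=> xn; have n0 : 0 < n.+1%:R :> R by rewrite ltr0n.
rewrite /cutoff; set y := x / _.
have : `|y| <= 1 by rewrite /y normrM normfV (gtr0_norm n0) ler_pdivrMr // mul1r ler_norml.
by rewrite ler_norml => /andP[? ?]; rewrite expr2; apply/andP; split; nra.
Qed.

Lemma cutoff1_sq n x : - n.+1%:R <= x <= n.+1%:R -> cutoff1 n x ^+ 2 <= 4 / n.+1%:R ^+ 2.
Proof.
move=> xn; have n0 : 0 < n.+1%:R :> R by rewrite ltr0n.
have : x ^+ 2 <= n.+1%:R ^+ 2 by case/andP: xn; move: n.+1%:R => m ? ?; rewrite !expr2; nra.
move=> h; rewrite /cutoff1 -(ler_pM2r (exprn_gt0 2 n0)) -(ler_pM2r (exprn_gt0 2 n0)).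
set m := n.+1%:R in n0 *.
have -> : (- (2 * x) / m ^+ 2) ^+ 2 * m ^+ 2 * m ^+ 2 = 4 * x ^+ 2 by field; rewrite gt_eqF.
have -> : 4 / m ^+ 2 * m ^+ 2 * m ^+ 2 = 4 * m ^+ 2 by field; rewrite gt_eqF.
by rewrite ler_wpM2l.
Qed.

Definition cutoff_int (n : nat) f := \int[mu]_(x in `[- n.+1%:R, n.+1%:R]) (cutoff n x ^+ 2 * f x).

Lemma cutoff_cvg x : cutoff n x @[n --> \oo] --> (1 : R).
Proof.
have h : x / n.+1%:R @[n --> \oo] --> (0 : R).
  by rewrite -[X in _ --> X](mulr0 x); exact: (cvgM (cvg_cst x) cvg_harmonic).
have := cvgB (cvg_cst (1 : R)) (cvgM h h).
rewrite mulr0 subr0 => h2; under eq_fun do rewrite /cutoff expr2.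
exact: h2.
Qed.

(** Dominated convergence, with f itself as the dominating function. *)
Lemma cutoff_int_cvg f : integrableT f -> cutoff_int n f @[n --> \oo] --> \int[mu]_x f x.
Proof.
move=> hf; have mf := integrableT_measurable hf.
pose h n := (fun x => cutoff n x ^+ 2 * f x) \_ `[- n.+1%:R, n.+1%:R].
have mh n : measurable_fun [set: R] (h n).
  apply/(measurable_restrictT _ (measurable_itv _)); apply: measurable_funTS.
  apply: measurable_funM => //; apply: continuous_measurable.
  exact/continuousX'/continuous_cutoff.
have hle n x : `|h n x| <= `|f x|.
  rewrite /h patchE; case: ifPn => [|_]; last by rewrite normr0.
  rewrite inE /= in_itv /= => /cutoff_itv /andP[c0 c1].
  rewrite normrM ger0_norm ?sqr_ge0 // -[leRHS]mul1r ler_wpM2r // expr_le1 //.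
have hcvg x : (h n x)%:E @[n --> \oo] --> (f x)%:E.
  apply: cvg_EFin; first by apply: nearW.
  have h1 : cutoff n x * cutoff n x * f x @[n --> \oo] --> 1 * 1 * f x.
    exact: (cvgM (cvgM (cutoff_cvg x) (cutoff_cvg x)) (cvg_cst (f x))).
  rewrite !mul1r in h1; apply: cvg_trans h1; apply: near_eq_cvg => /=.
  exists (Num.truncn `|x|) => // n /= nx.
  rewrite /h patchE mem_set ?expr2 //= in_itv /= -ler_norml.
  have /andP[_ h2] := truncn_itv (normr_ge0 x).
  by apply: (le_trans (ltW h2)); rewrite ler_nat.
have := @dominated_convergence _ _ R mu setT measurableT (fun n x => (h n x)%:E)
  (fun x => (f x)%:E) (fun x => `|f x|%:E).
case=> //.
- by move=> n; exact: (measurableT_comp (@EFin_measurable R setT) (mh n)).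
- exact: (measurableT_comp (@EFin_measurable R setT) mf).
- by apply: aeW => x _; exact: hcvg.
- exact: (integrable_norm (D := setT) (mu := mu)).
- by apply: aeW => x n _ /=; rewrite lee_fin.
move=> _ _ cv.
have E : (\int[mu]_x (f x)%:E)%E = (\int[mu]_x f x)%:E.
  by rewrite /Rintegral fineK //; exact: integrable_fin_num.
rewrite E in cv.
have -> : cutoff_int ^~ f = fine \o (fun n => \int[mu]_x (h n x)%:E)%E.
  by apply/funext => n; rewrite /cutoff_int Rintegral_mkcond.
exact: fine_cvg cv.
Qed.

End IntegralsOnTheLine.

(** * Energy bounds by truncation *)

Ltac cont := try assumption; lazymatch goal with
  | |- forall z, continuous_at z (fun y => @GRing.add _ (@?f y) (@?g y)) =>
      apply: (@continuousD' _ f g); cont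
  | |- forall z, continuous_at z (fun y => @GRing.opp _ (@?f y)) =>
      apply: (@continuousN' _ f); cont
  | |- forall z, continuous_at z (fun y => @GRing.mul _ (@?f y) (@?g y)) =>
      apply: (@continuousM' _ f g); cont
  | |- forall z, continuous_at z (fun y => @GRing.exp _ (@?f y) ?n) =>
      apply: (@continuousX' _ f n); cont
  | |- forall z, continuous_at z (fun y => cutoff ?n y) => exact: continuous_cutoff
  | |- forall z, continuous_at z (fun y => y) => exact: continuous_id'
  | |- forall z, continuous_at z (fun y => ?c) => exact: continuous_cst'
  | |- forall z, continuous_at z (fun y => @?f y) => try assumption
  end.

Section CutoffArguments.
Context {R : realType}.
Notation mu := (@lebesgue_measure R).
Implicit Types (f g h k w F G B V u v : R -> R) (a b c x y t E : R).

(** B is the boundary term of an integration by parts, killed by the cutoff; the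
    last term collects the error (chi')^2 <= 4/(n+1)^2 made by differentiating
    the cutoff chi. *)
Lemma cutoff_inequality n B B1 k w : has_der B B1 ->
  B n.+1%:R = 0 -> B (- n.+1%:R) = 0 -> continuous k -> continuous w ->
  (forall x, 0 <= w x) -> integrableT w ->
  (forall x, - n.+1%:R <= x <= n.+1%:R ->
     0 <= B1 x + cutoff n x ^+ 2 * k x + 4 / n.+1%:R ^+ 2 * w x) ->
  0 <= cutoff_int n k + 4 / n.+1%:R ^+ 2 * \int[mu]_x w x.
Proof.
move=> dB B0 B0' ck cw w0 iw hB.
have nn : - n.+1%:R <= n.+1%:R :> R by rewrite (@le_trans _ _ 0) // oppr_le0.
pose c : R := 4 / n.+1%:R ^+ 2.
have c0 : 0 <= c by rewrite divr_ge0 // exprn_ge0.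
rewrite -/c in hB *.
have ck2 : continuous (fun x => cutoff n x ^+ 2 * k x) by cont.
have ccw : continuous (fun x => c * w x) by cont.
have cs : continuous (fun x => cutoff n x ^+ 2 * k x + c * w x) by cont.
have dQ := has_der_potential cs; set Q := potential _ in dQ.
have : B (- n.+1%:R) + Q (- n.+1%:R) <= B n.+1%:R + Q n.+1%:R.
  apply: (@der_ge0_le _ (fun x => B x + Q x)
    (fun x => B1 x + (cutoff n x ^+ 2 * k x + c * w x))) => // [x _|x /andP[h1 h2]].
    by der.
  by rewrite addrA hB // !ltW.
rewrite B0 B0' !add0r -subr_ge0 /Q (potentialB (continuous_locint cs) nn).
rewrite RintegralD //; last 2 first.
- exact: continuous_locint.
- exact: continuous_locint.
rewrite RintegralZl //; last exact: continuous_locint.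
move=> h; apply: le_trans h _; rewrite lerD2l ler_wpM2l //.
exact: Rintegral_itv_leT.
Qed.

Lemma cvg_over_square (C : R) : C / n.+1%:R ^+ 2 @[n --> \oo] --> (0 : R).
Proof.
have := cvgM (cvg_cst C) (cvgM (@cvg_harmonic R) (@cvg_harmonic R)).
rewrite !mulr0 => h.
by under eq_fun do rewrite expr2 invfM; exact: h.
Qed.

(** The error term in [cutoff_inequality] disappears as n tends to infinity. *)
Lemma cutoff_limit_ge0 k (C : R) : integrableT k ->
  (forall n, 0 <= cutoff_int n k + C / n.+1%:R ^+ 2) -> 0 <= \int[mu]_x k x.
Proof.
move=> ik h; pose s n := cutoff_int n k + C / n.+1%:R ^+ 2.
have cv : s n @[n --> \oo] --> \int[mu]_x k x.
  by rewrite -[X in _ --> X]addr0; exact: cvgD (cutoff_int_cvg ik) (cvg_over_square C).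
rewrite -(cvg_lim _ cv) //.
apply: limr_ge; first by apply/cvg_ex; eexists; exact: cv.
by apply: nearW => n; exact: h.
Qed.

Lemma cutoff_fatou f c : (forall x, 0 <= f x) -> continuous f ->
  (forall n, cutoff_int n f <= c) -> integrableT f /\ \int[mu]_x f x <= c.
Proof.
move=> f0 cf hc; have lf := continuous_locint cf.
have cc n : continuous (fun x => cutoff n x ^+ 2 * f x) by cont.
have lc n := continuous_locint (cc n).
have If : integrableT f.
  apply: (proj1 (@integrableT_itv_bounded R f (2 * c) f0 lf (continuous_measurable cf) _)) => N.
  (* on [-N, N] the square of the cutoff of index 2N is at least 1/2 *)
  pose n := (N + N)%N.
  have Nn : N%:R <= n.+1%:R :> R by rewrite ler_nat /n -addnS leq_addr.
  have n0 : 0 < n.+1%:R :> R by rewrite ltr0n.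
  have h1 : \int[mu]_(x in `[- N%:R, N%:R]) f x <=
      2 * \int[mu]_(x in `[- N%:R, N%:R]) (cutoff n x ^+ 2 * f x).
    rewrite -RintegralZl //; last exact: lc.
    apply: Rintegral_itv_le => //; first by apply: continuous_locint; cont.
    move=> x /andP[x1 x2].
    have hn : N%:R + N%:R + 1 = n.+1%:R :> R by rewrite -natrD natr1.
    have hx : `|x / n.+1%:R| <= 1 / 2.
      rewrite normrM normfV (gtr0_norm n0) ler_pdivrMr // ler_norml -hn.
      by have N0 := ler0n R N; apply/andP; split; lra.
    have h : 1 <= 2 * cutoff n x ^+ 2.
      rewrite /cutoff; move: hx; move: (x / _) => y.
      rewrite ler_norml => /andP[y1 y2].
      have : 3 / 4 <= 1 - y ^+ 2 by rewrite expr2; nra.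
      by move: (1 - _) => z hz; rewrite expr2; nra.
    by rewrite mulrA ler_peMl.
  apply: le_trans h1 _; rewrite ler_wpM2l // (le_trans _ (hc n)) //.
  rewrite /cutoff_int /Rintegral fine_le //.
  - by apply: integrable_fin_num => //; exact: lc.
  - by apply: integrable_fin_num => //; exact: lc.
  - apply: ge0_subset_integral => //.
    + by apply: (measurable_int mu); exact: lc.
    + by move=> x _; rewrite lee_fin mulr_ge0 ?sqr_ge0.
    + by apply: subset_itv; rewrite bnd_simp // lerN2.
split=> //; have cv := cutoff_int_cvg If; rewrite -(cvg_lim _ cv) //.
apply: limr_le; first by apply/cvg_ex; eexists; exact: cv.
by apply: nearW => n; exact: hc.
Qed.

(** Testing the equation with chi^2 u (chi the cutoff) bounds the energy of an
    L^2 solution by its norm, since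
    (chi^2 u u')' = (chi u')^2 + 2 chi chi' u u' + chi^2 (V - E) u^2. *)
Theorem bound_state_energy V E u u1 : continuous V -> (forall x, 0 <= V x) -> 0 <= E ->
  solves (fun x => V x - E) u u1 -> integrableT (fun x => u x ^+ 2) ->
  [/\ integrableT (fun x => V x * u x ^+ 2), integrableT (fun x => u1 x ^+ 2) &
    \int[mu]_x (V x * u x ^+ 2) <= E * \int[mu]_x (u x ^+ 2)].
Proof.
move=> cV V0 E0 su iu; have [du du1] := su.
have cu := solves_continuous su; have cu1 := solves_continuous1 su.
set I := \int[mu]_x (u x ^+ 2).
have cu2 : continuous (fun x => u x ^+ 2) by cont.
have cVu : continuous (fun x => V x * u x ^+ 2) by cont.
have I0 : 0 <= I by apply: Rintegral_ge0 => x _; exact: sqr_ge0.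
(* the other half of u1^2 absorbs the cross term 2 chi chi' u u1 *)
pose f x := 2^-1 * u1 x ^+ 2 + V x * u x ^+ 2.
have cf : continuous f by rewrite /f; cont.
have f0 x : 0 <= f x.
  by rewrite /f; apply: addr_ge0; apply: mulr_ge0 => //; exact: sqr_ge0.
have key n : 0 <= cutoff_int n (fun x => E * u x ^+ 2 - f x) +
    4 / n.+1%:R ^+ 2 * \int[mu]_x (2 * u x ^+ 2).
  have [e1 e2] := @cutoff_end R n.
  apply: (@cutoff_inequality n (fun x => cutoff n x ^+ 2 * (u x * u1 x))
    (fun x => 2 * cutoff n x * cutoff1 n x * (u x * u1 x) +
       cutoff n x ^+ 2 * (u1 x ^+ 2 + (V x - E) * u x ^+ 2))).
  - by move=> x; have h := @der_cutoff R n; der; rewrite /=; ring.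
  - by rewrite e1 expr0n mul0r.
  - by rewrite e2 expr0n mul0r.
  - by cont.
  - by cont.
  - by move=> x; rewrite mulr_ge0 ?sqr_ge0.
  - exact: integrableTZ.
  move=> x xn; have h := cutoff1_sq xn; rewrite /f.
  have := ler_wpM2r (sqr_ge0 (u x)) h.
  move: (4 / _) (cutoff n x) (cutoff1 n x) (u x) (u1 x) (V x) => c q q1 z z1 W.
  have := sqr_ge0 (q * z1 + 2 * (q1 * z)).
  rewrite !expr2; lra.
have if_ : integrableT f /\ \int[mu]_x f x <= E * I + 8 * I.
  apply: cutoff_fatou => // n.
  have := key n; rewrite RintegralZl // -/I.
  have -> : cutoff_int n (fun x => E * u x ^+ 2 - f x) = E * cutoff_int n (fun x => u x ^+ 2) - cutoff_int n f.
    rewrite /cutoff_int -RintegralZl //; last by apply: continuous_locint; cont.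
    rewrite -RintegralB //; last 2 first.
    - by apply: continuous_locint; cont.
    - by apply: continuous_locint; cont.
    by apply: eq_Rintegral => x _; ring.
  have h1 : cutoff_int n (fun x => u x ^+ 2) <= I.
    apply: le_trans (Rintegral_itv_leT (- n.+1%:R) n.+1%:R iu (fun x => sqr_ge0 (u x))).
    apply: Rintegral_itv_le; [by apply: continuous_locint; cont|exact: continuous_locint|].
    move=> x /cutoff_itv /andP[c0 c1]; rewrite ler_piMl ?sqr_ge0 // expr_le1 //.
  have h2 : 4 / n.+1%:R ^+ 2 * (2 * I) <= 8 * I.
    have : 4 / n.+1%:R ^+ 2 <= 4 :> R.
      rewrite ler_pdivrMr ?exprn_gt0 // ler_peMr // expr_ge1 // ler1n //.
    have I20 : 0 <= 2 * I by lra.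
    by move=> h3; apply: le_trans (ler_wpM2r I20 h3) _; lra.
  move: h2 (ler_wpM2l E0 h1); move: (4 / n.+1%:R ^+ 2 * (2 * I)) => q; lra.
have iVu : integrableT (fun x => V x * u x ^+ 2).
  apply: (integrableT_le _ if_.1); first exact: continuous_measurable.
  move=> x; rewrite ger0_norm; last by rewrite mulr_ge0 ?sqr_ge0.
  by rewrite /f lerDr mulr_ge0 ?sqr_ge0.
have iu1 : integrableT (fun x => u1 x ^+ 2).
  have i2 := integrableTZ 2 if_.1.
  apply: (integrableT_le _ i2); first by apply: continuous_measurable; cont.
  move=> x; rewrite ger0_norm ?sqr_ge0 // /f.
  have := mulr_ge0 (V0 x) (sqr_ge0 (u x)); lra.
split=> //.
have : 0 <= \int[mu]_x (E * u x ^+ 2 - V x * u x ^+ 2).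
  apply: (@cutoff_limit_ge0 _ (8 * I)).
    have := integrableTD (integrableTZ E iu) (integrableTZ (-1) iVu).
    by apply: eq_integrable => // x _ /=; rewrite mulN1r.
  move=> n; have := key n; rewrite RintegralZl // -/I.
  have -> : 4 / n.+1%:R ^+ 2 * (2 * I) = 8 * I / n.+1%:R ^+ 2.
    by move: (n.+1%:R ^+ 2)^-1 => z; ring.
  move=> h; apply: le_trans h _; rewrite lerD2r.
  apply: Rintegral_itv_le; try by apply: continuous_locint; cont.
  move=> x _; rewrite ler_wpM2l ?sqr_ge0 // /f.
  have := sqr_ge0 (u1 x); lra.
rewrite RintegralB // ?RintegralZl // ?subr_ge0 //; exact: integrableTZ.
Qed.

(** Jacobi's factorisation: a positive solution phi of -phi'' + V2 phi = E2 phi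
    gives v'^2 + (V2 - E2) v^2 = (v' + p v)^2 - (p v^2)', p = - phi'/phi, so E2
    is a lower bound for the Rayleigh quotient; the trial function is the
    truncation chi u of an L^2 solution for another potential and energy. *)
Theorem variational_inequality V1 V2 E1 E2 u u1 v v1 : continuous V1 -> continuous V2 ->
  solves (fun x => V1 x - E1) u u1 -> integrableT (fun x => u x ^+ 2) ->
  solves (fun x => V2 x - E2) v v1 -> (forall x, 0 < v x) ->
  integrableT (fun x => (V2 x - V1 x) * u x ^+ 2) ->
  (E2 - E1) * \int[mu]_x (u x ^+ 2) <= \int[mu]_x ((V2 x - V1 x) * u x ^+ 2).
Proof.
move=> cV1 cV2 su iu sv v0 iW; have [du du1] := su; have [dv dv1] := sv.
have cu := solves_continuous su; have cu1 := solves_continuous1 su.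
have cv := solves_continuous sv; have cv1 := solves_continuous1 sv.
set I := \int[mu]_x (u x ^+ 2).
have iE := integrableTZ (E2 - E1) iu.
have ik : integrableT (fun x => (V2 x - V1 x) * u x ^+ 2 - (E2 - E1) * u x ^+ 2).
  have := integrableTD iW (integrableTZ (-1) iE).
  by apply: eq_integrable => // x _ /=; rewrite mulN1r.
suff : 0 <= \int[mu]_x ((V2 x - V1 x) * u x ^+ 2 - (E2 - E1) * u x ^+ 2).
  by rewrite RintegralB // RintegralZl // subr_ge0.
apply: (@cutoff_limit_ge0 _ (4 * I) ik) => n.
have -> : 4 * I / n.+1%:R ^+ 2 = 4 / n.+1%:R ^+ 2 * I by rewrite mulrAC.
have [e1 e2] := @cutoff_end R n.
apply: (@cutoff_inequality n
  (fun x => cutoff n x ^+ 2 * (u x * u1 x) - cutoff n x ^+ 2 * (u x ^+ 2 * (v1 x / v x)))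
  (fun x => 2 * cutoff n x * cutoff1 n x * (u x * u1 x) +
      cutoff n x ^+ 2 * (u1 x ^+ 2 + (V1 x - E1) * u x ^+ 2)
    - (2 * cutoff n x * cutoff1 n x * (u x ^+ 2 * (v1 x / v x)) +
       cutoff n x ^+ 2 * (2 * u x * u1 x * (v1 x / v x) +
         u x ^+ 2 * (V2 x - E2 - (v1 x / v x) ^+ 2))))).
- move=> x; have vx : v x != 0 by rewrite gt_eqF.
  have h := @der_cutoff R n; have h2 := derV vx (dv x).
  by der; rewrite /=; field.
- by rewrite e1 expr0n !mul0r subrr.
- by rewrite e2 expr0n !mul0r subrr.
- by cont.
- by cont.
- by move=> x; exact: sqr_ge0.
- by [].
move=> x xn; have h := cutoff1_sq xn.
have := ler_wpM2r (sqr_ge0 (u x)) h.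
move: (4 / _) (cutoff n x) (cutoff1 n x) (u x) (u1 x) (v1 x / v x) => c q q1 z z1 p.
move: (V1 x) (V2 x) => W1 W2.
have := sqr_ge0 (q * z1 + q1 * z - p * (q * z)).
rewrite !expr2; lra.
Qed.

End CutoffArguments.

(** * Smooth compactly supported functions *)

Section SmoothFunctions.
Context {R : realType}.
Notation mu := (@lebesgue_measure R).
Implicit Types (f g h w F G B V u v p q : R -> R) (a b c x y t E : R).

Fixpoint Cn (n : nat) f : Prop :=
  if n is n'.+1 then exists2 f1, has_der f f1 & Cn n' f1 else True.

Definition smooth f := forall n, Cn n f.

Lemma CnW n f : Cn n.+1 f -> Cn n f.
Proof. by elim: n f => // n IH f [f1 df /IH h]; exists f1. Qed.

Lemma Cn_cst n c : Cn n (fun=> c).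
Proof.
elim: n c => // n IH c; exists (fun=> 0); last exact: IH.
by move=> x; exact: der_cst.
Qed.

Lemma CnD n f g : Cn n f -> Cn n g -> Cn n (fun x => f x + g x).
Proof.
elim: n f g => // n IH f g [f1 df hf] [g1 dg hg].
by exists (fun x => f1 x + g1 x); [move=> x; der|exact: IH].
Qed.

Lemma CnM n f g : Cn n f -> Cn n g -> Cn n (fun x => f x * g x).
Proof.
elim: n f g => // n IH f g hf hg; have [f1 df hf1] := hf; have [g1 dg hg1] := hg.
exists (fun x => f1 x * g x + f x * g1 x); first by move=> x; der.
by apply: CnD; apply: IH => //; exact: CnW.
Qed.

Lemma CnZ n c f : Cn n f -> Cn n (fun x => c * f x).
Proof. by apply: CnM; exact: Cn_cst. Qed.

Lemma Cn_affine n f a b : Cn n f -> Cn n (fun x => f (a * x + b)).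
Proof.
elim: n f => // n IH f [f1 df hf].
exists (fun x => a * f1 (a * x + b)); last exact/CnZ/IH.
move=> x; have h : der_at x (fun y => a * y + b) a by der; ring.
by apply: der_eq; [exact: der_comp (df _) h|rewrite mulrC].
Qed.

Lemma has_der_derive1 f g : has_der f g -> derive1 f = g.
Proof.
by move=> d; apply/funext => x; rewrite derive1E; case: (d x).
Qed.

Lemma smooth_derivable f n x : smooth f -> derivable (derive1n n f) x 1.
Proof.
move=> sf; have : Cn n.+1 f by exact: sf.
elim: n f {sf} => [|n IH] f [f1 df hf1].
  by rewrite derive1n0; case: (df x).
by rewrite derive1Sn (has_der_derive1 df); exact: IH.
Qed.

Lemma smooth_has_der f : smooth f -> exists2 f1, has_der f f1 & smooth f1.
Proof.
move=> sf; have [f1 df _] := sf 1%N; exists f1 => // n.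
have [f2 df2 hf2] := sf n.+1.
by rewrite -(has_der_derive1 df) (has_der_derive1 df2).
Qed.

Lemma smooth_primitive f F : has_der F f -> smooth f -> smooth F.
Proof. by move=> dF sf [|n] //; exists f. Qed.

Lemma derivable_smooth f : (forall n x, derivable (derive1n n f) x 1) -> smooth f.
Proof.
move=> df n; elim: n f df => // n IH f df; exists (derive1 f).
  move=> x; have h := df 0%N x; rewrite derive1n0 in h.
  by have := derivableP h; rewrite -derive1E.
by apply: IH => m x; rewrite -derive1Sn; exact: df.
Qed.

(** The parameter k is there because this family spans a space closed under
    differentiation, see [der_flat]. *)
Definition flat (k : nat) x : R := if 0 < x then x ^- k * expR (- x^-1) else 0.

Lemma expR_ge_pow (m : nat) y : 0 <= y -> y ^+ m.+1 <= m.+1%:R ^+ m.+1 * expR y.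
Proof.
move=> y0; have m0 : 0 < m.+1%:R :> R by rewrite ltr0n.
have -> : expR y = expR (y / m.+1%:R) ^+ m.+1.
  by rewrite -expRM_natl -mulr_natl mulrCA divff ?mulr1 // gt_eqF.
have h0 : 0 <= m.+1%:R * expR (y / m.+1%:R) by rewrite mulr_ge0 ?expR_ge0 // ltW.
rewrite -exprMn; apply: lerXn2r => //.
have := expR_ge1Dx (y / m.+1%:R).
rewrite -ler_pdivrMl // mulrC; apply: le_trans.
by rewrite lerDr.
Qed.

(** Flatness at 0 enters only through this quadratic bound, which yields
    differentiability at 0 for all k at once. *)
Lemma flat_le (k : nat) x : `|flat k x| <= k.+2%:R ^+ k.+2 * x ^+ 2.
Proof.
rewrite /flat; case: ifPn => [x0|_]; last by rewrite normr0 mulr_ge0 ?sqr_ge0 // exprn_ge0.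
rewrite ger0_norm; last by rewrite mulr_ge0 ?expR_ge0 // invr_ge0 exprn_ge0 // ltW.
have y0 : 0 <= x^-1 by rewrite invr_ge0 ltW.
have := expR_ge_pow k.+1 y0; rewrite expRN.
set A := _%:R ^+ _; rewrite exprVn => h.
have x2 : 0 < x ^+ 2 by rewrite exprn_gt0.
have E : x ^- k.+2 * x ^+ 2 = x ^- k.
  rewrite -addn2 exprD invfM -mulrA mulVf ?mulr1 // gt_eqF //.
rewrite -E ler_pdivrMr ?expR_gt0 // [leRHS]mulrAC; apply: ler_wpM2r => //; exact: ltW.
Qed.

Lemma der_quadratic f C : (forall x, `|f x| <= C * x ^+ 2) -> der_at 0 f 0.
Proof.
move=> h; have f0 : f 0 = 0.
  by apply/eqP; rewrite -normr_le0; apply: le_trans (h 0) _; rewrite expr0n mulr0.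
have C0 : 0 <= C by have := le_trans (normr_ge0 _) (h 1); rewrite expr1n mulr1.
have cv : (fun s => s^-1 *: (f (s *: 1 + 0) - f 0)) @ 0^' --> (0 : R).
  apply/cvgr0Pnorm_lt => e e0; near=> s.
  have s0 : s != 0 by near: s; exact: nbhs_dnbhs_neq.
  rewrite f0 subr0 addr0 /GRing.scale /= mulr1 normrM normfV.
  rewrite ltr_pdivrMl ?normr_gt0 //.
  apply: (le_lt_trans (h s)); rewrite -real_normK ?num_real // expr2 mulrCA.
  rewrite ltr_pM2l ?normr_gt0 //.
  have s1 : `|s| < e / (C + 1).
    near: s; apply: nbhs_dnbhs; exists (e / (C + 1)) => /=; first by rewrite divr_gt0 //; lra.
    by move=> z /=; rewrite sub0r normrN.
  rewrite ltr_pdivlMr in s1; last by lra.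
  have := normr_ge0 s; nra.
apply: DeriveDef; first by apply/cvg_ex; exists 0.
by apply/cvg_lim.
Unshelve. all: by end_near. Qed.

Lemma der_flat (k : nat) : has_der (flat k) (fun x => flat k.+2 x - k%:R * flat k.+1 x).
Proof.
move=> x; have [x0|x0|->] := ltgtP x 0.
- have -> : flat k.+2 x - k%:R * flat k.+1 x = 0.
    by rewrite /flat ltNge (ltW x0) /= mulr0 subrr.
  apply: near_eq_is_derive (der_cst x 0).
  near=> y; rewrite /flat; case: ifPn => // y0.
  have : y < 0 by near: y; exists (- x) => [|z] /=; rewrite ?oppr_gt0 // ltr_norml; lra.
  by move/(lt_trans y0); rewrite ltxx.
- have xn : x != 0 by rewrite gt_eqF.
  have d1 := derV xn (der_id x).
  have d : der_at x (fun y => y^-1 ^+ k * expR (- y^-1))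
      (flat k.+2 x - k%:R * flat k.+1 x).
    der; rewrite /flat x0 /=.
    case: k => [|k]; first by rewrite !expr0; field.
    by rewrite -!exprVn /= !exprS; ring.
  apply: near_eq_is_derive d.
  near=> y; rewrite /flat; have -> : 0 < y by near: y; exists x => // z /=; rewrite ltr_norml; lra.
  by rewrite exprVn.
- have -> : flat k.+2 0 - k%:R * flat k.+1 0 = 0 by rewrite /flat ltxx mulr0 subrr.
  exact: der_quadratic (flat_le k).
Unshelve. all: by end_near. Qed.

Lemma smooth_flat (k : nat) : smooth (flat k).
Proof.
move=> n; elim: n k => // n IH k; exists (fun x => flat k.+2 x - k%:R * flat k.+1 x).
  exact: der_flat.
have := CnD (IH k.+2) (CnZ (- k%:R) (IH k.+1)).
by congr Cn; apply/funext => x; rewrite mulNr.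
Qed.

Definition bumpf x : R := flat 0 x * flat 0 (1 - x).

Lemma smooth_bump : smooth bumpf.
Proof.
move=> n; apply: CnM; first exact: smooth_flat.
have := @Cn_affine n (flat 0) (-1) 1 (smooth_flat 0 n).
by congr Cn; apply/funext => x; rewrite mulN1r addrC.
Qed.

Lemma bump_gt0 x : 0 < x < 1 -> 0 < bumpf x.
Proof.
move=> /andP[x0 x1]; rewrite /bumpf /flat x0 subr_gt0 x1 !expr0 !invr1 !mul1r.
by rewrite mulr_gt0 ?expR_gt0.
Qed.

Lemma bump_out x : x <= 0 \/ 1 <= x -> bumpf x = 0.
Proof.
rewrite /bumpf /flat; move=> [x0|x1]; first by rewrite ltNge x0 /= mul0r.
by rewrite subr_gt0 [x < 1]ltNge x1 /= mulr0.
Qed.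

Lemma bump_ge0 x : 0 <= bumpf x.
Proof.
have [x0|x0] := leP x 0; first by rewrite bump_out //; left.
have [x1|x1] := leP 1 x; first by rewrite bump_out //; right.
by rewrite ltW // bump_gt0 // x0.
Qed.

Lemma smooth_continuous f : smooth f -> continuous f.
Proof. by case/smooth_has_der => f1 /has_der_continuous. Qed.

(** The normalised primitive of the bump. *)
Lemma smooth_step : exists S, [/\ smooth S, forall x, x <= 0 -> S x = 0,
  forall x, 1 <= x -> S x = 1 & forall x, 0 <= S x <= 1].
Proof.
have cb := smooth_continuous smooth_bump.
have d := has_der_potential cb; set P := potential bumpf in d.
have P0 : P 0 = 0 by exact: potential0.
have mono x y : x <= y -> P x <= P y.
  move=> xy; apply: (@der_ge0_le _ P bumpf) => // z _; exact: bump_ge0.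
have neg x : x <= 0 -> P x = 0.
  move=> x0; rewrite -P0; apply: (@der_eq0_eq _ P bumpf) => // z.
  by move=> /andP[_ z0]; rewrite bump_out //; left; exact: ltW.
have pos x : 1 <= x -> P x = P 1.
  move=> x1; symmetry; apply: (@der_eq0_eq _ P bumpf) => // z.
  by move=> /andP[z0 _]; rewrite bump_out //; right; exact: ltW.
have P1 : 0 < P 1.
  rewrite -P0; apply: (@der_gt0_lt _ P bumpf) => // z; exact: bump_gt0.
exists (fun x => (P 1)^-1 * P x); split.
- move=> n; apply: CnZ; exact: (smooth_primitive d smooth_bump).
- by move=> x /neg ->; rewrite mulr0.
- by move=> x /pos ->; rewrite mulVf // gt_eqF.
move=> x; rewrite ler_pdivlMl // ler_pdivrMl // mulr0 mulr1; apply/andP; split.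
  by have [x0|x0] := leP x 0; [rewrite neg|rewrite -P0 mono // ltW].
by have [x1|x1] := leP 1 x; [rewrite pos|rewrite mono // ltW].
Qed.

Definition vanishes_out (N : R) f := forall x, N < `|x| -> f x = 0.

Lemma test_funP p : test_fun p <-> smooth p /\ exists N, vanishes_out N p.
Proof.
split.
  move=> [dp cp]; split; first exact: derivable_smooth.
  have [M [_ hM]] := compact_bounded cp.
  exists (`|M| + 1) => x xM; apply/eqP; apply: contrapT => /negP px.
  have sx : supp p x by apply: subset_closure.
  have := hM (`|M| + 1) _ x sx; rewrite ltr_pwDr ?ler_norm // => /(_ erefl) /=.
  by rewrite leNgt xM.
move=> [sp [N pN]]; split; first by move=> n x; exact: smooth_derivable.
apply: (@subclosed_compact _ (supp p) `[- N, N]%classic).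
- exact: closed_closure.
- exact: segment_compact.
rewrite /supp; have -> : `[- N, N]%classic = closure `[- N, N]%classic.
  by apply/closure_id; exact: interval_closed.
apply: closure_subset => x /= px; rewrite in_itv /= -ler_norml leNgt.
by apply/negP => /pN; apply/eqP.
Qed.

End SmoothFunctions.

(** * Integration by parts against compactly supported functions *)

Section Distributions.
Context {R : realType}.
Notation mu := (@lebesgue_measure R).
Implicit Types (f g h w F G B V K u v p q : R -> R) (a b c x y t E N : R).

Lemma vanishes_outW N M f : N <= M -> vanishes_out N f -> vanishes_out M f.
Proof. by move=> NM h x Mx; apply: h; exact: le_lt_trans NM Mx. Qed.

Lemma has_der_vanishes N f f1 : has_der f f1 -> vanishes_out N f -> vanishes_out N f1.
Proof.
move=> df fN x Nx.
have d0 : der_at x f 0.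
  apply: near_eq_is_derive (der_cst x 0).
  near=> y; rewrite fN //.
  near: y; exists (`|x| - N) => /=; first by rewrite subr_gt0.
  move=> y /= xy; have := ler_distD y x 0; rewrite !subr0; lra.
by have := has_der_derive1 df => /(congr1 (fun g => g x)) <-; rewrite derive1E; case: d0.
Unshelve. all: by end_near. Qed.

Lemma Rintegral_vanishes N f : vanishes_out N f ->
  \int[mu]_x f x = \int[mu]_(x in `[- N, N]) f x.
Proof.
move=> fN; rewrite [RHS]Rintegral_mkcond; congr Rintegral; apply/funext => x.
rewrite patchE; case: ifPn => //; rewrite notin_setE /= in_itv /= -ler_norml => /negP.
by rewrite -ltNge => /fN.
Qed.

Lemma integrableT_vanishes N f : vanishes_out N f ->
  mu.-integrable `[- N, N] (EFin \o f) -> integrableT f.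
Proof.
move=> fN If.
have := (integrable_mkcond (mu := mu) (EFin \o f) (measurable_itv `[- N, N])).1 If.
apply: eq_integrable => // x _; rewrite patchE; case: ifPn => //.
rewrite notin_setE /= in_itv /= -ler_norml => /negP.
by rewrite -ltNge => /fN ->.
Qed.

Lemma locint_mul_continuous f q : locint f -> continuous q -> locint (fun x => f x * q x).
Proof.
move=> lf cq a b.
pose N := Num.max `|a| `|b|.
have [M M0 hM] := continuous_bounded N cq.
have If : mu.-integrable `[a, b] (EFin \o (fun x => M * f x)) by exact: locintZ.
apply: (le_integrable _ _ _ If) => //.
  apply/measurable_EFinP; apply: measurable_funM.
    by apply/measurable_EFinP; apply: (measurable_int mu); exact: lf.
  by apply: measurable_funTS; exact: continuous_measurable.
move=> x /=; rewrite in_itv /= => /andP[ax xb]; rewrite lee_fin !normrM.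
rewrite (ger0_norm M0) mulrC ler_wpM2r // hM // ler_norml /N.
have := ler_norm b; have := ler_norm (- a); rewrite normrN => h1 h2.
have h3 : `|a| <= Num.max `|a| `|b| by rewrite le_max lexx.
have h4 : `|b| <= Num.max `|a| `|b| by rewrite le_max lexx orbT.
apply/andP; split; lra.
Qed.

Lemma vanishes_outMr N f q : vanishes_out N q -> vanishes_out N (fun x => f x * q x).
Proof. by move=> qN x /qN ->; rewrite mulr0. Qed.

Lemma integrableT_test N f q : locint f -> continuous q -> vanishes_out N q ->
  integrableT (fun x => f x * q x).
Proof.
move=> lf cq qN; apply: (@integrableT_vanishes N); first exact: vanishes_outMr.
exact: locint_mul_continuous.
Qed.

Lemma Rintegral_der N F f : 0 <= N -> has_der F f -> continuous f -> vanishes_out N f ->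
  \int[mu]_x f x = F N - F (- N).
Proof.
move=> N0 dF cf fN; have nn : - N <= N by lra.
rewrite (Rintegral_vanishes fN) -(potentialB (continuous_locint cf) nn).
have E x : potential f x = F x - F 0.
  apply: (@has_der_unique _ _ (fun x => F x - F 0) f (has_der_potential cf)).
    by move=> z; der; ring.
  by rewrite potential0 subrr.
rewrite !E; ring.
Qed.

Lemma Rintegral_by_parts N F f p p1 : 0 <= N -> has_der F f -> continuous f ->
  has_der p p1 -> continuous p1 -> vanishes_out N p ->
  \int[mu]_x (F x * p1 x) = - \int[mu]_x (f x * p x).
Proof.
move=> N0 dF cf dp cp1 pN; have p1N := has_der_vanishes dp pN.
have cF := has_der_continuous dF; have cp := has_der_continuous dp.
have pW := @vanishes_outW N (N + 1) _ ltac:(lra).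
apply/eqP; rewrite -addr_eq0; apply/eqP; rewrite -RintegralD //; last 2 first.
- exact: (integrableT_test (continuous_locint cF) cp1 p1N).
- exact: (integrableT_test (continuous_locint cf) cp pN).
rewrite (@Rintegral_der (N + 1) (fun x => F x * p x)) //; first last.
- move=> x /[dup] /(pW _ pN) -> /(pW _ p1N) ->; ring.
- by cont.
- by move=> x; der; ring.
- lra.
rewrite (pN (N + 1)) ?(pN (- (N + 1))) ?mulr0 ?subrr //; rewrite ?normrN ger0_norm; lra.
Qed.

Lemma potential_le N w x : locint w -> `|x| <= N ->
  `|potential w x| <= \int[mu]_(t in `[- N, N]) `|w t|.
Proof.
move=> lw xN; have lw' : locint (fun t => `|w t|).
  by move=> a b; exact: (integrable_norm (lw a b)).
have key a b : a <= b -> - N <= a -> b <= N ->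
    `|potential w b - potential w a| <= \int[mu]_(t in `[- N, N]) `|w t|.
  move=> ab Na bN; rewrite potentialB //.
  apply: le_trans (le_normr_Rintegral _ (lw a b)) _ => //.
  rewrite /Rintegral fine_le //.
  - by apply: integrable_fin_num => //; exact: lw'.
  - by apply: integrable_fin_num => //; exact: lw'.
  - apply: ge0_subset_integral => //.
    + by apply: (measurable_int mu); exact: lw'.
    + by apply: subset_itv; rewrite bnd_simp.
move: xN; rewrite ler_norml => /andP[xl xr].
have [x0|x0] := leP 0 x.
  by have := key 0 x x0 ltac:(lra) xr; rewrite potential0 subr0.
have := key x 0 (ltW x0) xl ltac:(lra).
by rewrite potential0 sub0r normrN.
Qed.

Lemma potential_sub f g x : locint f -> locint g ->
  potential (fun t => f t - g t) x = potential f x - potential g x.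
Proof.
move=> lf lg; rewrite /potential !RintegralB //; ring.
Qed.

Lemma locintB f g : locint f -> locint g -> locint (fun x => f x - g x).
Proof.
move=> lf lg; have := locintD lf (locintZ (-1) lg).
by under eq_fun do rewrite mulN1r.
Qed.

Lemma potential_continuous f : locint f -> continuous (potential f).
Proof.
move=> lf x; pose N := `|x| + 1.
have N0 : - N <= N by rewrite /N; have := normr_ge0 x; lra.
have h := @parameterized_integral_continuous R (- N) N f N0 (lf _ _).
have xN : x \in `](- N), N[.
  rewrite in_itv /=; have := ler_norm x; have := ler_norm (- x); rewrite normrN /N.
  by move=> h1 h2; apply/andP; split; lra.
have hx : {for x, continuous (fun y => \int[mu]_(t in `[- N, y]) f t)}.
  have NN : - N < N by rewrite /N; have := normr_ge0 x; lra.
  exact: (within_continuous_continuous NN h xN).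
have h2 : {for x, continuous (fun y => \int[mu]_(t in `[- N, y]) f t + potential f (- N))}.
  by apply: continuousD => //; exact: cst_continuous.
have E y : - N <= y -> \int[mu]_(t in `[- N, y]) f t + potential f (- N) = potential f y.
  by move=> Ny; rewrite -(potentialB lf Ny); ring.
have Nx : - N <= x by move: xN; rewrite in_itv /= => /andP[/ltW].
rewrite /continuous_at -(E x Nx); apply: cvg_trans h2.
apply: near_eq_cvg; near=> y; rewrite E //.
near: y; exists 1 => //= y /=; rewrite ltr_norml /N => /andP[h1 h2].
by have := ler_norm (- x); rewrite normrN; lra.
Unshelve. all: by end_near. Qed.

Lemma L1_approximation g N e : locint g -> 0 < e -> exists2 h, continuous h &
  \int[mu]_(t in `[- N, N]) `|g t - h t| <= e.
Proof.
move=> lg e0.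
pose D := `[- N, N]%classic.
have fin : (mu D < +oo)%E.
  by rewrite lebesgue_measure_itv /=; case: ifP => _; rewrite ?ltry.
have [h [ch ih]] := approximation_continuous_integrable (measurable_itv `[- N, N]) fin (lg (- N) N).
move/fine_cvgP => [_ /cvgr0Pnorm_lt /(_ _ e0)] [n _ /(_ n (leqnn n)) hn].
exists (h n) => //; apply/ltW; apply: le_lt_trans hn; exact: ler_norm.
Qed.

(** Integration by parts for the primitive of a locally integrable function,
    by density of continuous functions in L^1([-N, N]). *)
Lemma potential_by_parts N g p p1 : 0 <= N -> locint g ->
  has_der p p1 -> continuous p1 -> vanishes_out N p ->
  \int[mu]_x (potential g x * p1 x) = - \int[mu]_x (g x * p x).
Proof.
move=> N0 lg dp cp1 pN; have p1N := has_der_vanishes dp pN.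
have cp := has_der_continuous dp.
have lU : locint (potential g) by apply: continuous_locint; exact: potential_continuous.
apply/eqP; rewrite -addr_eq0 -normr_le0 leNgt; apply/negP => ll.
set A := _ + _ in ll.
have [C C0 hC] := continuous_bounded N cp; have [C1 C10 hC1] := continuous_bounded N cp1.
pose L := C1 * (N + N) + C + 1.
have L0 : 0 < L by rewrite /L; have := mulr_ge0 C10 N0; lra.
have e0 : 0 < `|A| / 2 / L by rewrite !divr_gt0.
have [h ch hh] := L1_approximation N lg e0.
have lh := continuous_locint ch; have lgh := locintB lg lh.
have lUh : locint (potential h) by apply: continuous_locint; exact: potential_continuous.
set e := \int[mu]_(t in _) _ in hh.
have lgh' : locint (fun t => `|g t - h t|).
  by move=> a b; exact: (integrable_norm (lgh a b)).
have E : A = \int[mu]_x ((potential g x - potential h x) * p1 x) + \int[mu]_x ((g x - h x) * p x).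
  have h0 := Rintegral_by_parts N0 (has_der_potential ch) ch dp cp1 pN.
  under [X in _ = X + _]eq_Rintegral do rewrite mulrBl.
  under [X in _ = _ + X]eq_Rintegral do rewrite mulrBl.
  rewrite !RintegralB //; first by rewrite h0 /A; ring.
  - exact: (integrableT_test lg cp pN).
  - exact: (integrableT_test lh cp pN).
  - exact: (integrableT_test lU cp1 p1N).
  - exact: (integrableT_test lUh cp1 p1N).
have le1 : `|\int[mu]_x ((potential g x - potential h x) * p1 x)| <= e * C1 * (N + N).
  rewrite (Rintegral_vanishes (N := N)); last exact: vanishes_outMr.
  have i1 := locint_mul_continuous (locintB lU lUh) cp1.
  apply: le_trans (le_normr_Rintegral _ (i1 _ _)) _ => //.
  apply: (@le_trans _ _ (\int[mu]_(x in `[- N, N]) (e * C1))).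
    apply: Rintegral_itv_le => //.
    - by move=> a b; exact: (integrable_norm (i1 a b)).
    - exact/continuous_locint/continuous_cst'.
    move=> x xN; rewrite -ler_norml in xN.
    rewrite normrM ler_pM // ?hC1 // -potential_sub //.
    exact: potential_le.
  rewrite Rintegral_cst //.
  have -> : fine (mu `[- N, N]%classic) = N + N.
    have := lebesgue_measure_itv `[- N, N]; rewrite /= lte_fin => ->.
    case: ltP => [_|hN] /=; first by rewrite opprK.
    have -> : N = 0 by apply/eqP; rewrite eq_le N0 andbT; lra.
    by rewrite addr0.
  by [].
have le2 : `|\int[mu]_x ((g x - h x) * p x)| <= e * C.
  rewrite (Rintegral_vanishes (N := N)); last exact: vanishes_outMr.
  have i1 := locint_mul_continuous lgh cp.
  apply: le_trans (le_normr_Rintegral _ (i1 _ _)) _ => //.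
  rewrite /e -RintegralZr //.
  apply: Rintegral_itv_le => //.
  - by move=> a b; exact: (integrable_norm (i1 a b)).
  - have := locintZ C lgh'; by under eq_fun do rewrite mulrC.
  move=> x xN; rewrite -ler_norml in xN.
  by rewrite normrM ler_wpM2l // hC.
have e00 : 0 <= e by exact: Rintegral_ge0.
have := ler_normD (\int[mu]_x ((potential g x - potential h x) * p1 x)) (\int[mu]_x ((g x - h x) * p x)).
rewrite -E => tri.
rewrite ler_pdivlMr // /L in hh.
move: tri le1 le2 hh; move: (`|A|) ll => aA ll; move: (`|_|) (`|_|) => z1 z2; lra.
Qed.

End Distributions.

(** * Distributional solutions are classical *)

Section Regularity.
Context {R : realType}.
Notation mu := (@lebesgue_measure R).
Implicit Types (f g h w F G B V K u v p q : R -> R) (a b c x y t E N : R).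

Lemma ae_imply (P Q : R -> Prop) : (forall x, P x -> Q x) ->
  {ae mu, forall x, P x} -> {ae mu, forall x, Q x}.
Proof.
move=> PQ [A [mA A0 hA]]; exists A; split=> // x /= hx; apply: hA => /= hx2.
by apply: hx; exact: PQ.
Qed.

Definition test p := smooth p /\ exists2 N, 0 <= N & vanishes_out N p.

Lemma test_test_fun p : test p <-> test_fun p.
Proof.
rewrite test_funP; split=> -[sp [N]]; first by move=> N0 pN; split=> //; exists N.
move=> pN; split=> //; exists `|N| => //; apply: vanishes_outW pN; exact: ler_norm.
Qed.

Lemma test_der p p1 : test p -> has_der p p1 -> test p1.
Proof.
move=> [sp [N N0 pN]] dp; split; last by exists N => //; exact: has_der_vanishes dp pN.
have [p1' dp' sp'] := smooth_has_der sp.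
by rewrite -(has_der_derive1 dp) (has_der_derive1 dp').
Qed.

Lemma test_continuous p : test p -> continuous p.
Proof. by case=> sp _; exact: smooth_continuous. Qed.

Lemma test_integrable v q : locint v -> test q -> integrableT (fun x => v x * q x).
Proof.
move=> lv tq; have cq := test_continuous tq; case: tq => _ [N N0 qN].
exact: integrableT_test lv cq qN.
Qed.

Lemma locint_cst c : locint (fun _ : R => c).
Proof. exact/continuous_locint/continuous_cst'. Qed.

Lemma test_integrable1 q : test q -> integrableT q.
Proof.
move=> tq; have := test_integrable (locint_cst 1) tq.
by under eq_fun do rewrite mul1r.
Qed.

Lemma testB p q c : test p -> test q -> test (fun x => p x - c * q x).
Proof.
move=> [sp [N N0 pN]] [sq [M M0 qM]]; split.
  move=> n; have := CnD (sp n) (CnZ (- c) (sq n)).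
  by under [X in Cn n X]eq_fun do rewrite mulNr.
exists (N + M); first exact: addr_ge0.
move=> x hx; rewrite pN ?qM ?mulr0 ?subrr //; apply: le_lt_trans hx; lra.
Qed.

(** The indicator function of ]a, b[ is the bounded limit of the test functions
    S(k(t - a)) - S(k(t - b) + 1), S a smooth step, as k tends to infinity. *)
Lemma integral_zero_of_tests v a b : locint v -> measurable_fun [set: R] v ->
  (forall q, test q -> \int[mu]_x (v x * q x) = 0) -> a < b ->
  \int[mu]_(x in `[a, b]) v x = 0.
Proof.
move=> lv mv hv ab.
have [S [sS S0 S1 S01]] := @smooth_step R.
(* with k (b - a) >= 1 the rise and the fall of the step do not overlap *)
pose k (n : nat) : R := n.+1%:R / (b - a).
have ba : 0 < b - a by rewrite subr_gt0.
have k_ge (n : nat) : 1 <= k n * (b - a) by rewrite /k mulfVK ?gt_eqF // ler1n.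
have k0 n : 0 < k n by rewrite /k divr_gt0.
pose q n t := S (k n * t + - (k n * a)) - S (k n * t + (1 - k n * b)).
have qout n t : t <= a \/ b <= t -> q n t = 0.
  rewrite /q => -[ta|bt].
    have := ler_wpM2l (ltW (k0 n)) ta; have := k_ge n; rewrite mulrBr => h1 h2.
    by rewrite !S0 ?subrr //; lra.
  have := ler_wpM2l (ltW (k0 n)) bt; have := k_ge n; rewrite mulrBr => h1 h2.
  by rewrite !S1 ?subrr //; lra.
have q1 n t : `|q n t| <= 1.
  rewrite /q; have /andP[a1 a2] := S01 (k n * t + - (k n * a)).
  have /andP[b1 b2] := S01 (k n * t + (1 - k n * b)).
  by rewrite ler_norml; apply/andP; split; lra.
have tq n : test (q n).
  split.
    move=> m; have h1 := @Cn_affine R m S (k n) (- (k n * a)) (sS m).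
    have h2 := @Cn_affine R m S (k n) (1 - k n * b) (sS m).
    have := CnD h1 (CnZ (-1) h2).
    by under [X in Cn m X]eq_fun do rewrite mulN1r.
  exists (`|a| + `|b|); first exact: addr_ge0.
  move=> x; have [x0|x0] := ltP 0 x.
    rewrite (gtr0_norm x0) => hx; apply: qout; right.
    by have := ler_norm b; have := normr_ge0 a; lra.
  rewrite (ler0_norm x0) => hx; apply: qout; left.
  by have := ler_norm (- a); rewrite normrN; have := normr_ge0 b; lra.
pose L := v \_ `]a, b[.
have cvL x : (v x * q n x)%:E @[n --> \oo] --> (L x)%:E.
  apply: cvg_EFin; first by apply: nearW.
  rewrite /L patchE; case: ifPn.
    rewrite inE /= in_itv /= => /andP[ax xb].
    pose d := Num.min (x - a) (b - x).
    have d0 : 0 < d by rewrite lt_min !subr_gt0 ax.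
    apply: cvg_near_cst; exists (Num.truncn ((b - a) / d)) => // n /= hn.
    have kd : 1 <= k n * d.
      have c0 : 0 <= (b - a) / d by rewrite divr_ge0 // ltW.
      have /andP[_ h1] := truncn_itv c0.
      have h2 : (b - a) / d <= n.+1%:R by apply: (le_trans (ltW h1)); rewrite ler_nat.
      rewrite ler_pdivrMr // in h2.
      by rewrite /k mulrAC ler_pdivlMr // mul1r.
    have [da db] : d <= x - a /\ d <= b - x by rewrite !ge_min !lexx orbT.
    have h1 := ler_wpM2l (ltW (k0 n)) da; have h2 := ler_wpM2l (ltW (k0 n)) db.
    by rewrite /q S1 ?S0 ?subr0 ?mulr1 //; lra.
  rewrite notin_setE /= in_itv /= => /negP h.
  have Z n : v x * q n x = 0.
    by rewrite qout ?mulr0 //; move: h; rewrite negb_and -!leNgt => /orP[?|?]; [left|right].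
  by under eq_fun do rewrite Z; exact: cvg_cst.
pose G x := `|(v \_ `[a, b]) x|.
have iG : mu.-integrable setT (EFin \o (v \_ `[a, b])).
  rewrite -restrict_EFin.
  exact: ((integrable_mkcond (mu := mu) (EFin \o v) (measurable_itv `[a, b])).1 (lv a b)).
have iG' := integrable_norm iG.
have [] := @dominated_convergence _ _ R mu setT measurableT
  (fun n x => (v x * q n x)%:E) (fun x => (L x)%:E) (fun x => (G x)%:E).
- move=> n; have mq := continuous_measurable (test_continuous (tq n)).
  exact: (measurableT_comp (@EFin_measurable R setT) (measurable_funM mv mq)).
- apply: (measurableT_comp (@EFin_measurable R setT)).
  by apply/(measurable_restrictT _ (measurable_itv _)); exact: measurable_funTS.
- by apply: aeW => x _; exact: cvL.
- exact: iG'.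
- apply: aeW => x n _ /=; rewrite lee_fin normrM /G /= patchE.
  case: ifPn; first by move=> _; rewrite ler_piMr.
  rewrite notin_setE /= in_itv /= => /negP h.
  rewrite qout ?normr0 ?mulr0 //.
  by move: h; rewrite negb_and -!ltNge => /orP[?|?]; [left|right]; exact: ltW.
move=> iL _ cv.
have E n : (\int[mu]_x (v x * q n x)%:E = 0)%E.
  have fin : (\int[mu]_x (v x * q n x)%:E)%E \is a fin_num.
    by apply: integrable_fin_num => //; exact: test_integrable.
  by rewrite -(fineK fin); congr EFin; exact: hv.
have : (\int[mu]_x (L x)%:E = 0)%E.
  rewrite -(cvg_lim _ cv) //; under eq_fun do rewrite E; exact: lim_cst.
move=> L0; have : \int[mu]_x L x = 0 by rewrite /Rintegral L0.
rewrite -Rintegral_mkcond Rintegral_itv_bndo_bndc; last first.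
  by apply: integrableS (lv a b) => //; exact: subset_itv_oo_cc.
rewrite Rintegral_itv_obnd_cbnd //.
by apply: integrableS (lv a b) => //; exact: subset_itv_oc_cc.
Qed.

(** Lebesgue's differentiation theorem, applied to the primitive starting at -n
    for every integer n. *)
Lemma ae_zero_of_integrals v : locint v -> measurable_fun [set: R] v ->
  (forall a b, a < b -> \int[mu]_(x in `[a, b]) v x = 0) ->
  {ae mu, forall x, v x = 0}.
Proof.
move=> lv mv hv.
have liv : locally_integrable [set: R] v.
  split=> //; first exact: openT.
  move=> K _ cK; have [M [_ hM]] := compact_bounded cK.
  pose N := `|M| + 1.
  have KN : K `<=` `[- N, N]%classic.
    move=> x Kx /=; rewrite in_itv /= -ler_norml.
    by apply: (hM N) => //; rewrite /N ltr_pwDr // ler_norm.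
  have /integrableP[mN fN] := lv (- N) N.
  apply: le_lt_trans fN; apply: ge0_subset_integral => //.
  - exact: compact_measurable.
  - by apply/measurable_EFinP; apply: measurable_funTS; exact: measurableT_comp.
pose F n x := \int[mu]_(t in `[- n%:R, x]) v t.
have h n : {ae mu, forall x, - n%:R < x -> derivable (F n) x 1 /\ derive1 (F n) x = v x}.
  have := @FTC1 R v (BLeft (- n%:R)) (fun y => lv _ _) liv.
  by apply: ae_imply => x hx nx; apply: hx; rewrite /= lte_fin.
have := ae_foralln h; apply: ae_imply => x hx.
pose n := (Num.truncn `|x|).+1.
have nx : - n%:R < x.
  have /andP[_ h1] := truncn_itv (normr_ge0 x).
  by have := ler_norm (- x); rewrite normrN /n; lra.
have [_ <-] := hx n nx.
have d0 : der_at x (F n) 0.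
  apply: near_eq_is_derive (der_cst x 0).
  near=> y; rewrite /F hv //.
  near: y; exists (x + n%:R) => /=; first lra.
  by move=> y /=; rewrite ltr_norml; lra.
by rewrite derive1E; case: d0.
Unshelve. all: by end_near. Qed.

Lemma ae_zero_of_tests v : locint v -> measurable_fun [set: R] v ->
  (forall q, test q -> \int[mu]_x (v x * q x) = 0) -> {ae mu, forall x, v x = 0}.
Proof.
move=> lv mv hv; apply: ae_zero_of_integrals => // a b.
exact: integral_zero_of_tests.
Qed.

(** A test function is the derivative of a test function as soon as its
    integral vanishes; subtracting a multiple of a fixed rho arranges that. *)
Lemma test_primitive : exists2 rho : R -> R, test rho &
  forall q, test q -> exists2 p, test p &
    has_der p (fun x => q x - (\int[mu]_y q y) * rho x).
Proof.
pose B := @bumpf R.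
have cB : continuous B by exact: smooth_continuous smooth_bump.
have B1 : vanishes_out 1 B.
  move=> x x1; rewrite /B bump_out //; have [x0|x0] := leP x 0; [by left|right].
  by move: x1; rewrite gtr0_norm // => /ltW.
have dP := has_der_potential cB.
have I0 : 0 < \int[mu]_y B y.
  rewrite (Rintegral_der ler01 dP cB B1) subr_gt0.
  apply: (@lt_le_trans _ _ (potential B 1)) => //.
  apply: (@le_lt_trans _ _ (potential B 0)).
    by apply: (@der_ge0_le _ _ B) => [|//|x _]; [lra|exact: bump_ge0].
  apply: (@der_gt0_lt _ _ B) => // x; exact: bump_gt0.
set I := \int[mu]_y B y in I0.
pose rho x := I^-1 * B x.
have trho : test rho.
  split; first by move=> n; apply: CnZ; exact: smooth_bump.
  by exists 1 => // x /B1; rewrite /rho => ->; rewrite mulr0.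
have Irho : \int[mu]_y rho y = 1.
  rewrite RintegralZl //; last first.
    by apply: (integrableT_vanishes B1); exact: continuous_locint.
  by rewrite mulVf // gt_eqF.
exists rho => // q tq; set c := \int[mu]_y q y.
pose w x := q x - c * rho x.
have tw : test w by exact: testB.
have cw := test_continuous tw.
have Iw : \int[mu]_y w y = 0.
  rewrite /w RintegralB //; last 2 first.
  - exact: test_integrable1.
  - by apply: integrableTZ; exact: test_integrable1.
  by rewrite RintegralZl //; [rewrite Irho mulr1 subrr|exact: test_integrable1].
have [sw [N N0 wN]] := tw.
have dW := has_der_potential cw.
pose p x := potential w x - potential w (- N).
have dp : has_der p w by move=> x; rewrite /p; der; ring.
exists p => //; split; first exact: smooth_primitive dp sw.
exists N => // x Nx.
have [x0|x0] := leP 0 x.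
  have -> : p x = p N.
    symmetry; apply: (@der_eq0_eq _ p w) => [|z _|z /andP[Nz _]].
    - by move: Nx; rewrite ger0_norm // => /ltW.
    - exact: dp.
    - by apply: wN; rewrite gtr0_norm //; lra.
  have := Rintegral_der N0 dW cw wN.
  by rewrite Iw /p => <-.
have -> : p x = p (- N).
  apply: (@der_eq0_eq _ p w) => [|z _|z /andP[_ zN]].
  - by move: Nx; rewrite ltr0_norm //; lra.
  - exact: dp.
  - by apply: wN; rewrite ltr0_norm //; lra.
by rewrite /p subrr.
Qed.

(** By [test_primitive], testing v - c against q with c = int v rho amounts to
    testing v against the derivative of a test function. *)
Lemma du_bois_reymond v : locint v -> measurable_fun [set: R] v ->
  (forall p p1, test p -> has_der p p1 -> \int[mu]_x (v x * p1 x) = 0) ->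
  exists c, {ae mu, forall x, v x = c}.
Proof.
move=> lv mv hv; have [rho trho hrho] := test_primitive.
pose c := \int[mu]_x (v x * rho x); exists c.
have l1 : locint (fun x => v x - c) by exact: locintB lv (locint_cst c).
have := @ae_zero_of_tests (fun x => v x - c) l1; case.
- apply: measurable_funB => //; exact: measurable_cst.
- move=> q tq; have [p tp dp] := hrho q tq.
  have := hv _ _ tp dp.
  set I := \int[mu]_y q y.
  under eq_Rintegral do rewrite mulrBr mulrCA.
  rewrite RintegralB //; last 2 first.
  - exact: test_integrable.
  - by apply: integrableTZ; exact: test_integrable.
  rewrite RintegralZl //; last exact: test_integrable.
  under [in X in _ -> X]eq_Rintegral do rewrite mulrBl.
  rewrite RintegralB //; last 2 first.
  - exact: test_integrable.
  - by apply: integrableTZ; exact: test_integrable1.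
  rewrite RintegralZl //; last exact: test_integrable1.
  by rewrite -/I -/c [c * _]mulrC.
- move=> A hA; apply: (ae_imply _ (ex_intro _ A hA)) => x /= hx.
  by apply/eqP; rewrite -subr_eq0; apply/eqP.
Qed.

(** With d = int v rho', the distribution (v + d x)' annihilates every test
    function p, because p differs from a derivative by a multiple of rho. *)
Lemma du_bois_reymond2 v : locint v -> measurable_fun [set: R] v ->
  (forall p p1 p2, test p -> has_der p p1 -> has_der p1 p2 ->
    \int[mu]_x (v x * p2 x) = 0) ->
  exists c d, {ae mu, forall x, v x = c + d * x}.
Proof.
move=> lv mv hv; have [rho trho hrho] := test_primitive.
have [rho1 drho _] := smooth_has_der trho.1.
have trho1 := test_der trho drho.
pose d := \int[mu]_x (v x * rho1 x).
have lid : locint (fun x => d * x).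
  by apply: continuous_locint; cont.
have mid : measurable_fun [set: R] (fun x => d * x).
  by apply: continuous_measurable; cont.
have [] := @du_bois_reymond (fun x => v x + d * x).
- exact: locintD.
- exact: measurable_funD.
- move=> p p1 tp dp; have tp1 := test_der tp dp; have [q tq dq] := hrho p tp.
  set I := \int[mu]_y p y in dq.
  have dq1 : has_der (fun x => p x - I * rho x) (fun x => p1 x - I * rho1 x).
    by move=> x; der; ring.
  have := hv _ _ _ tq dq dq1.
  under eq_Rintegral do rewrite mulrBr mulrCA.
  rewrite RintegralB //; last 2 first.
  - exact: test_integrable.
  - by apply: integrableTZ; exact: test_integrable.
  rewrite RintegralZl //; last exact: test_integrable.
  under [in X in _ -> X]eq_Rintegral do rewrite mulrDl.
  rewrite RintegralD //; last 2 first.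
  - exact: test_integrable.
  - exact: test_integrable.
  have [_ [N N0 pN]] := tp.
  have did : has_der (fun x => d * x) (fun=> d) by move=> x; der; ring.
  rewrite (Rintegral_by_parts N0 did (@continuous_cst' R d) dp (test_continuous tp1) pN).
  rewrite RintegralZl //; last exact: test_integrable1.
  by rewrite -/I -/d [d * _]mulrC.
move=> c hc; exists c, (- d); apply: ae_imply hc => x <-; ring.
Qed.

(** From 2 |u| <= 1 + u^2. *)
Lemma locint_sqr u : measurable_fun [set: R] u -> integrableT (fun x => u x ^+ 2) -> locint u.
Proof.
move=> mu_ iu a b.
have i2 : mu.-integrable `[a, b] (EFin \o (fun x => 1 + u x ^+ 2)).
  exact: (locintD (locint_cst 1) (integrableT_locint iu)).
apply: (le_integrable _ _ _ i2) => //.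
  by apply/measurable_EFinP; exact: measurable_funTS.
move=> x _ /=; rewrite lee_fin [leRHS]ger0_norm ?addr_ge0 ?sqr_ge0 //.
rewrite -[u x ^+ 2]real_normK ?num_real //; move: `|u x| => z.
have := sqr_ge0 (z - 1); have := sqr_ge0 z; rewrite !expr2; lra.
Qed.

(** Weyl's lemma in dimension one: a locally integrable distributional solution
    agrees almost everywhere with a classical one, because u and the second
    primitive of K u have the same second derivative. *)
Theorem weak_solution_classical K u : continuous K -> measurable_fun [set: R] u -> locint u ->
  (forall p p1 p2, test p -> has_der p p1 -> has_der p1 p2 ->
     \int[mu]_x (u x * p2 x) = \int[mu]_x (K x * u x * p x)) ->
  exists v v1, solves K v v1 /\ {ae mu, forall x, u x = v x}.
Proof.
move=> cK mu_ lu hu.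
have lg : locint (fun x => K x * u x).
  by have := locint_mul_continuous lu cK; under eq_fun do rewrite mulrC.
pose G0 := potential (fun x => K x * u x).
have cG0 : continuous G0 by exact: potential_continuous.
have dG1 := has_der_potential cG0; set G1 := potential G0 in dG1.
have lG1 := continuous_locint (has_der_continuous dG1).
have [] := @du_bois_reymond2 (fun x => u x - G1 x).
- exact: locintB.
- by apply: measurable_funB => //; exact: (continuous_measurable (has_der_continuous dG1)).
- move=> p p1 p2 tp dp dp1; have tp1 := test_der tp dp; have tp2 := test_der tp1 dp1.
  under eq_Rintegral do rewrite mulrBl.
  rewrite RintegralB //; [|exact: test_integrable|exact: test_integrable].
  have [_ [N N0 pN]] := tp; have [_ [N1 N10 p1N]] := tp1.
  rewrite (Rintegral_by_parts N10 dG1 cG0 dp1 (test_continuous tp2) p1N).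
  rewrite (potential_by_parts N0 lg dp (test_continuous tp1) pN).
  by rewrite (hu _ _ _ tp dp dp1) opprK subrr.
move=> c [d hcd].
pose v x := G1 x + (c + d * x); pose v1 x := G0 x + d.
have uv : {ae mu, forall x, u x = v x}.
  apply: ae_imply hcd => x; rewrite /v => <-; ring.
have dv : has_der v v1 by move=> x; rewrite /v /v1; der; ring.
exists v, v1; split=> //; split=> //.
have cv := has_der_continuous dv.
have cKv : continuous (fun x => K x * v x) by cont.
have E x : G0 x = potential (fun x => K x * v x) x.
  have key a b : \int[mu]_(x in `[a, b]) (K x * u x) = \int[mu]_(x in `[a, b]) (K x * v x).
    rewrite /Rintegral; congr fine; apply: ae_eq_integral => //.
    - by apply: (measurable_int mu); exact: lg.
    - by apply: (measurable_int mu); exact: continuous_locint.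
    by apply: ae_imply uv => z -> .
  by rewrite /G0 /potential !key.
have -> : v1 = (fun x => potential (fun x => K x * v x) x + d).
  by apply/funext => x; rewrite /v1 E.
by have h := has_der_potential cKv => x; der; ring.
Qed.

End Regularity.

(** * Vector potentials of the profiles *)

Section Potentials.
Context {R : realType}.
Notation mu := (@lebesgue_measure R).
Implicit Types (a b f g h u v : R -> R) (x y t c : R).

Lemma L2P u : L2 u <-> measurable_fun [set: R] u /\ integrableT (fun x => u x ^+ 2).
Proof.
rewrite /L2 /=; split.
  move=> hu; split; last exact: Lfun2_integrable_sqr.
  by move: hu; rewrite inE => /andP[]; rewrite inE.
move=> [mu_ iu]; rewrite inE; apply/andP; split; first by rewrite inE.
rewrite inE /= /finite_norm unlock /Lnorm; apply: poweR_lty.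
have /integrableP[_] := iu; apply: le_lt_trans.
apply: ge0_le_integral => //.
- by move=> x _; exact: poweR_ge0.
- apply: (measurableT_comp (f := fun z => (`|z| `^ 2%R)%E)); last exact/measurable_EFinP.
  apply: (measurableT_comp (f := fun z => (z `^ 2%R)%E)); first exact: measurable_poweR.
  exact: abse_measurable.
- apply: (measurableT_comp (f := fun z => (`|z|)%E)); first exact: abse_measurable.
  by apply/measurable_EFinP; apply: measurable_funX.
by move=> x _ /=; rewrite lee_fin powR_mulrn // normrX.
Qed.

Lemma Rintegral_itv_cst c x y : x <= y -> \int[mu]_(t in `[x, y]) c = c * (y - x).
Proof.
move=> xy; have cc := @continuous_cst' R c.
rewrite -(potentialB (continuous_locint cc) xy).
have E z : potential (fun=> c) z = c * z.
  apply: (@has_der_unique _ _ (fun z => c * z) (fun=> c) (has_der_potential cc)).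
    by move=> w; der; ring.
  by rewrite potential0 mulr0.
by rewrite !E; ring.
Qed.

(** The bounds bm <= b <= bp in integrated form, for the vector potential. *)
Definition admissible (bm bp : R) a :=
  a 0 = 0 /\ forall x y, x <= y -> bm * (y - x) <= a y - a x <= bp * (y - x).

Section Profile.
Variables (bm bp : R) (b : R -> R).
Hypothesis hb : profiles bm bp b.

(** A monotone function lies between its limits at both ends. *)
Lemma profile_bounds x : bm <= b x <= bp.
Proof.
have [_ mono lm lp] := hb; apply/andP; split; rewrite leNgt; apply/negP => h.
- have e0 : 0 < bm - b x by rewrite subr_gt0.
  move/cvgrPdist_lt: lm => /(_ _ e0) near_b.
  have [y [yx]] : exists y, y <= x /\ `|bm - b y| < bm - b x.
    suff : \forall y \near -oo, y <= x /\ `|bm - b y| < bm - b x.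
      by move/filter_ex.
    by apply: filterI => //; apply: nbhs_ninfty_le; exact: num_real.
  by have := mono _ _ yx; rewrite ltr_norml => h1 /andP[_ h2]; lra.
- have e0 : 0 < b x - bp by rewrite subr_gt0.
  move/cvgrPdist_lt: lp => /(_ _ e0) near_b.
  have [y [yx]] : exists y, x <= y /\ `|bp - b y| < b x - bp.
    suff : \forall y \near +oo, x <= y /\ `|bp - b y| < b x - bp.
      by move/filter_ex.
    by apply: filterI => //; apply: nbhs_pinfty_ge; exact: num_real.
  by have := mono _ _ yx; rewrite ltr_norml => h1 /andP[h2 _]; lra.
Qed.

Lemma profile_measurable : measurable_fun [set: R] b.
Proof. by have [+ _ _ _] := hb; rewrite inE => /andP[]; rewrite inE. Qed.

Lemma profile_locint : locint b.
Proof.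
move=> x y; have ic := continuous_locint (@continuous_cst' R (`|bm| + `|bp|)) x y.
apply: (le_integrable _ _ _ ic) => //.
  by apply/measurable_EFinP; apply: measurable_funTS; exact: profile_measurable.
move=> z _ /=; rewrite lee_fin [leRHS]ger0_norm ?addr_ge0 //.
have /andP[h1 h2] := profile_bounds z.
have := ler_norm (- bm); have := ler_norm bp; rewrite normrN => h3 h4.
have := normr_ge0 bm; have := normr_ge0 bp => h5 h6.
by rewrite ler_norml; apply/andP; split; lra.
Qed.

Lemma profile_admissible : admissible bm bp (potential b).
Proof.
split=> [|x y xy]; first exact: potential0.
rewrite (potentialB profile_locint xy) -!(Rintegral_itv_cst _ xy).
apply/andP; split; apply: Rintegral_itv_le => //; try exact: profile_locint;
  try exact: locint_cst; by move=> z _; have /andP[] := profile_bounds z.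
Qed.

End Profile.

Lemma potential_mix b b' e x : locint b -> locint b' ->
  potential (mix b b' e) x = potential b x + e * (potential b' x - potential b x).
Proof.
move=> lb lb'; have l1 := locintZ (1 - e) lb; have l2 := locintZ e lb'.
have key c d : \int[mu]_(t in `[c, d]) mix b b' e t =
    (1 - e) * \int[mu]_(t in `[c, d]) b t + e * \int[mu]_(t in `[c, d]) b' t.
  by rewrite /mix RintegralD // !RintegralZl.
by rewrite /potential !key; ring.
Qed.

Lemma admissible_mix bm bp b b' e : profiles bm bp b -> profiles bm bp b' ->
  0 <= e <= 1 -> admissible bm bp (potential (mix b b' e)).
Proof.
move=> hb hb' /andP[e0 e1]; have lb := profile_locint hb; have lb' := profile_locint hb'.
split=> [|x y xy]; first exact: potential0.
have [_ /(_ x y xy) /andP[h1 h2]] := profile_admissible hb.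
have [_ /(_ x y xy) /andP[h3 h4]] := profile_admissible hb'.
rewrite !(potential_mix _ _ lb lb'); move: h1 h2 h3 h4.
move: (potential b x) (potential b y) (potential b' x) (potential b' y) (bm * _) (bp * _).
move=> p q p' q' k l h1 h2 h3 h4; apply/andP; split; nra.
Qed.

Lemma admissible_lipschitz bm bp a x y : 0 < bm -> admissible bm bp a ->
  `|a x - a y| <= bp * `|x - y|.
Proof.
move=> bm0 [_ ha]; have [xy|yx] := leP x y.
  have /andP[h1 h2] := ha x y xy; have h3 : 0 <= bm * (y - x) by rewrite mulr_ge0 ?subr_ge0 // ltW.
  rewrite distrC [`|x - y|]distrC !ger0_norm //; [by rewrite subr_ge0|lra].
have /andP[h1 h2] := ha y x (ltW yx).
have h3 : 0 <= bm * (x - y) by rewrite mulr_ge0 ?subr_ge0 // ltW.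
rewrite !ger0_norm //; [by rewrite subr_ge0 ltW|lra].
Qed.

Lemma admissible_continuous bm bp a : 0 < bm -> admissible bm bp a -> continuous a.
Proof.
move=> bm0 ha x; apply/cvgrPdist_lt => e e0.
have bp0 : 0 < `|bp| + 1 by rewrite ltr_pwDr.
have d0 : 0 < e / (`|bp| + 1) by rewrite divr_gt0.
near=> y.
have xy : `|x - y| < e / (`|bp| + 1) by near: y; exists (e / (`|bp| + 1)) => //=.
apply: le_lt_trans (admissible_lipschitz x y bm0 ha) _.
rewrite ltr_pdivlMr // in xy.
have := ler_norm bp; have := normr_ge0 (x - y); nra.
Unshelve. all: by end_near. Qed.

Lemma admissible_center bm bp a xi : 0 < bm -> admissible bm bp a ->
  exists x0, a x0 = xi.
Proof.
move=> bm0 ha; have ca := admissible_continuous bm0 ha; have [a0 h] := ha.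
pose M := `|xi| / bm.
have M0 : 0 <= M by rewrite divr_ge0 // ltW.
have ME : bm * M = `|xi| by rewrite /M mulrC mulfVK // gt_eqF.
have /andP[h1 _] := h 0 M M0.
have /andP[h2 _] := h (- M) 0 ltac:(lra).
have NM : - M <= M by lra.
have [|x _ hx] := @IVT R a (- M) M xi NM (continuous_in (D := `[- M, M]%classic) ca); last by exists x.
have := ler_norm xi; have := ler_norm (- xi); rewrite normrN ge_min le_max.
move=> h3 h4; apply/andP; split; apply/orP; [left|right]; lra.
Qed.

(** The potential of the fibre operator, seen from its zero x0, lies between two
    harmonic oscillators. *)
Lemma admissible_well bm bp a x0 t : 0 < bm -> admissible bm bp a ->
  bm ^+ 2 * t ^+ 2 <= (a x0 - a (x0 + t)) ^+ 2 <= bp ^+ 2 * t ^+ 2.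
Proof.
move=> bm0 ha; have [_ h] := ha.
have lip := admissible_lipschitz x0 (x0 + t) bm0 ha.
have low : bm * `|t| <= `|a x0 - a (x0 + t)|.
  have [t0|t0] := leP 0 t.
    have /andP[h1 _] := h x0 (x0 + t) ltac:(lra).
    rewrite distrC (ger0_norm t0); apply: le_trans (ler_norm _); lra.
  have /andP[h1 _] := h (x0 + t) x0 ltac:(lra).
  rewrite (ltr0_norm t0); apply: le_trans (ler_norm _); lra.
have E : x0 - (x0 + t) = - t by ring.
rewrite E normrN in lip.
rewrite -!exprMn -(real_normK (num_real (bm * t))) -(real_normK (num_real (bp * t))).
rewrite -(real_normK (num_real (a x0 - _))) !normrM (gtr0_norm bm0).
have bp0 : bp * `|t| <= `|bp| * `|t| by rewrite ler_wpM2r // ler_norm.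
have bm0' := ltW bm0.
apply/andP; split; rewrite ler_pXn2r // ?nnegrE ?mulr_ge0 //.
exact: le_trans lip bp0.
Qed.

End Potentials.

(** * The ground state of the fibre operator *)

Section GroundState.
Context {R : realType}.
Notation mu := (@lebesgue_measure R).
Implicit Types (a b f g h u v p V : R -> R) (x y t c xi l E : R).

Lemma Rintegral_gt0 f x0 : continuous f -> (forall x, 0 <= f x) -> integrableT f ->
  0 < f x0 -> 0 < \int[mu]_x f x.
Proof.
move=> cf f0 iff fx0; have e0 : 0 < f x0 / 2 by rewrite divr_gt0.
have /cvgrPdist_lt /(_ _ e0) [d /= d0 hd] := cf x0.
have key x : x0 - d / 2 <= x <= x0 + d / 2 -> f x0 / 2 <= f x.
  move=> /andP[h1 h2]; have : `|x0 - x| < d by rewrite ltr_norml; apply/andP; split; lra.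
  by move/hd; rewrite ltr_norml => /andP[_]; lra.
have xy : x0 - d / 2 <= x0 + d / 2 by lra.
apply: lt_le_trans (Rintegral_itv_leT (x0 - d / 2) (x0 + d / 2) iff f0).
apply: (@lt_le_trans _ _ (\int[mu]_(t in `[x0 - d / 2, x0 + d / 2]) (f x0 / 2))).
  by rewrite Rintegral_itv_cst // mulr_gt0 //; lra.
by apply: Rintegral_itv_le => //; [exact: locint_cst|exact: continuous_locint].
Qed.

Lemma continuous_ae_eq f g : continuous f -> continuous g ->
  {ae mu, forall x, f x = g x} -> f =1 g.
Proof.
move=> cf cg fg x0; apply/eqP; rewrite -subr_eq0; apply: contrapT => /negP ne.
have d0 : 0 < `|f x0 - g x0| by rewrite normr_gt0.
have cfg : continuous (fun x => f x - g x) by cont.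
have /cvgrPdist_lt /(_ _ d0) [d /= d1 hd] := cfg x0.
have [A [mA A0 hA]] := fg.
have : (mu (`[(x0 - d / 2)%R, (x0 + d / 2)%R] : set R) <= mu A)%E.
  apply: le_measure; rewrite ?inE // => x /=; rewrite in_itv /= => /andP[h1 h2].
  apply: hA => /= E; have : `|x0 - x| < d by rewrite ltr_norml; apply/andP; split; lra.
  by move/hd; rewrite E subrr subr0 ltxx.
rewrite A0 lebesgue_measure_itv /= lte_fin ifT; last by lra.
by rewrite -EFinD lee_fin; lra.
Qed.

Lemma test_derive1 p : test p -> has_der p (derive1 p).
Proof.
by move=> [sp _]; have [p1 dp _] := smooth_has_der sp; rewrite (has_der_derive1 dp).
Qed.

Lemma test_derive1n2 p : test p -> has_der (derive1 p) (derive1n 2 p).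
Proof.
move=> tp; have := test_derive1 (test_der tp (test_derive1 tp)).
by rewrite derive1nS derive1n1.
Qed.

(** Two integrations by parts. *)
Lemma classical_schrodinger V u u1 u2 g : has_der u u1 -> has_der u1 u2 ->
  continuous u2 -> continuous V -> (forall x, g x = V x * u x - u2 x) -> schrodinger V u g.
Proof.
move=> du du1 cu2 cV hg p /test_test_fun tp.
have dp := test_derive1 tp; have dp1 := test_derive1n2 tp.
have tp1 := test_der tp dp; have tp2 := test_der tp1 dp1.
have cu := has_der_continuous du; have cu1 := has_der_continuous du1.
have [_ [N N0 pN]] := tp; have [_ [N1 N10 p1N]] := tp1.
have lVu : locint (fun x => V x * u x) by apply: continuous_locint; cont.
have lu := continuous_locint cu; have lu2 := continuous_locint cu2.
rewrite /inner.
have -> : \int[mu]_x (u x * (- derive1n 2 p x + V x * p x)) =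
    \int[mu]_x (V x * u x * p x) - \int[mu]_x (u x * derive1n 2 p x).
  rewrite -RintegralB //; [|exact: test_integrable|exact: test_integrable].
  by apply: eq_Rintegral => x _; ring.
rewrite (Rintegral_by_parts N10 du cu1 dp1 (test_continuous tp2) p1N).
rewrite (Rintegral_by_parts N0 du1 cu2 dp (test_continuous tp1) pN) opprK.
rewrite -RintegralB //; [|exact: test_integrable|exact: test_integrable].
by apply: eq_Rintegral => x _; rewrite hg; ring.
Qed.

Section Admissible.
Variables (bm bp : R) (b : R -> R).
Hypotheses (bm0 : 0 < bm) (bmp : bm <= bp) (bp3 : bp < 3 * bm).
Hypothesis ha : admissible bm bp (potential b).

Let a := potential b.
Let V xi x := (xi - a x) ^+ 2.

Let ca : continuous a. Proof. exact: admissible_continuous bm0 ha. Qed.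
Let cV xi : continuous (V xi). Proof. by rewrite /V; cont. Qed.

Lemma classical_ground_state xi : exists E u u1, [/\ bm <= E <= bp,
  solves (fun x => V xi x - E) u u1, forall x, 0 < u x &
  integrableT (fun x => u x ^+ 2)].
Proof.
have [x0 ax0] := admissible_center xi bm0 ha.
pose W t := V xi (x0 + t).
have cW : continuous W.
  have cs : continuous (fun t : R => x0 + t) by cont.
  by move=> t; apply: (@continuous_comp _ _ _ (fun t => x0 + t) (V xi)); [exact: cs|exact: cV].
have hW t : bm ^+ 2 * t ^+ 2 <= W t <= bp ^+ 2 * t ^+ 2.
  by rewrite /W /V -ax0; exact: admissible_well.
have [E [u [u1 [hE [du du1] u0 [P [M [dP PM]]]]]]] := positive_bound_state bm0 bmp bp3 cW hW.
have cu : continuous u := has_der_continuous du.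
have dsh x : der_at x (fun y => y - x0) 1 by der; ring.
have E0 x : x0 + (x - x0) = x by ring.
exists E, (fun x => u (x - x0)), (fun x => u1 (x - x0)); split=> //.
- split=> x; first by have := der_comp (g := fun y => y - x0) (du _) (dsh x); rewrite mulr1.
  by have := der_comp (g := fun y => y - x0) (du1 _) (dsh x); rewrite mulr1 /W E0.
- apply: (@integrableT_bounded_primitive R _ (fun x => P (x - x0)) M) => //.
  + by move=> x; exact: sqr_ge0.
  + apply: (@continuousX' _ (fun x => u (x - x0))) => x.
    apply: (@continuous_comp _ _ _ (fun y => y - x0) u); last exact: cu.
    exact: der_continuous (dsh x).
  + by move=> x; have := der_comp (g := fun y => y - x0) (dP _) (dsh x); rewrite mulr1.
Qed.

Lemma solves_schrodinger xi E u u1 W : continuous W ->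
  solves (fun x => V xi x - E) u u1 ->
  schrodinger W u (fun x => (W x - V xi x + E) * u x).
Proof.
move=> cW [du du1]; have cu := has_der_continuous du; have cVx := @cV xi.
apply: (classical_schrodinger du du1) => //; first by cont.
by move=> x; ring.
Qed.

(** For W = V and for W = a^2 the square of W - V + E is at most c (1 + V), so
    the energy bound on V u^2 makes (W - V + E) u square integrable; this is what
    membership in the domain of the operator requires. *)
Lemma classical_eigenfunction xi E u u1 : 0 <= E ->
  solves (fun x => V xi x - E) u u1 -> integrableT (fun x => u x ^+ 2) ->
  (exists x, u x != 0) -> eigenfunction b xi E u.
Proof.
move=> E0 su iu [z uz]; have [du du1] := su; have cu := has_der_continuous du.
have cu1 := has_der_continuous du1.
have V0 x : 0 <= V xi x by exact: sqr_ge0.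
have [iVu iu1 _] := bound_state_energy (@cV xi) V0 E0 su iu.
have L2u : L2 u by apply/L2P; split=> //; exact: continuous_measurable.
split.
  move=> h; have := continuous_ae_eq cu (@continuous_cst' R 0) h z.
  by move/eqP; apply/negP.
have sub W : continuous W ->
    (exists2 c, 0 <= c & forall x, (W x - V xi x + E) ^+ 2 <= c * (1 + V xi x)) ->
    L2 (fun x => (W x - V xi x + E) * u x).
  move=> cW [c c0 hc]; have cVx := @cV xi.
  have cf : continuous (fun x => (W x - V xi x + E) * u x) by cont.
  apply/L2P; split; first exact: continuous_measurable.
  have i2 := integrableTZ c (integrableTD iu iVu).
  apply: (integrableT_le _ i2).
    by apply: continuous_measurable; apply: continuousX'.
  move=> x; rewrite ger0_norm ?sqr_ge0 // exprMn.
  have := ler_wpM2r (sqr_ge0 (u x)) (hc x); lra.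
split.
- split.
    split=> //; exists u1; first by apply/L2P; split=> //; exact: continuous_measurable.
    move=> p /test_test_fun tp; have dp := test_derive1 tp; have [_ [N N0 pN]] := tp.
    exact: (Rintegral_by_parts N0 du cu1 dp (test_continuous (test_der tp dp)) pN).
  have ca2 : continuous (fun x => potential b x ^+ 2) by exact: continuousX'.
  exists (fun x => (potential b x ^+ 2 - V xi x + E) * u x); last exact: (solves_schrodinger ca2 su).
  apply: sub => //; exists (2 * (E + xi ^+ 2) ^+ 2 + 8 * xi ^+ 2).
    by rewrite addr_ge0 // mulr_ge0 // sqr_ge0.
  move=> x; rewrite /V -/a; move: (a x) => A.
  pose B := E + xi ^+ 2; pose C := xi - A.
  have -> : A ^+ 2 - (xi - A) ^+ 2 + E = B - 2 * (xi * C) by rewrite /B /C; ring.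
  rewrite -/B -/C.
  have h1 : 0 <= xi ^+ 2 by exact: sqr_ge0.
  have h2 : 0 <= B ^+ 2 * C ^+ 2 by rewrite mulr_ge0 ?sqr_ge0.
  have := sqr_ge0 (B + 2 * (xi * C)); rewrite !expr2 in h1 h2 *; lra.
- have h := sub (V xi) (@cV xi).
  have -> : (fun x => E * u x) = (fun x => (V xi x - V xi x + E) * u x).
    by apply/funext => x; rewrite subrr add0r.
  apply: h; exists (E ^+ 2); first exact: sqr_ge0.
  by move=> x; rewrite subrr add0r ler_peMr ?sqr_ge0 // lerDl.
- have := solves_schrodinger (@cV xi) su.
  by under eq_fun do rewrite subrr add0r.
Qed.

Lemma eigenfunction_classical xi l u : eigenfunction b xi l u ->
  exists v v1, [/\ solves (fun x => V xi x - l) v v1, {ae mu, forall x, u x = v x},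
    integrableT (fun x => v x ^+ 2) & 0 < \int[mu]_x (v x ^+ 2)].
Proof.
move=> [nu [[[/L2P[mu_ iu] _] _] _ sch]].
have lu := locint_sqr mu_ iu; have cVx := @cV xi.
have cK : continuous (fun x => V xi x - l) by cont.
have [] := weak_solution_classical cK mu_ lu.
  move=> p p1 p2 tp dp dp1.
  have tp1 := test_der tp dp; have tp2 := test_der tp1 dp1.
  have p2E : derive1n 2 p = p2.
    by rewrite derive1nS derive1n1 (has_der_derive1 dp) (has_der_derive1 dp1).
  have := sch p ((test_test_fun p).1 tp); rewrite /inner p2E => h.
  have lVu : locint (fun x => u x * V xi x) by exact: locint_mul_continuous.
  have i1 : integrableT (fun x => u x * V xi x * p x) by exact: test_integrable.
  have i2 : integrableT (fun x => u x * p2 x) by exact: test_integrable.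
  have i3 : integrableT (fun x => l * (u x * p x)).
    by apply: integrableTZ; exact: test_integrable.
  have E1 : \int[mu]_x (u x * (- p2 x + (xi - potential b x) ^+ 2 * p x)) =
      \int[mu]_x (u x * V xi x * p x) - \int[mu]_x (u x * p2 x).
    by rewrite -RintegralB //; apply: eq_Rintegral => x _; rewrite /V /a; ring.
  have E2 : \int[mu]_x (l * u x * p x) = \int[mu]_x (l * (u x * p x)).
    by apply: eq_Rintegral => x _; ring.
  have E3 : \int[mu]_x ((V xi x - l) * u x * p x) =
      \int[mu]_x (u x * V xi x * p x) - \int[mu]_x (l * (u x * p x)).
    by rewrite -RintegralB //; apply: eq_Rintegral => x _; ring.
  by rewrite E1 E2 in h; rewrite E3 -h; ring.
move=> v [v1 [sv uv]]; have cv := solves_continuous sv.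
have mv2 : measurable_fun [set: R] (fun x => v x ^+ 2).
  by apply: continuous_measurable; exact: continuousX'.
have mu2 : measurable_fun [set: R] (fun x => u x ^+ 2) by exact: measurable_funX.
have iv : integrableT (fun x => v x ^+ 2).
  have /integrableP[_ fin] := iu; apply/integrableP; split; first exact/measurable_EFinP.
  apply: le_lt_trans fin; rewrite le_eqVlt; apply/orP; left; apply/eqP.
  apply: ae_eq_integral => //.
  - by apply: measurableT_comp => //; exact/measurable_EFinP.
  - by apply: measurableT_comp => //; exact/measurable_EFinP.
  by apply: ae_imply uv => x /= ->.
exists v, v1; split=> //.
have [x0 vx0] : exists x0, v x0 != 0.
  apply: contrapT => no; apply: nu; apply: ae_imply uv => x ->.
  by apply/eqP; apply: contrapT => /negP h; apply: no; exists x.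
apply: (@Rintegral_gt0 _ x0) => //; first exact: continuousX'.
  by move=> x; exact: sqr_ge0.
by rewrite exprn_even_gt0.
Qed.

(** A positive square integrable solution is a ground state: by Jacobi's
    factorisation its energy bounds every eigenvalue from below. *)
Lemma lambda1_spec xi : Defs.eigenvalue b xi (lambda1 b xi) /\
  exists E u u1, [/\ bm <= E <= bp, lambda1 b xi = E,
  solves (fun x => V xi x - E) u u1, forall x, 0 < u x &
  integrableT (fun x => u x ^+ 2)].
Proof.
have [E [u [u1 [/andP[E1 E2] su u0 iu]]]] := classical_ground_state xi.
have E0 : 0 <= E by apply: le_trans E1; exact: ltW.
have eE : Defs.eigenvalue b xi E.
  exists u; apply: (classical_eigenfunction E0 su iu); exists 0.
  by rewrite gt_eqF.
have lb : lbound (Defs.eigenvalue b xi) E.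
  move=> l [w /eigenfunction_classical[v [v1 [sv _ iv v0]]]].
  have iW : integrableT (fun x => (V xi x - V xi x) * v x ^+ 2).
    have := integrableTZ 0 iv; by apply: eq_integrable => // x _ /=; rewrite subrr !mul0r.
  have := variational_inequality (@cV xi) (@cV xi) sv iv su u0 iW.
  have -> : \int[mu]_x ((V xi x - V xi x) * v x ^+ 2) = 0.
    under eq_Rintegral do rewrite subrr mul0r.
    by rewrite /Rintegral integral0.
  by rewrite pmulr_lle0 // subr_le0.
have -> : lambda1 b xi = E.
  apply/le_anti/andP; split.
    by apply: ge_inf => //; exists E.
  by apply: lb_le_inf => //; exists E.
by split=> //; exists E, u, u1; rewrite E1 E2.
Qed.

(** The positive solution, once normalised, shows that the choice defining [phi1]
    is made from a nonempty set; being continuous, the chosen function coincides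
    everywhere with its classical representative. *)
Theorem phi1_spec xi : bm <= lambda1 b xi <= bp /\ exists v1,
  [/\ solves (fun x => V xi x - lambda1 b xi) (phi1 b xi) v1,
    forall x, 0 < phi1 b xi x, integrableT (fun x => phi1 b xi x ^+ 2) &
    \int[mu]_x (phi1 b xi x ^+ 2) = 1].
Proof.
have [_ [E [u [u1 [hE lE [du du1] u0 iu]]]]] := lambda1_spec xi.
have cu := has_der_continuous du.
pose c := \int[mu]_x (u x ^+ 2).
have c0 : 0 < c.
  apply: (@Rintegral_gt0 _ 0) => //; first exact: continuousX'.
    by move=> x; exact: sqr_ge0.
  by rewrite exprn_gt0.
have s0 : 0 < Num.sqrt c by rewrite sqrtr_gt0.
pose k := (Num.sqrt c)^-1.
have k0 : 0 < k by rewrite invr_gt0.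
have k2 : k ^+ 2 * c = 1.
  by rewrite /k exprVn sqr_sqrtr ?ltW // mulVf // gt_eqF.
have gs : ground_state b xi (fun x => k * u x).
  have ik : integrableT (fun x => (k * u x) ^+ 2).
    have := integrableTZ (k ^+ 2) iu; apply: eq_integrable => // x _ /=; by rewrite exprMn.
  split.
  - rewrite lE; apply: (@classical_eigenfunction xi E _ (fun x => k * u1 x)) => //.
    + by case/andP: hE => h _; apply: le_trans h; exact: ltW.
    + by split=> x; der; ring.
    + by exists 0; rewrite gt_eqF // mulr_gt0.
  - rewrite /inner -k2 /c -RintegralZl //; apply: eq_Rintegral => x _; ring.
  - by apply: continuousM' => //; exact: continuous_cst'.
  - by move=> x; rewrite mulr_gt0.
have : ground_state b xi (phi1 b xi).
  by rewrite /phi1; apply: (xgetPex (fun=> 0)); exists (fun x => k * u x).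
move=> [ef n1 cphi phi0]; split; first by rewrite lE.
have [v [v1 [sv uv iv _]]] := eigenfunction_classical ef.
have vE : phi1 b xi = v.
  by apply/funext; apply: continuous_ae_eq => //; exact: solves_continuous sv.
rewrite -vE in sv iv; exists v1; split=> //.
Qed.

End Admissible.
End GroundState.

(** * Comparison of concave functions through their supergradients *)

Section Supergradients.
Context {R : realType}.
Implicit Types (L g : R -> R) (x y z h d : R).

Definition supergradient L g := forall x y, L y <= L x + g x * (y - x).

(** Add the two supporting inequalities at x and at y. *)
Lemma supergradient_nincr L g x y : supergradient L g -> x <= y -> g y <= g x.
Proof.
move=> hL; rewrite le_eqVlt => /orP[/eqP-> //|xy].
have := hL x y; have := hL y x => h1 h2.
have d0 : 0 < y - x by lra.
have : 0 <= (g x - g y) * (y - x) by lra.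
by rewrite pmulr_lge0 // subr_ge0.
Qed.

(** If g1 <= g2 holds somewhere in every interval then L1 grows at most as fast
    as L2: on a grid of step h each increment of L1 is bounded by the increment
    of L2 two cells earlier, and the grid can be refined. *)
Lemma supergradient_increment L1 L2 g1 g2 : supergradient L1 g1 -> supergradient L2 g2 ->
  (forall x y, x < y -> exists2 z, x < z < y & g1 z <= g2 z) ->
  forall x y, x <= y -> L1 y - L1 x <= L2 y - L2 x.
Proof.
move=> s1 s2 hz x y xy; pose d := y - x; have d0 : 0 <= d by rewrite subr_ge0.
have step w h : 0 < h -> L1 (w + 2 * h) - L1 (w + h) <= L2 w - L2 (w - h).
  move=> h0; have [z /andP[wz zh] gz] := hz w (w + h) ltac:(lra).
  have a1 := s1 (w + h) (w + 2 * h).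
  have a2 := s2 w (w - h).
  have a3 := supergradient_nincr s1 (ltW zh).
  have a4 := supergradient_nincr s2 (ltW wz).
  have e1 : w + 2 * h - (w + h) = h by ring.
  have e2 : w - h - w = - h by ring.
  rewrite e1 in a1; rewrite e2 in a2.
  have : g1 (w + h) * h <= g2 w * h by apply: ler_wpM2r; [exact: ltW|lra].
  lra.
have grid h n : 0 < h ->
    L1 (x + h + n%:R * h) - L1 (x + h) <= L2 (x - h + n%:R * h) - L2 (x - h).
  move=> h0; elim: n => [|n IH]; first by rewrite mul0r !addr0 !subrr.
  have := step (x + n%:R * h) h h0.
  have -> : x + n%:R * h + 2 * h = x + h + n.+1%:R * h by rewrite -natr1; ring.
  have -> : x + n%:R * h + h = x + h + n%:R * h by ring.
  have -> : x + n%:R * h - h = x - h + n%:R * h by ring.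
  have -> : x - h + n.+1%:R * h = x + n%:R * h by rewrite -natr1; ring.
  lra.
(* a Lipschitz constant on [x - 1, y + 1], which makes the shifts of the end
   points by h negligible *)
pose C := `|g1 (x - 1)| + `|g1 (y + 1)| + (`|g2 (x - 1)| + `|g2 (y + 1)|).
have lip L g : supergradient L g -> `|g (x - 1)| + `|g (y + 1)| <= C ->
    forall w z, x - 1 <= w -> w <= z -> z <= y + 1 -> `|L z - L w| <= C * (z - w).
  move=> sL hC w z h1 h2 h3; have b1 := sL w z; have b2 := sL z w.
  have c1 := supergradient_nincr sL h1; have c2 := supergradient_nincr sL h3.
  have c3 := supergradient_nincr sL h2.
  have := ler_norm (g (x - 1)); have := ler_norm (- g (y + 1)); rewrite normrN => n1 n2.
  have := normr_ge0 (g (x - 1)); have := normr_ge0 (g (y + 1)) => n3 n4.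
  have zw : 0 <= z - w by lra.
  have k1 : g w * (z - w) <= C * (z - w) by rewrite ler_wpM2r //; lra.
  have k2 : - C * (z - w) <= g z * (z - w) by rewrite ler_wpM2r //; lra.
  rewrite ler_norml; apply/andP; split; lra.
rewrite leNgt; apply/negP => gap.
pose e := L1 y - L1 x - (L2 y - L2 x); have e0 : 0 < e by rewrite /e; lra.
have C0 : 0 <= C by rewrite /C !addr_ge0.
pose n := (Num.truncn (d + d * (4 * C + 1) / e)).+1.
have n0 : 0 < n%:R :> R by rewrite ltr0n.
pose h := d / n%:R.
have q1 : 0 <= d * (4 * C + 1) / e.
  by apply: divr_ge0; [rewrite mulr_ge0 //; lra|exact: ltW].
have dn : d + d * (4 * C + 1) / e < n%:R.
  have q0 : 0 <= d + d * (4 * C + 1) / e by rewrite addr_ge0.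
  by have /andP[] := truncn_itv q0.
have h1 : h <= 1 by rewrite /h ler_pdivrMr // mul1r; lra.
have [d00|dp] : d = 0 \/ 0 < d.
  by move: d0; rewrite le_eqVlt => /orP[/eqP<-|->]; [left|right].
  move: gap; have -> : y = x by apply/eqP; rewrite -subr_eq0 -/d d00.
  by rewrite !subrr ltxx.
have h0 : 0 < h by rewrite divr_gt0.
have nh : n%:R * h = d by rewrite /h mulrC mulfVK // gt_eqF.
have small : (4 * C + 1) * h < e.
  have : d * (4 * C + 1) / e < n%:R by lra.
  rewrite ltr_pdivrMr // => hh.
  rewrite /h mulrA ltr_pdivrMr // mulrC [e * _]mulrC; lra.
have := grid h n h0; rewrite nh.
have -> : x + h + d = y + h by rewrite /d; ring.
have -> : x - h + d = y - h by rewrite /d; ring.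
have l1 := lip _ _ s1 ltac:(rewrite /C lerDl addr_ge0 //).
have l2 := lip _ _ s2 ltac:(rewrite /C lerDr addr_ge0 //).
have a1 := l1 y (y + h) ltac:(lra) ltac:(lra) ltac:(lra).
have a2 := l1 x (x + h) ltac:(lra) ltac:(lra) ltac:(lra).
have a3 := l2 (y - h) y ltac:(lra) ltac:(lra) ltac:(lra).
have a4 := l2 (x - h) x ltac:(lra) ltac:(lra) ltac:(lra).
have e1 : y + h - y = h by ring.
have e2 : x + h - x = h by ring.
have e3 : y - (y - h) = h by ring.
have e4 : x - (x - h) = h by ring.
rewrite e1 in a1; rewrite e2 in a2; rewrite e3 in a3; rewrite e4 in a4.
move: a1 a2 a3 a4; rewrite !ler_norml => /andP[p1 p2] /andP[p3 p4] /andP[p5 p6] /andP[p7 p8] gr.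
rewrite /e in small e0; lra.
Qed.

End Supergradients.

(** * The current determines the ground state energy *)

Section Currents.
Context {R : realType}.
Notation mu := (@lebesgue_measure R).
Variables (bm bp : R).
Hypotheses (bm0 : 0 < bm) (bmp : bm <= bp) (bp3 : bp < 3 * bm).
Implicit Types (b f g h u v p chi : R -> R) (x y t c xi eta r : R).

Definition mean_potential b xi := \int[mu]_x (potential b x * phi1 b xi x ^+ 2).

Local Opaque lambda1 phi1 mean_potential.

Lemma supporting_line_rearrange (l1 l2 m x y : R) :
  l2 - l1 <= (y ^+ 2 - x ^+ 2) * 1 - 2 * (y - x) * m ->
  l2 - y ^+ 2 <= l1 - x ^+ 2 + - 2 * m * (y - x).
Proof. lra. Qed.

Section OneProfile.
Variable b : R -> R.
Hypothesis ha : admissible bm bp (potential b).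

Let a := potential b.
Let phi xi := phi1 b xi.

Let ca : continuous a. Proof. exact: admissible_continuous bm0 ha. Qed.

Let cphi xi : continuous (phi xi).
Proof. by have [_ [v1 [sv _ _ _]]] := phi1_spec bm0 bmp bp3 ha xi; exact: solves_continuous sv. Qed.

Let iphi xi : integrableT (fun x => phi xi x ^+ 2).
Proof. by have [_ [v1 [_ _ iv _]]] := phi1_spec bm0 bmp bp3 ha xi. Qed.

Let nphi xi : \int[mu]_x (phi xi x ^+ 2) = 1.
Proof. by have [_ [v1 [_ _ _ n1]]] := phi1_spec bm0 bmp bp3 ha xi. Qed.

(** The kinetic energy is nonnegative. *)
Lemma well_energy xi : integrableT (fun x => (xi - a x) ^+ 2 * phi xi x ^+ 2) /\
  \int[mu]_x ((xi - a x) ^+ 2 * phi xi x ^+ 2) <= lambda1 b xi.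
Proof.
have [/andP[h _] [v1 [sv _ iv n1]]] := phi1_spec bm0 bmp bp3 ha xi.
have cV : continuous (fun x => (xi - a x) ^+ 2) by have := ca => ?; cont.
have l0 : 0 <= lambda1 b xi by apply: le_trans h; exact: ltW.
have [i1 _] := bound_state_energy cV (fun x => sqr_ge0 (xi - a x)) l0 sv iv.
by rewrite n1 mulr1.
Qed.

(** From |a| <= |xi| + 1 + (xi - a)^2 and the finite potential energy. *)
Lemma integrable_potential xi : integrableT (fun x => a x * phi xi x ^+ 2).
Proof.
have [iV _] := well_energy xi; have i0 := iphi xi.
have i1 := integrableTD iV (integrableTZ (1 + `|xi|) i0).
have ca' := ca; have cphi' := @cphi xi.
apply: (integrableT_le _ i1); first by apply: continuous_measurable; cont.
move=> x; rewrite normrM (ger0_norm (sqr_ge0 _)) -mulrDl ler_wpM2r ?sqr_ge0 //.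
have h : `|a x| <= `|xi| + `|xi - a x|.
  by have := ler_normB xi (xi - a x); rewrite opprB addrC subrK.
rewrite -[(xi - a x) ^+ 2]real_normK ?num_real //.
move: h (normr_ge0 (xi - a x)); move: (`|xi - a x|) (`|a x|) (`|xi|) => z q w h z0.
have := sqr_ge0 (z - 1); rewrite !expr2; nra.
Qed.

Lemma mean_velocity xi :
  inner (fun x => velocity b xi x * phi xi x) (phi xi) = 2 * xi - 2 * mean_potential b xi.
Proof.
rewrite /inner /velocity.
have -> : \int[mu]_x (2 * (xi - a x) * phi xi x * phi xi x) =
    \int[mu]_x (2 * xi * phi xi x ^+ 2 - 2 * (a x * phi xi x ^+ 2)).
  by apply: eq_Rintegral => x _; ring.
rewrite (RintegralB measurableT (integrableTZ (2 * xi) (iphi xi))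
  (integrableTZ 2 (integrable_potential xi))).
rewrite (RintegralZl _ measurableT (iphi xi)).
rewrite (RintegralZl _ measurableT (integrable_potential xi)).
by rewrite nphi mulr1.
Qed.

(** The energy minus xi^2 is a minimum of affine functions of xi; the ground
    state at xi supplies the supporting line there (Hellmann-Feynman). *)
Lemma energy_supergradient :
  supergradient (fun xi => lambda1 b xi - xi ^+ 2) (fun xi => - 2 * mean_potential b xi).
Proof.
move=> xi eta.
have [_ [v1 [sv v0 iv n1]]] := phi1_spec bm0 bmp bp3 ha xi.
have [_ [w1 [sw w0 iw n2]]] := phi1_spec bm0 bmp bp3 ha eta.
have cV z : continuous (fun x => (z - a x) ^+ 2) by have := ca => ?; cont.
have i1 := integrableTZ (eta ^+ 2 - xi ^+ 2) (iphi xi).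
have i2 := integrableTZ (2 * (eta - xi)) (integrable_potential xi).
have E x : ((eta - a x) ^+ 2 - (xi - a x) ^+ 2) * phi xi x ^+ 2 =
    (eta ^+ 2 - xi ^+ 2) * phi xi x ^+ 2 - 2 * (eta - xi) * (a x * phi xi x ^+ 2) by ring.
have iW : integrableT (fun x => ((eta - a x) ^+ 2 - (xi - a x) ^+ 2) * phi xi x ^+ 2).
  have := integrableTD i1 (integrableTZ (-1) i2).
  by apply: eq_integrable => // x _ /=; rewrite E mulN1r.
have := variational_inequality (cV xi) (cV eta) sv iv sw w0 iW.
rewrite n1 mulr1.
under eq_Rintegral do rewrite E.
rewrite (RintegralB measurableT i1 i2).
rewrite (RintegralZl _ measurableT (iphi xi)).
rewrite (RintegralZl _ measurableT (integrable_potential xi)).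
rewrite nphi -[Rintegral _ _ _]/(mean_potential b xi).
exact: supporting_line_rearrange.
Qed.

End OneProfile.

(** A nonnegative function with integral 0 vanishes almost everywhere, and an
    interval is not negligible. *)
Lemma integral_eq0_ex f x y : x < y -> integrableT f -> (forall z, 0 <= f z) ->
  \int[mu]_z f z = 0 -> exists2 z, x < z < y & f z = 0.
Proof.
move=> xy iff f0 If; apply: contrapT => no.
have mf := integrableT_measurable iff.
have E0 : (\int[mu]_z `|(f z)%:E| = 0)%E.
  have fin : (\int[mu]_z (f z)%:E)%E \is a fin_num by exact: integrable_fin_num.
  have <- : (\int[mu]_z (f z)%:E = 0)%E by rewrite -(fineK fin); congr EFin.
  by apply: eq_integral => z _; rewrite gee0_abs // lee_fin.
have [A [mA A0 hA]] := (ae_eq_integral_abs mu measurableT ((measurable_EFinP _ _).2 mf)).1 E0.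
have : (mu (`](x : R), y[ : set R) <= mu A)%E.
  apply: le_measure; rewrite ?inE // => z /=; rewrite in_itv /= => hz.
  by apply: hA => /= /(_ Logic.I) [fz]; apply: no; exists z.
by rewrite A0 lebesgue_measure_itv /= lte_fin xy -EFinD lee_fin; lra.
Qed.

Lemma monotone_locint g : (forall x y, x <= y -> g x <= g y) -> locint g.
Proof.
move=> mono c d.
have ic := continuous_locint (@continuous_cst' R (`|g c| + `|g d|)) c d.
apply: (le_integrable _ _ _ ic) => //.
  apply/measurable_EFinP; apply: measurable_funTS.
  by apply: nondecreasing_measurable => // x y; exact: mono.
move=> z; rewrite /= in_itv /= => /andP[cz zd]; rewrite lee_fin [leRHS]ger0_norm ?addr_ge0 //.
have := mono _ _ cz; have := mono _ _ zd.
have := ler_norm (- g c); have := ler_norm (g d); rewrite normrN => h1 h2.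
have := normr_ge0 (g c); have := normr_ge0 (g d) => h3 h4 h5 h6.
by rewrite ler_norml; apply/andP; split; lra.
Qed.

Lemma mean_potential_mono b : admissible bm bp (potential b) ->
  forall x y, x <= y -> mean_potential b x <= mean_potential b y.
Proof.
move=> /energy_supergradient; move: (mean_potential b) (fun xi => _ - _) => m L sL x y xy.
by have := supergradient_nincr sL xy; rewrite !mulNr lerN2 ler_pM2l.
Qed.

(** If m' < m held on the whole interval, testing with a bump supported there
    would distinguish the two sides. *)
Lemma touching_means (m m' : R -> R) x y :
  (forall x y, x <= y -> m x <= m y) -> (forall x y, x <= y -> m' x <= m' y) ->
  (forall chi, test chi -> \int[mu]_z (chi z ^+ 2 * (2 * z - 2 * m z)) =
     \int[mu]_z (chi z ^+ 2 * (2 * z - 2 * m' z))) ->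
  x < y -> exists2 z, x < z < y & m z <= m' z.
Proof.
move=> mono mono' hc xy; apply: contrapT => no.
have gt z : x < z < y -> m' z < m z.
  by move=> hz; rewrite ltNge; apply/negP => h; apply: no; exists z.
have yx : 0 < y - x by lra.
pose k := (y - x)^-1; have k0 : 0 < k by rewrite invr_gt0.
have ky : k * (y - x) = 1 by rewrite /k mulVf // gt_eqF.
pose chi z := bumpf (k * z + - (k * x)).
have kz z : k * z + - (k * x) = k * (z - x) by ring.
have chi_gt0 z : x < z < y -> 0 < chi z.
  move=> /andP[xz zy]; apply: bump_gt0; rewrite kz mulr_gt0 ?subr_gt0 //= -ky ltr_pM2l //; lra.
have chi_out z : ~~ (x < z < y) -> chi z = 0.
  rewrite negb_and -!leNgt => /orP[zx|yz]; apply: bump_out; rewrite kz; [left|right].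
    by rewrite pmulr_rle0 // subr_le0.
  rewrite -ky ler_pM2l //; lra.
have tchi : test chi.
  split; first by move=> n; apply: Cn_affine; exact: smooth_bump.
  exists (`|x| + `|y|); first exact: addr_ge0.
  move=> z hz; apply: chi_out; apply/negP => /andP[xz zy].
  move: hz; apply/negP; rewrite -leNgt ler_norml.
  have := ler_norm (- x); have := ler_norm y; rewrite normrN => h1 h2.
  by have := normr_ge0 x; have := normr_ge0 y => h3 h4; apply/andP; split; lra.
have cchi := test_continuous tchi.
have tchi2 : test (fun z => chi z ^+ 2).
  have [sc [N N0 cN]] := tchi; split; last by exists N => // z /cN ->; rewrite expr0n.
  by move=> n; have := CnM (sc n) (sc n); under eq_fun do rewrite -expr2.
have cur n : (forall x y, x <= y -> n x <= n y) ->
    integrableT (fun z => (2 * z - 2 * n z) * chi z ^+ 2) /\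
    \int[mu]_z (chi z ^+ 2 * (2 * z - 2 * n z)) =
      \int[mu]_z ((2 * z - 2 * n z) * chi z ^+ 2).
  move=> mn; split; last by apply: eq_Rintegral => z _; rewrite mulrC.
  apply: test_integrable => //.
  have h1 : locint (fun z : R => 2 * z) by apply: continuous_locint; cont.
  exact: (locintB h1 (locintZ 2 (monotone_locint mn))).
have [i1 c1] := cur _ mono; have [i2 c2] := cur _ mono'.
have := hc chi tchi; rewrite c1 c2 => E.
pose f z := (2 * z - 2 * m' z) * chi z ^+ 2 - (2 * z - 2 * m z) * chi z ^+ 2.
have iff : integrableT f.
  have := integrableTD i2 (integrableTZ (-1) i1).
  by apply: eq_integrable => // z _ /=; rewrite mulN1r.
have fE z : f z = 2 * (m z - m' z) * chi z ^+ 2 by rewrite /f; ring.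
have f0 z : 0 <= f z.
  rewrite fE; case: (boolP (x < z < y)) => hz; last by rewrite chi_out // expr0n mulr0.
  apply: mulr_ge0; last exact: sqr_ge0.
  by apply: mulr_ge0 => //; rewrite subr_ge0 ltW // gt.
have If : \int[mu]_z f z = 0 by rewrite /f RintegralB // E subrr.
have [z hz fz] := integral_eq0_ex xy iff f0 If.
move/eqP: fz; apply/negP; rewrite fE gt_eqF //; apply: mulr_gt0; last by rewrite exprn_gt0 // chi_gt0.
by apply: mulr_gt0 => //; rewrite subr_gt0 gt.
Qed.

Lemma current_touch b b' x y : admissible bm bp (potential b) ->
  admissible bm bp (potential b') -> same_current b b' -> x < y ->
  exists2 z, x < z < y & mean_potential b z <= mean_potential b' z.
Proof.
move=> ha ha' hc.
have curE d chi : admissible bm bp (potential d) ->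
    current d chi = \int[mu]_z (chi z ^+ 2 * (2 * z - 2 * mean_potential d z)).
  by move=> hd; apply: eq_Rintegral => z _; rewrite (mean_velocity hd).
have hc' chi : test chi -> \int[mu]_z (chi z ^+ 2 * (2 * z - 2 * mean_potential b z)) =
    \int[mu]_z (chi z ^+ 2 * (2 * z - 2 * mean_potential b' z)).
  by move=> /test_test_fun /hc; rewrite (curE _ _ ha) (curE _ _ ha').
move: hc' (mean_potential_mono ha) (mean_potential_mono ha').
move: (mean_potential b) (mean_potential b') => m m' hc' mono mono'.
exact: touching_means.
Qed.

(** The ground state for a serves as trial function for a'.  On [-r, r] one has
    xi - a >= M, so the change of the potential is at most O(1/M) times
    the potential itself, and the potential energy is at most bp. *)
Lemma perturbed_energy_le (a a' : R -> R) (E E' r M xi : R) u u1 v w1 :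
  admissible bm bp a -> admissible bm bp a' ->
  solves (fun x => (xi - a x) ^+ 2 - E) u u1 -> (forall x, 0 < u x) ->
  integrableT (fun x => u x ^+ 2) -> \int[mu]_x (u x ^+ 2) = 1 ->
  integrableT (fun x => (xi - a x) ^+ 2 * u x ^+ 2) ->
  \int[mu]_x ((xi - a x) ^+ 2 * u x ^+ 2) <= E -> E <= bp ->
  solves (fun x => (xi - a' x) ^+ 2 - E') v w1 -> (forall x, 0 < v x) ->
  0 < r -> 1 <= M -> bp * r + M <= xi ->
  (forall x, r < `|x| -> a' x = a x) ->
  E' - E <= (2 * (2 * bp * r) + (2 * bp * r) ^+ 2) / M * bp.
Proof.
move=> ha ha' sv v0 iv n1 iV EV l_le sw w0 r0 M1 xiM hout; have bp0 : 0 < bp := lt_le_trans bm0 bmp.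
have ca := admissible_continuous bm0 ha; have ca' := admissible_continuous bm0 ha'.
have cV : continuous (fun x => (xi - a x) ^+ 2) by cont.
have cV' : continuous (fun x => (xi - a' x) ^+ 2) by cont.
have cphi := solves_continuous sv.
pose D := 2 * bp * r; pose c := (2 * D + D ^+ 2) / M; rewrite -/D -/c.
have D0 : 0 < D by rewrite /D !mulr_gt0.
have M0 : 0 < M by lra.
have c0 : 0 <= c by rewrite /c divr_ge0 ?addr_ge0 ?sqr_ge0 //; lra.
have pot0 (d : R -> R) : admissible bm bp d -> forall x, `|x| <= r -> `|d x| <= bp * r.
  move=> hd x xr; have := admissible_lipschitz x 0 bm0 hd.
  have [-> _] := hd; rewrite !subr0 => h; apply: le_trans h _; rewrite ler_wpM2l // ltW //.
have WV x : `|(xi - a' x) ^+ 2 - (xi - a x) ^+ 2| <=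
    c * (xi - a x) ^+ 2.
  have [xr|rx] := leP `|x| r; last first.
    by rewrite hout // subrr normr0 mulr_ge0 // sqr_ge0.
  have := pot0 _ ha x xr; have := pot0 _ ha' x xr.
  rewrite !ler_norml /c -mulrA.
  move: (a x) (a' x) => p q /andP[h1 h2] /andP[h3 h4].
  pose s := xi - p; have sM : M <= s by rewrite /s; lra.
  have -> : (xi - q) ^+ 2 - (xi - p) ^+ 2 = (p - q) * (2 * s + (p - q)) by rewrite /s; ring.
  rewrite -/s; set d := p - q.
  have [d1 d2] : - D <= d /\ d <= D by rewrite /d /D; split; lra.
  have sD : s <= M^-1 * s ^+ 2.
    by rewrite ler_pdivlMl // expr2 ler_wpM2r //; lra.
  have s1 : 1 <= M^-1 * s ^+ 2 by lra.
  have dd : d * d <= D ^+ 2 by rewrite expr2; nra.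
  have ds1 : d * s <= D * s by rewrite ler_wpM2r //; lra.
  have ds2 : - D * s <= d * s by rewrite ler_wpM2r //; lra.
  have Ds : D * s <= D * (M^-1 * s ^+ 2) by rewrite ler_wpM2l // ltW.
  have D1 : D ^+ 2 <= D ^+ 2 * (M^-1 * s ^+ 2) by rewrite ler_peMr // sqr_ge0.
  have d0 : 0 <= d * d by rewrite -expr2 sqr_ge0.
  move: Ds D1; move: (M^-1 * s ^+ 2) => z Ds D1; move: dd d0; move: (D ^+ 2) D1 => DD D1 dd d0.
  apply/andP; split; lra.
have iW : integrableT (fun x => ((xi - a' x) ^+ 2 - (xi - a x) ^+ 2) * u x ^+ 2).
  apply: (integrableT_le _ (integrableTZ c iV)).
    by apply: continuous_measurable; cont.
  move=> x; rewrite normrM (ger0_norm (sqr_ge0 (u x))) mulrA.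
  by rewrite ler_wpM2r ?sqr_ge0.
have := variational_inequality cV cV' sv iv sw w0 iW.
rewrite n1 mulr1 => h; apply: le_trans h _.
apply: (@le_trans _ _ (\int[mu]_x (c * ((xi - a x) ^+ 2 * u x ^+ 2)))).
  apply: le_Rintegral => //; first exact: integrableTZ.
  move=> x _; rewrite mulrA ler_wpM2r ?sqr_ge0 //; exact: le_trans (ler_norm _) (WV x).
rewrite RintegralZl // ler_wpM2l //; exact: le_trans EV l_le.
Qed.

(** Comparing increments both ways, l' - l is constant; its decay at infinity
    determines the constant. *)
Lemma energies_equal (l l' m m' : R -> R) (A C : R) :
  supergradient (fun xi => l xi - xi ^+ 2) (fun xi => - 2 * m xi) ->
  supergradient (fun xi => l' xi - xi ^+ 2) (fun xi => - 2 * m' xi) ->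
  (forall x y, x < y -> exists2 z, x < z < y & m z <= m' z) ->
  (forall x y, x < y -> exists2 z, x < z < y & m' z <= m z) -> 0 <= A ->
  (forall M xi, 1 <= M -> C + M <= xi -> `|l' xi - l xi| <= A / M) ->
  forall xi, l' xi = l xi.
Proof.
move=> s s' t t' A0 hA xi.
have g1 x y : x < y -> exists2 z, x < z < y & - 2 * m' z <= - 2 * m z.
  by move=> /t[z hz mz]; exists z => //; rewrite !mulNr lerN2 ler_pM2l.
have g2 x y : x < y -> exists2 z, x < z < y & - 2 * m z <= - 2 * m' z.
  by move=> /t'[z hz mz]; exists z => //; rewrite !mulNr lerN2 ler_pM2l.
have inc := supergradient_increment s' s g1.
have inc' := supergradient_increment s s' g2.
have cst x y : x <= y -> l' y - l y = l' x - l x.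
  move=> xy; have := inc x y xy; have := inc' x y xy => h1 h2.
  by apply/eqP; rewrite eq_le; apply/andP; split; lra.
apply/eqP; rewrite -subr_eq0 -normr_le0 leNgt; apply/negP => gap.
set G := l' xi - l xi in gap.
pose M := 1 + A / `|G|.
have q0 : 0 <= A / `|G| by rewrite divr_ge0.
have M1 : 1 <= M by rewrite /M; lra.
pose eta := Num.max xi (C + M).
have [e1 e2] : xi <= eta /\ C + M <= eta by rewrite /eta !le_max !lexx !orbT.
have := hA M eta M1 e2; rewrite (cst xi eta e1) -/G.
rewrite ler_pdivlMr; last by lra.
rewrite /M mulrDr mulr1 mulrCA divff ?gt_eqF //; lra.
Qed.

(** The current determines the energy: it determines lambda1 up to a constant,
    and the constant is 0 because for large xi the ground state leaves the
    region where the potentials differ. *)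
Theorem same_current_energy b b' r : admissible bm bp (potential b) ->
  admissible bm bp (potential b') -> 0 < r ->
  (forall x, r < `|x| -> potential b' x = potential b x) ->
  same_current b b' -> forall xi, lambda1 b' xi = lambda1 b xi.
Proof.
move=> ha ha' r0 hout hc.
have hc' : same_current b' b by move=> chi hchi; rewrite hc.
have bp0 : 0 < bp := lt_le_trans bm0 bmp.
have half d d' : admissible bm bp (potential d) -> admissible bm bp (potential d') ->
    (forall x, r < `|x| -> potential d' x = potential d x) ->
    forall M xi, 1 <= M -> bp * r + M <= xi -> lambda1 d' xi - lambda1 d xi <=
      (2 * (2 * bp * r) + (2 * bp * r) ^+ 2) / M * bp.
  move=> hd hd' ho M xi M1 hM.
  have [/andP[_ l_le] [u1 [su u0 iu n1]]] := phi1_spec bm0 bmp bp3 hd xi.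
  have [_ [v1 [sv v0 iv n2]]] := phi1_spec bm0 bmp bp3 hd' xi.
  have [iV EV] := well_energy hd xi.
  exact: (perturbed_energy_le hd hd' su u0 iu n1 iV EV l_le sv v0 r0 M1 hM ho).
have h1 := half _ _ ha ha' hout.
have h2 := half _ _ ha' ha (fun x hx => esym (hout x hx)).
have s1 := energy_supergradient ha; have s2 := energy_supergradient ha'.
have t1 x y := @current_touch _ _ x y ha ha' hc.
have t2 x y := @current_touch _ _ x y ha' ha hc'.
move: h1 h2 s1 s2 t1 t2; move: (lambda1 b) (lambda1 b') (mean_potential b) (mean_potential b').
move=> l l' m m' h1 h2 s1 s2 t1 t2.
pose A := (2 * (2 * bp * r) + (2 * bp * r) ^+ 2) * bp.
have br : 0 <= 2 * bp * r by rewrite !mulr_ge0 // ltW.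
have A0 : 0 <= A by rewrite /A mulr_ge0 ?(ltW bp0) // addr_ge0 ?sqr_ge0 // mulr_ge0.
apply: (energies_equal s1 s2 t1 t2 A0 (C := bp * r)) => M xi M1 hM.
have E : (2 * (2 * bp * r) + (2 * bp * r) ^+ 2) / M * bp = A / M by rewrite /A mulrAC.
have := h1 M xi M1 hM; have := h2 M xi M1 hM; rewrite E.
by move: (A / M) => q k1 k2; rewrite ler_norml; apply/andP; split; lra.
Qed.

End Currents.

(** * Second order perturbation at fixed energy *)

Section SecondOrder.
Context {R : realType}.
Notation mu := (@lebesgue_measure R).
Implicit Types (f g h u v p K a d : R -> R) (x y t c r e : R).

(** A positive solution that increases at some point of the region K >= 0
    increases for ever, hence is not square integrable. *)
Lemma positive_L2_decays K u u1 : solves K u u1 -> eventually_ge 0 K ->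
  (forall x, 0 < u x) -> integrableT (fun x => u x ^+ 2) -> decays u u1.
Proof.
move=> su [T KT] u0 iu; exists T => t Tt; split; first exact: u0.
rewrite leNgt; apply/negP => u1t.
have inc s : t <= s -> u t <= u s.
  move=> ts; have [] // := increasing_solution su (fun s hs => KT s (le_trans Tt hs)) (u0 t) (ltW u1t) ts.
set I := \int[mu]_x (u x ^+ 2).
have ut2 : 0 < u t ^+ 2 by rewrite exprn_gt0.
(* on an interval of this length, u >= u t makes the integral of u^2 exceed I *)
pose N := (I + 1) / u t ^+ 2.
have I0 : 0 <= I by apply: Rintegral_ge0 => x _; exact: sqr_ge0.
have N0 : 0 <= N by rewrite divr_ge0 ?ltW //; lra.
have tN : t <= t + N by lra.
have := Rintegral_itv_leT t (t + N) iu (fun x => sqr_ge0 (u x)); rewrite -/I.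
have : \int[mu]_(x in `[t, t + N]) (u t ^+ 2) <= \int[mu]_(x in `[t, t + N]) (u x ^+ 2).
  apply: Rintegral_itv_le; [exact: locint_cst|exact: integrableT_locint|].
  move=> x /andP[tx _]; rewrite ler_pXn2r ?nnegrE ?(ltW (u0 _)) //; exact: inc.
rewrite Rintegral_itv_cst // [t + N]addrC addrK /N mulrCA divff ?mulr1 ?gt_eqF //; lra.
Qed.

(** The Wronskian of two ground states is constant where the potentials agree,
    and it vanishes at infinity. *)
Lemma wronskian_zero_right K1 K2 u u1 v v1 r : solves K1 u u1 -> solves K2 v v1 ->
  eventually_ge 0 K1 -> eventually_ge 0 K2 ->
  (forall x, 0 < u x) -> (forall x, 0 < v x) ->
  integrableT (fun x => u x ^+ 2) -> integrableT (fun x => v x ^+ 2) ->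
  (forall x, r < x -> K1 x = K2 x) -> u r * v1 r - u1 r * v r = 0.
Proof.
move=> su sv e1 e2 u0 v0 iu iv KK.
apply/eqP; rewrite -normr_le0 leNgt; apply/negP => w0.
have h0 : 0 < `|u r * v1 r - u1 r * v r| / 2 by rewrite divr_gt0.
have [T hT] := wronskian_vanishes su sv e1 e2 (positive_L2_decays su e1 u0 iu)
  (positive_L2_decays sv e2 v0 iv) h0.
pose t := Num.max T r.
have [Tt rt] : T <= t /\ r <= t by rewrite /t !le_max !lexx orbT.
have := hT t Tt.
rewrite -(@der_eq0_eq _ _ _ r t rt (fun z _ => der_wronskian su sv z)).
  move: (`|_|) w0 => z; lra.
by move=> x /andP[rx _]; rewrite KK // subrr mul0r.
Qed.

Lemma integrableT_reflect f : continuous f -> (forall x, 0 <= f x) -> integrableT f ->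
  integrableT (fun x => f (- x)).
Proof.
move=> cf f0 iff; have dP := has_der_potential cf; set P := potential f in dP.
have P0 : P 0 = 0 by exact: potential0.
set I := \int[mu]_x f x.
have PI x : `|P x| <= I.
  have := potential_le (integrableT_locint iff) (lexx `|x|); rewrite -/P.
  move=> h; apply: le_trans h _.
  under eq_Rintegral do rewrite ger0_norm //.
  exact: Rintegral_itv_leT.
apply: (@integrableT_bounded_primitive R _ (fun x => - P (- x)) I) => //.
- have cn : continuous (fun x : R => - x) by cont.
  by move=> x; apply: (@continuous_comp _ _ _ (fun x : R => - x) f); [exact: cn|exact: cf].
- by move=> x; have h := der_comp (g := fun y : R => - y) (dP _) (derN (der_id x)); der; ring.
- by move=> x; rewrite normrN.
Qed.

Lemma wronskian_zero_left K1 K2 u u1 v v1 r : solves K1 u u1 -> solves K2 v v1 ->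
  eventually_ge 0 (fun x => K1 (- x)) -> eventually_ge 0 (fun x => K2 (- x)) ->
  (forall x, 0 < u x) -> (forall x, 0 < v x) ->
  integrableT (fun x => u x ^+ 2) -> integrableT (fun x => v x ^+ 2) ->
  (forall x, x < - r -> K1 x = K2 x) -> u (- r) * v1 (- r) - u1 (- r) * v (- r) = 0.
Proof.
move=> su sv e1 e2 u0 v0 iu iv KK.
have sq (w : R -> R) : continuous w -> integrableT (fun x => w x ^+ 2) -> integrableT (fun x => w (- x) ^+ 2).
  move=> cw; apply: (@integrableT_reflect (fun x => w x ^+ 2)); first exact: continuousX'.
  by move=> x; exact: sqr_ge0.
have := @wronskian_zero_right _ _ _ _ _ _ r (solves_reflect su) (solves_reflect sv) e1 e2
  (fun x => u0 (- x)) (fun x => v0 (- x)) (sq _ (solves_continuous su) iu)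
  (sq _ (solves_continuous sv) iv).
by move=> /(_ (fun x hx => KK (- x) (ltac:(lra)))) h; lra.
Qed.

(** Second order perturbation theory in exact form.  u and v are ground states
    for the potentials a^2 and (a + e d)^2 at the same energy, w is their
    Wronskian and z = w/v.  Then (w u/v)' = e d (2a + e d) u^2 - z^2, which gives
    the energy balance e X + e^2 Y = int z^2 >= 0, with X and Y the increments of
    F and H over [-r, r].  A weighted Dirichlet
    Poincare inequality for z on [-r, r], from the factorisation with
    p = v'/v and with t = - y'/y for y = 1 - x^2/(2 r^2), bounds int z^2 by
    r^2 int (w'/v)^2, hence by 4 be^2 r^4 e^2 Y. *)
Lemma second_order_balance a d (E e be r : R) u u1 v v1 F H :
  0 < r -> 0 <= be ->
  solves (fun x => a x ^+ 2 - E) u u1 -> solves (fun x => (a x + e * d x) ^+ 2 - E) v v1 ->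
  (forall x, 0 < v x) -> continuous u -> continuous a -> continuous d ->
  u r * v1 r - u1 r * v r = 0 -> u (- r) * v1 (- r) - u1 (- r) * v (- r) = 0 ->
  (forall x, - r <= x <= r -> `|a x| <= be * r) ->
  (forall x, - r <= x <= r -> `|a x + e * d x| <= be * r) ->
  (be * r) ^+ 2 <= E ->
  has_der F (fun x => 2 * d x * a x * u x ^+ 2) -> has_der H (fun x => d x ^+ 2 * u x ^+ 2) ->
  0 <= e * (F r - F (- r)) + e ^+ 2 * (H r - H (- r)) <=
    4 * be ^+ 2 * r ^+ 4 * (e ^+ 2 * (H r - H (- r))).
Proof.
move=> r0 be0 su sv v0 cu ca cd wr wl ha hae hE dF dH.
have [du du1] := su; have [dv dv1] := sv.
pose w x := u x * v1 x - u1 x * v x.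
pose z x := w x / v x.
have vn x : v x != 0 by rewrite gt_eqF.
have dw x : der_at x w (e * d x * (2 * a x + e * d x) * (u x * v x)).
  by apply: (der_eq (der_wronskian su sv x)); ring.
have cv := has_der_continuous dv.
have cw : continuous w by exact: has_der_continuous dw.
have dz x : der_at x z (e * d x * (2 * a x + e * d x) * u x - z x * (v1 x / v x)).
  have h := derV (vn x) (dv x); have h2 := dw x.
  by rewrite /z; der; field; exact: vn.
have cz : continuous z by exact: has_der_continuous dz.
have cz2 : continuous (fun x => z x ^+ 2) by exact: continuousX'.
have dZ := has_der_potential cz2; set Z := potential _ in dZ.
have rr : - r <= r by lra.
have zr : z r = 0 by rewrite /z /w wr mul0r.
have zl : z (- r) = 0 by rewrite /z /w wl mul0r.
have balance : e * (F r - F (- r)) + e ^+ 2 * (H r - H (- r)) = Z r - Z (- r).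
  (* z u vanishes at both ends *)
  pose B x := e * F x + e ^+ 2 * H x - Z x - z x * u x.
  have : B (- r) = B r.
    apply: (@der_eq0_eq _ B (fun=> 0)) => // x _.
    have h := dz x; rewrite /B; der.
    have -> : z x ^+ 2 = z x * (u x * (v1 x / v x) - u1 x).
      by rewrite expr2; congr (_ * _); rewrite /z /w; field.
    ring.
  by rewrite /B zr zl !mul0r; lra.
rewrite balance; apply/andP; split.
  rewrite subr_ge0; apply: (@der_ge0_le _ Z (fun x => z x ^+ 2)) => // x _; exact: sqr_ge0.
(* a positive supersolution of y'' = - y / r^2 on [-r, r], giving r^2 as a
   Poincare constant *)
pose y x : R := 1 - x ^+ 2 / (2 * r ^+ 2).
pose tt x : R := x / r ^+ 2 / y x.
have rn : r != 0 by rewrite gt_eqF.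
have y_ge x : - r <= x <= r -> 2^-1 <= y x.
  move=> /andP[h1 h2]; rewrite /y.
  have : x ^+ 2 / (2 * r ^+ 2) <= 2^-1.
    rewrite ler_pdivrMr ?mulr_gt0 ?exprn_gt0 // mulrA mulVf // mul1r !expr2; nra.
  lra.
have y_gt0 x : - r <= x <= r -> 0 < y x by move/y_ge; lra.
have dy x : der_at x y (- (x / r ^+ 2)).
  by rewrite /y; der; rewrite /=; field.
have dtt x : - r <= x <= r -> der_at x tt (tt x ^+ 2 + (r ^+ 2)^-1 / y x).
  move=> hx; have yn : y x != 0 by rewrite gt_eqF // y_gt0.
  have h := derV yn (dy x); rewrite /tt; der; field.
  by rewrite rn yn.
pose p x := v1 x / v x.
have dp x : der_at x p ((a x + e * d x) ^+ 2 - E - p x ^+ 2).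
  by have h := derV (vn x) (dv x); rewrite /p; der; field; exact: vn.
have dzp x : der_at x z (e * d x * (2 * a x + e * d x) * u x - z x * p x) := dz x.
clearbody p tt z Z.
pose k := 4 * be ^+ 2 * r ^+ 4.
(* the integrated form of the Poincare inequality; completing the square in
   q - p z + t z shows that its derivative is nonnegative, q = w'/v *)
pose B x := k * (e ^+ 2 * H x) - Z x + r ^+ 2 * ((tt x - p x) * z x ^+ 2).
have dB x : - r <= x <= r -> der_at x B
    (k * (e ^+ 2 * (d x ^+ 2 * u x ^+ 2)) - z x ^+ 2 +
     r ^+ 2 * ((tt x ^+ 2 + (r ^+ 2)^-1 / y x - ((a x + e * d x) ^+ 2 - E - p x ^+ 2)) * z x ^+ 2 +
       (tt x - p x) * (2 * z x * (e * d x * (2 * a x + e * d x) * u x - z x * p x)))).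
  move=> hx; have h1 := dtt x hx; have h2 := dzp x; have h3 := dp x.
  by rewrite /B; der; rewrite /=; ring.
have : B (- r) <= B r.
  apply: (der_ge0_le rr dB).
  move=> x /andP[hx1 hx2]; have hx : - r <= x <= r by rewrite !ltW.
  have y1 : 1 <= (y x)^-1.
    rewrite -[leLHS]invr1 lef_pV2 ?posrE // ?y_gt0 //.
    by rewrite /y gerBl divr_ge0 ?sqr_ge0 // mulr_ge0 ?sqr_ge0.
  have aE : (a x + e * d x) ^+ 2 <= E.
    apply: le_trans hE; rewrite -(real_normK (num_real (a x + _))) ler_pXn2r ?nnegrE ?hae //.
    by rewrite mulr_ge0 // ltW.
  have sum2 : (2 * a x + e * d x) ^+ 2 <= 4 * be ^+ 2 * r ^+ 2.
    have -> : 4 * be ^+ 2 * r ^+ 2 = (be * r + be * r) ^+ 2 by ring.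
    rewrite -(real_normK (num_real (2 * a x + _))) ler_pXn2r ?nnegrE ?addr_ge0 ?mulr_ge0 ?(ltW r0) //.
    have -> : 2 * a x + e * d x = a x + (a x + e * d x) by ring.
    by apply: le_trans (ler_normD _ _) _; rewrite lerD ?ha ?hae.
  have r2 : 0 < r ^+ 2 by rewrite exprn_gt0.
  have kq : r ^+ 2 * (e * d x * (2 * a x + e * d x) * u x) ^+ 2 <=
      k * (e ^+ 2 * (d x ^+ 2 * u x ^+ 2)).
    have -> : k * (e ^+ 2 * (d x ^+ 2 * u x ^+ 2)) =
      r ^+ 2 * ((e * d x * u x) ^+ 2 * (4 * be ^+ 2 * r ^+ 2)) by rewrite /k; ring.
    have -> : (e * d x * (2 * a x + e * d x) * u x) ^+ 2 =
      (e * d x * u x) ^+ 2 * (2 * a x + e * d x) ^+ 2 by ring.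
    by rewrite ler_wpM2l ?(ltW r2) // ler_wpM2l ?sqr_ge0.
  move: kq; move: (k * _) => kk.
  move: (e * d x * (2 * a x + e * d x) * u x) (p x) (tt x) (z x) => q px t s kq.
  have m1 : s ^+ 2 <= r ^+ 2 * ((r ^+ 2)^-1 / y x * s ^+ 2).
    have -> : r ^+ 2 * ((r ^+ 2)^-1 / y x * s ^+ 2) = (y x)^-1 * s ^+ 2.
      by rewrite !mulrA divff ?mul1r // expf_neq0.
    by apply: ler_peMl => //; exact: sqr_ge0.
  have m2 : 0 <= r ^+ 2 * ((E - (a x + e * d x) ^+ 2) * s ^+ 2).
    by apply: mulr_ge0; [exact: ltW|apply: mulr_ge0; [rewrite subr_ge0|exact: sqr_ge0]].
  have m3 : 0 <= r ^+ 2 * (q - px * s + t * s) ^+ 2.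
    by apply: mulr_ge0; [exact: ltW|exact: sqr_ge0].
  have m4 : 0 <= r ^+ 2 * (px * s) ^+ 2 by apply: mulr_ge0; [exact: ltW|exact: sqr_ge0].
  move: m1 m2 m3 m4 kq; move: ((r ^+ 2)^-1 / y x) => Y1.
  move: ((a x + e * d x) ^+ 2) (r ^+ 2) => VV r2' m1 m2 m3 m4 kq.
  rewrite !expr2 in m1 m2 m3 m4 kq *; lra.
rewrite /B zr zl expr0n !mulr0 !addr0 -/k; lra.
Qed.

(** Divide by e and let e tend to 0 in S. *)
Lemma second_order_vanishes (S : set R) (X Y th : R) : limit_point S 0 ->
  S `<=` [set e | 0 < e] -> 0 <= Y -> th < 1 ->
  (forall e, S e -> 0 <= e * X + e ^+ 2 * Y <= th * (e ^+ 2 * Y)) -> Y = 0.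
Proof.
move=> lS S0 Y0 th1 hS.
have small eta : 0 < eta -> exists e, [/\ S e, 0 < e & e < eta].
  move=> eta0; have [e [_ Se he]] := lS _ (nbhsx_ballx 0 eta eta0).
  have e0 : 0 < e := S0 _ Se.
  by exists e; split=> //; move: he; rewrite /ball /= sub0r normrN gtr0_norm.
have div e : S e -> 0 <= X + e * Y /\ X + e * Y <= th * (e * Y).
  move=> Se; have e0 : 0 < e := S0 _ Se; have /andP[h1 h2] := hS _ Se.
  split; rewrite -(ler_pM2l e0) ?mulr0.
    by apply: le_trans h1 _; rewrite le_eqVlt; apply/orP; left; apply/eqP; ring.
  by rewrite [leLHS](_ : _ = e * X + e ^+ 2 * Y); last ring;
    rewrite [leRHS](_ : _ = th * (e ^+ 2 * Y)); last ring.
have X0 : 0 <= X.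
  rewrite leNgt; apply/negP => Xn.
  have eta0 : 0 < - X / (Y + 1) by rewrite divr_gt0 ?oppr_gt0 // ltr_wpDl.
  have [e [Se e0]] := small _ eta0; rewrite ltr_pdivlMr ?ltr_wpDl // => he.
  have [h1 _] := div _ Se; lra.
have [e [Se e0 _]] := small 1 ltr01.
have [_ h2] := div _ Se.
have : e * ((1 - th) * Y) <= 0 by lra.
rewrite pmulr_rle0 // pmulr_rle0 ?subr_gt0 // => Yn.
by apply/eqP; rewrite eq_le Yn Y0.
Qed.

(** For r up to the bound, [- r, r] is classically allowed at every possible
    ground state energy (the first inequality, bm being the lowest of them), and
    the constant in the second order balance stays below 1. *)
Lemma small_radius (bm bp r : R) : 0 < bm -> bm < bp -> bp < 3 * bm -> 0 < r ->
  r < Num.sqrt (3 * bm - bp) / (2 * bp) ->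
  (bp * r) ^+ 2 <= bm /\ 4 * bp ^+ 2 * r ^+ 4 < 1.
Proof.
move=> bm0 bmp bp3 r0; have bp0 : 0 < bp by lra.
have s0 : 0 < 3 * bm - bp by lra.
rewrite ltr_pdivlMr ?mulr_gt0 // => hr.
have hsq : (r * (2 * bp)) ^+ 2 < 3 * bm - bp.
  rewrite -(sqr_sqrtr (ltW s0)) ltr_pXn2r ?nnegrE ?sqrtr_ge0 //.
  by rewrite !mulr_ge0 ?(ltW r0) ?(ltW bp0).
have e1 : (r * (2 * bp)) ^+ 2 = 4 * (bp * r) ^+ 2 by ring.
have q0 : 0 <= (bp * r) ^+ 2 by exact: sqr_ge0.
split; first lra.
have bp2 : 0 < 4 * bp ^+ 2 by rewrite mulr_gt0 ?exprn_gt0.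
rewrite -(ltr_pM2l bp2) mulr1.
have -> : 4 * bp ^+ 2 * (4 * bp ^+ 2 * r ^+ 4) = (4 * (bp * r) ^+ 2) ^+ 2 by ring.
have -> : 4 * bp ^+ 2 = (2 * bp) ^+ 2 by ring.
move: hsq q0; rewrite e1; move: ((bp * r) ^+ 2) => q hsq q0.
by rewrite ltr_pXn2r ?nnegrE //; lra.
Qed.

End SecondOrder.

(** * Rigidity *)

Section Rigidity.
Context {R : realType}.
Notation mu := (@lebesgue_measure R).
Implicit Types (a b f g h u v : R -> R) (x y t c : R).

Lemma equal_potentials b b' : locint b -> locint b' ->
  measurable_fun [set: R] b -> measurable_fun [set: R] b' ->
  potential b =1 potential b' -> {ae mu, forall x, b x = b' x}.
Proof.
move=> lb lb' mb mb' eP.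
have lw : locint (fun x => b x - b' x) by exact: locintB.
have mw : measurable_fun [set: R] (fun x => b x - b' x) by exact: measurable_funB.
have h := ae_zero_of_integrals lw mw.
have /ae_imply : {ae mu, forall x, b x - b' x = 0}.
  apply: h => x y /ltW xy; rewrite RintegralB //; try exact: lb; try exact: lb'.
  by rewrite -(potentialB lb xy) -(potentialB lb' xy) !eP subrr.
by apply=> x /eqP; rewrite subr_eq0 => /eqP.
Qed.

Lemma solves_ext (K K' u u1 : R -> R) : K =1 K' -> solves K u u1 -> solves K' u u1.
Proof. by move=> eK [du du1]; split=> // x; rewrite -eK. Qed.

Lemma admissible_wells bm bp a E : 0 < bm -> admissible bm bp a ->
  eventually_ge 0 (fun x => a x ^+ 2 - E) /\ eventually_ge 0 (fun x => a (- x) ^+ 2 - E).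
Proof.
move=> bm0 ha; have [a0 _] := ha.
have W t : bm ^+ 2 * t ^+ 2 <= a t ^+ 2.
  by have /andP[+ _] := admissible_well 0 t bm0 ha; rewrite a0 sub0r sqrrN add0r.
split.
- exact: (@eventually_quadratic _ (fun x => a x ^+ 2) bm).
- by apply: (@eventually_quadratic _ (fun x => a (- x) ^+ 2) bm) => // t _; have := W (- t); rewrite sqrrN.
Qed.

(** All the currents being equal, the lowest eigenvalues at xi = 0 agree along S,
    and the second order term int d^2 phi^2 vanishes, with d the difference of
    the potentials and phi the positive ground state. *)
Lemma perturbation_vanishes bm bp b b' (S : set R) (r : R) :
  0 < bm -> bm < bp -> bp < 3 * bm -> profiles bm bp b -> profiles bm bp b' ->
  0 < r -> r < Num.sqrt (3 * bm - bp) / (2 * bp) ->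
  (forall x, r < `|x| -> potential b' x = potential b x) ->
  limit_point S 0 -> S `<=` [set e | 0 < e <= 1] ->
  (forall e, S e -> same_current (mix b b' e) b) ->
  forall x, - r < x < r -> potential b' x = potential b x.
Proof.
move=> bm0 bmp bp3 hb hb' r0 rlt hout lS S1 hS.
have [hr hth] := small_radius bm0 bmp bp3 r0 rlt.
have [bp0 rr] : 0 < bp /\ - r <= r by split; lra.
have lb := profile_locint hb; have lb' := profile_locint hb'.
have ha := profile_admissible hb.
pose a := potential b; pose d x := potential b' x - potential b x.
have ca : continuous a := admissible_continuous bm0 ha.
have cd : continuous d.
  exact: continuousD' (admissible_continuous bm0 (profile_admissible hb')) (continuousN' ca).
have mixE e x : potential (mix b b' e) x = a x + e * d x := potential_mix e x lb lb'.
have dout x : r < `|x| -> d x = 0 by move=> hx; rewrite /d hout // subrr.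
have bound f : admissible bm bp f -> forall x, - r <= x <= r -> `|f x| <= bp * r.
  move=> hf x hx; have := admissible_lipschitz x 0 bm0 hf; have [-> _] := hf; rewrite !subr0.
  by move/le_trans; apply; rewrite ler_pM2l // ler_norml.
have [/andP[E1 E2] [u1 [su u0 iu _]]] := phi1_spec bm0 (ltW bmp) bp3 ha 0.
have sq0 f x : (0 - f x) ^+ 2 = f x ^+ 2 :> R by rewrite sub0r sqrrN.
have suE : solves (fun x => a x ^+ 2 - lambda1 b 0) (phi1 b 0) u1.
  by apply: solves_ext su => x; rewrite sq0.
set u := phi1 b 0 in suE u0 iu *.
have cu : continuous u := solves_continuous suE.
have cF : continuous (fun x => 2 * d x * a x * u x ^+ 2) by cont.
have cH : continuous (fun x => d x ^+ 2 * u x ^+ 2) by cont.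
have dF := has_der_potential cF; have dH := has_der_potential cH.
set F := potential _ in dF; set H := potential _ in dH.
have main e : S e ->
  0 <= e * (F r - F (- r)) + e ^+ 2 * (H r - H (- r)) <=
    (4 * bp ^+ 2 * r ^+ 4) * (e ^+ 2 * (H r - H (- r))).
  move=> Se; have /andP[e0 e1] := S1 _ Se.
  have e01 : 0 <= e <= 1 by rewrite (ltW e0).
  have hm := admissible_mix hb hb' e01.
  have mout x : r < `|x| -> potential (mix b b' e) x = potential b x.
    by move=> hx; rewrite mixE dout // mulr0 addr0.
  have hE := same_current_energy bm0 (ltW bmp) bp3 ha hm r0 mout
    (fun chi hchi => esym (hS _ Se chi hchi)) 0.
  have [_ [v1 [sv v0 iv _]]] := phi1_spec bm0 (ltW bmp) bp3 hm 0.
  move: sv v0 iv; rewrite hE; move: (phi1 (mix b b' e) 0) => v sv v0 iv.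
  have svE : solves (fun x => (a x + e * d x) ^+ 2 - lambda1 b 0) v v1.
    by apply: solves_ext sv => x; rewrite sq0 mixE.
  have [wu1 wu2] := admissible_wells (lambda1 b 0) bm0 ha.
  have [wv1 wv2] := admissible_wells (lambda1 b 0) bm0 hm.
  have fE : potential (mix b b' e) = (fun x => a x + e * d x) by apply/funext => x; exact: mixE.
  rewrite fE in wv1 wv2 hm.
  have Kout x : r < `|x| -> a x ^+ 2 - lambda1 b 0 = (a x + e * d x) ^+ 2 - lambda1 b 0.
    by move=> hx; congr (_ ^+ 2 - _); rewrite dout // mulr0 addr0.
  apply: (second_order_balance r0 (ltW bp0) suE svE v0 cu ca cd _ _ (bound _ ha) (bound _ hm) (le_trans hr E1) dF dH).
  - apply: (wronskian_zero_right suE svE wu1 wv1 u0 v0 iu iv) => x hx; apply: Kout.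
    by apply: lt_le_trans hx _; exact: ler_norm.
  - apply: (wronskian_zero_left suE svE wu2 wv2 u0 v0 iu iv) => x hx; apply: Kout.
    by rewrite -normrN; apply: lt_le_trans (ler_norm _); rewrite ltrNr.
have Hinc x y : x <= y -> H x <= H y.
  by move=> xy; apply: (der_ge0_le xy (fun z _ => dH z)) => z _; rewrite mulr_ge0 ?sqr_ge0.
have Y0 : H r - H (- r) = 0.
  apply: (second_order_vanishes lS (fun e Se => proj1 (andP (S1 e Se))) _ hth main).
  by rewrite subr_ge0 Hinc.
move=> x /andP[x1 x2]; apply/eqP; rewrite -subr_eq0 -/(d x); apply/negP => /negP dn.
(* H is constant on [- r, r], so its derivative d^2 u^2 vanishes inside *)
have Hmax : forall t, t \in `]- r, r[%R -> H t <= H x.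
  move=> t; rewrite in_itv /= => /andP[t1 t2].
  apply: le_trans (Hinc _ _ (ltW t2)) _.
  by move/eqP: Y0; rewrite subr_eq0 => /eqP ->; exact: Hinc (ltW x1).
have xin : x \in `]- r, r[%R by rewrite in_itv /= x1.
have h0 := @derive1_at_max _ H (- r) r x rr (fun t _ => @ex_derive _ _ _ _ _ _ _ (dH t)) xin Hmax.
have := @derive_val _ _ _ _ _ _ _ h0.
rewrite (@derive_val _ _ _ _ _ _ _ (dH x)) => /eqP.
by rewrite mulf_eq0 !sqrf_eq0 (negbTE dn) gt_eqF.
Qed.

End Rigidity.

Theorem corollary2p2 (R : realType) (bm bp : R) (b bt : R -> R)
    (hbm : 0 < bm) (hbmp : bm < bp) (hbp : bp < 3 * bm)
    (hb : profiles bm bp b) (hbt : profiles bm bp bt)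
    (hsupp : exists2 r : R, 0 < r < Num.sqrt (3 * bm - bp) / (2 * bp) &
       supp (fun x => potential bt x - potential b x) `<=` `[- r, r])
    (hacc : limit_point
       [set e : R | 0 < e <= 1 /\ same_current (mix b bt e) b] 0) :
  {ae @lebesgue_measure R, forall x, bt x = b x}.
Proof.
have [r /andP[r0 rlt] hr] := hsupp.
have out x : r < `|x| -> potential bt x = potential b x.
  move=> hx; apply/eqP; rewrite -subr_eq0; apply/negP => /negP dn.
  have : supp (fun x => potential bt x - potential b x) x by exact: subset_closure.
  by move/hr; rewrite /= in_itv /= -ler_norml leNgt hx.
(* the points at distance r from 0 must be interior, so as to be reached by
   the vanishing of the integral *)
pose r' := (r + Num.sqrt (3 * bm - bp) / (2 * bp)) / 2.
have [rr' r'lt] : r < r' /\ r' < Num.sqrt (3 * bm - bp) / (2 * bp).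
  by rewrite /r'; move: rlt; move: (_ / (2 * bp)) => q rlt; split; lra.
apply: (equal_potentials (profile_locint hbt) (profile_locint hb)
  (profile_measurable hbt) (profile_measurable hb)) => x.
have [hx|/out //] := leP `|x| r.
apply: (perturbation_vanishes hbm hbmp hbp hb hbt (lt_trans r0 rr') r'lt _ hacc).
- by move=> y hy; apply: out; exact: lt_trans rr' hy.
- by move=> e [].
- by move=> e [].
- by have := le_lt_trans hx rr'; rewrite ltr_norml.
Qed.
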